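(* Suppose that $\mathrm{P}_{\theta}(qR>2)=1$. Let $r:\mathbb{R}\to[0,c_1]$ be any bounded differentiable non-negative function with bounded derivative $|r'|\le c_2$. Let $$G=\frac{r^2(F)}{F^2}S^{+}XX^{\top}S^{+}S,\qquad g(X,S)=\frac{r(F)}{F}SS^{+}X,\qquad H=AGA^{-1},\qquad \tilde Y=\sqrt{q}\,YA^{-1}.$$ Then: (i) $\mathrm{E}_{\theta}\left[\left|\mathrm{div}_{\mathrm{vec}(\tilde Y)}\mathrm{vec}(\tilde Y H)\right|\right]<\infty$; (ii) $\mathrm{E}_{\theta}\left[\left|\mathrm{tr}\left(\nabla_X g(X,S)^{\top}\right)\right|\right]<\infty$; (iii) $$\mathrm{E}_{\theta}\left[\mathrm{tr}\left(g^{\top}(X,S)\Sigma^{-1}g(X,S)\right)\right]=\frac1q\,\mathrm{E}_{\theta}\left[\frac{r^2(F)}{F}\left(nq+p-2\,\mathrm{tr}(SS^{+})-1+\frac{4\,\mathrm{tr}\left((X^{\top}S^{+}X)^2\right)}{F^2}\right)-\frac{4r(F)r'(F)}{F^2}\mathrm{tr}\left((X^{\top}S^{+}X)^2\right)\right].$$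
   Context: Fix integers $n,p,q\ge1$, a $p\times q$ real matrix $\theta$ and a $p\times p$ symmetric positive definite matrix $\Sigma$. The random $p\times q$ matrix $X\sim\mathcal N_{p\times q}(\theta,\Sigma\otimes I_q)$ has independent columns, the $j$-th column being $\mathcal N_p(\theta_{\cdot j},\Sigma)$. The random $nq\times p$ matrix $Y\sim\mathcal N_{nq\times p}(0,I_{nq}\otimes(\Sigma/q))$ has i.i.d. rows distributed as $\mathcal N_p(0,\Sigma/q)$. Set $S=Y^{\top}Y$; $X$ and $S$ are independent. $\mathrm P_\theta,\mathrm E_\theta$ denote probability and expectation under this model. $S^{+}$ is the Moore–Penrose inverse of $S$, $R=\mathrm{rank}(S)$, and $F=\mathrm{tr}(X^{\top}S^{+}X)$ (which is positive almost surely). $A$ is the symmetric positive definite square root of $\Sigma$. $\mathrm{div}_{\mathrm{vec}(\tilde Y)}\mathrm{vec}(\tilde YH)=\sum_{\alpha,i}\partial(\tilde YH)_{\alpha i}/\partial\tilde Y_{\alpha i}$, where $X$ is held fixed and $Y=\tilde YA/\sqrt q$, $S=Y^\top Y$, $F$, $G$, $H$ are regarded as functions of $\tilde Y$ (the derivatives exist almost surely). $\mathrm{tr}(\nabla_Xg(X,S)^{\top})=\sum_{i,j}\partial g_{ij}(X,S)/\partial X_{ij}$, with $S$ held fixed. *)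

(* Defs.v *)
From HB Require Import structures.
From mathcomp Require Import all_boot all_order all_algebra.
From mathcomp Require Import all_classical all_reals all_analysis.

Set Implicit Arguments.
Unset Strict Implicit.
Unset Printing Implicit Defensive.

Import Order.TTheory GRing.Theory Num.Theory.
Import numFieldTopology.Exports numFieldNormedType.Exports.

Local Open Scope classical_set_scope.
Local Open Scope ring_scope.

Section linear_algebra.
Context {R : realType}.

Definition posdefmx p (M : 'M[R]_p) : Prop :=
  M^T = M /\ forall v : 'cV[R]_p, v != 0 -> 0 < (v^T *m M *m v) 0 0.

Definition is_mpinv m n (M : 'M[R]_(m, n)) (B : 'M[R]_(n, m)) : Prop :=
  [/\ M *m B *m M = M, B *m M *m B = B,
      (M *m B)^T = M *m B & (B *m M)^T = B *m M].

Definition mpinv m n (M : 'M[R]_(m, n)) : 'M[R]_(n, m) :=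
  xget 0 [set B | is_mpinv M B].

Lemma gram_unitmx r n (D : 'M[R]_(r, n)) : row_free D -> D *m D^T \in unitmx.
Proof.
move=> fD; rewrite -row_free_unit -kermx_eq0; apply/rowV0P => v.
move=> /sub_kermxP; rewrite mulmxA => vDD.
have : (v *m D) *m (v *m D)^T = 0 by rewrite trmx_mul mulmxA vDD mul0mx.
move=> /matrixP /(_ 0 0); rewrite !mxE => /eqP.
rewrite psumr_eq0; last by move=> i _; rewrite [X in _ * X]mxE -expr2 sqr_ge0.
move=> /allP vD0; apply: (row_free_inj fD); rewrite mul0mx.
apply/rowP => i; rewrite [RHS]mxE.
have := vD0 i (mem_index_enum i).
by rewrite [X in _ * X]mxE -expr2 sqrf_eq0 => /eqP.
Qed.

Lemma is_mpinv_factor m r n (C : 'M[R]_(m, r)) (D : 'M[R]_(r, n)) :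
  row_full C -> row_free D ->
  is_mpinv (C *m D)
    (D^T *m invmx (D *m D^T) *m invmx (C^T *m C) *m C^T).
Proof.
move=> fC fD; have uD : D *m D^T \in unitmx by exact: gram_unitmx.
have uC : C^T *m C \in unitmx.
  rewrite -[X in _ *m X]trmxK; apply: gram_unitmx.
  by rewrite /row_free mxrank_tr -/(row_full C).
set K := D *m D^T in uD *; set L := C^T *m C in uC *.
have MB : C *m D *m (D^T *m invmx K *m invmx L *m C^T) = C *m invmx L *m C^T.
  rewrite !mulmxA -(mulmxA C D) -/K -(mulmxA C K).
  by rewrite mulmxV // mulmx1.
have BM : D^T *m invmx K *m invmx L *m C^T *m (C *m D) = D^T *m invmx K *m D.
  rewrite !mulmxA -(mulmxA _ C^T C) -/L -(mulmxA _ (invmx L) L).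
  by rewrite mulVmx // mulmx1.
have Ksym : K^T = K by rewrite trmx_mul trmxK.
have Lsym : L^T = L by rewrite trmx_mul trmxK.
split; rewrite ?MB ?BM.
- rewrite !mulmxA -(mulmxA _ C^T C) -/L -(mulmxA C (invmx L)).
  by rewrite mulVmx // mulmx1.
- rewrite !mulmxA -(mulmxA _ D D^T) -/K -(mulmxA _ (invmx K) K).
  by rewrite mulVmx // mulmx1.
- by rewrite !trmx_mul trmxK trmx_inv Lsym mulmxA.
- by rewrite !trmx_mul trmxK trmx_inv Ksym mulmxA.
Qed.

Lemma mpinvP m n (M : 'M[R]_(m, n)) : is_mpinv M (mpinv M).
Proof.
suff [B MB] : exists B, is_mpinv M B by exact: (@xgetPex _ 0 (is_mpinv M)
  (ex_intro _ B MB)).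
have := is_mpinv_factor (col_base_full M) (row_base_free M).
by rewrite mulmx_base => ?; eexists; eassumption.
Qed.

Lemma is_mpinv_uniq m n (M : 'M[R]_(m, n)) (B1 B2 : 'M[R]_(n, m)) :
  is_mpinv M B1 -> is_mpinv M B2 -> B1 = B2.
Proof.
move=> [a1 b1 c1 d1] [a2 b2 c2 d2].
have MB : M *m B1 = M *m B2.
  transitivity ((M *m B2 *m (M *m B1))^T); last first.
    by rewrite trmx_mul c1 c2 mulmxA a1.
  by rewrite mulmxA a2 c1.
have BM : B1 *m M = B2 *m M.
  transitivity ((B1 *m M *m (B2 *m M))^T); last first.
    by rewrite trmx_mul d1 d2 -!mulmxA (mulmxA M) a1.
  by rewrite -mulmxA (mulmxA M) a2 d1.
by rewrite -b1 BM -mulmxA MB mulmxA b2.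
Qed.

End linear_algebra.

Definition measure_matrix_display : measure_display -> measure_display.
Proof. exact. Qed.

Definition matrix_cylinders d (T : measurableType d) (m n : nat) :
    set (set 'M[T]_(m, n)) :=
  [set E | exists i j (B : set T),
     measurable B /\ E = (fun M : 'M[T]_(m, n) => M i j) @^-1` B].

Section measurable_matrix.
Context {d} {T : measurableType d} {m n : nat}.

HB.instance Definition _ := @isMeasurable.Build (measure_matrix_display d)
  'M[T]_(m, n) <<s @matrix_cylinders d T m n >>
  (@sigma_algebra0 _ setT _) (@sigma_algebraC _ _)
  (@sigma_algebra_bigcup _ setT _).

Lemma measurable_mx_coord (i : 'I_m) (j : 'I_n) :
  measurable_fun [set: 'M[T]_(m, n)] (fun M : 'M[T]_(m, n) => M i j).
Proof.
by move=> _ B mB; rewrite setTI; apply: sub_sigma_algebra; exists i, j, B.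
Qed.

Lemma measurable_fun_mxP d' (U : measurableType d') (f : U -> 'M[T]_(m, n)) :
  measurable_fun [set: U] f <->
  forall i j, measurable_fun [set: U] (fun u => f u i j).
Proof.
split=> [mf i j|mf]; first exact: (measurableT_comp (measurable_mx_coord i j)).
apply: (@measurability _ _ _ _ [set: U] f (@matrix_cylinders d T m n)) => //.
by move=> _ [_ [i [j [B [mB ->]]]] <-]; exact: mf.
Qed.

End measurable_matrix.

Section gaussian_model.
Context d (Omega : measurableType d) (R : realType) (P : probability Omega R).

(* Subfamilies are covered by taking some [E i] equal to [setT]. *)
Definition mutually_independent d' (T : measurableType d') (I : finType)
    (Z : I -> Omega -> T) : Prop :=
  forall E : I -> set T, (forall i, measurable (E i)) ->
    P (\bigcap_i (Z i @^-1` E i)) = (\prod_i P (Z i @^-1` E i))%E.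

Definition independent d1 d2 (T1 : measurableType d1) (T2 : measurableType d2)
    (Z1 : Omega -> T1) (Z2 : Omega -> T2) : Prop :=
  forall (E1 : set T1) (E2 : set T2), measurable E1 -> measurable E2 ->
    P (Z1 @^-1` E1 `&` Z2 @^-1` E2) = (P (Z1 @^-1` E1) * P (Z2 @^-1` E2))%E.

Definition is_std_normal p (nu : probability 'cV[R]_p R) : Prop :=
  forall E : 'I_p -> set R, (forall i, measurable (E i)) ->
    nu [set z | forall i, E i (z i 0)] = (\prod_i normal_prob 0 1 (E i))%E.

(* N_p(mu, Sigma) is the law of mu + B z, with B B^T = Sigma and z standard
   normal; it does not depend on the choice of B. *)
Definition normal_vector p (mu : 'cV[R]_p) (Sigma : 'M[R]_p)
    (Z : Omega -> 'cV[R]_p) : Prop :=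
  exists (B : 'M[R]_p) (nu : probability 'cV[R]_p R),
    [/\ B *m B^T = Sigma, is_std_normal nu &
      forall E : set 'cV[R]_p, measurable E ->
        P (Z @^-1` E) = nu ((fun z => mu + B *m z) @^-1` E)].

Definition normal_matrix_cols p q (theta : 'M[R]_(p, q)) (Sigma : 'M[R]_p)
    (X : Omega -> 'M[R]_(p, q)) : Prop :=
  mutually_independent (fun j w => col j (X w)) /\
  forall j, normal_vector (col j theta) Sigma (fun w => col j (X w)).

Definition normal_matrix_rows m p (Sigma : 'M[R]_p)
    (Y : Omega -> 'M[R]_(m, p)) : Prop :=
  mutually_independent (fun i w => row i (Y w)) /\
  forall i, normal_vector 0 Sigma (fun w => (row i (Y w))^T).

End gaussian_model.

Section estimation.
Context {R : realType}.

Definition gram m p (Y : 'M[R]_(m, p)) : 'M[R]_p := Y^T *m Y.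

Definition Fstat p q (X : 'M[R]_(p, q)) (S : 'M[R]_p) : R :=
  \tr (X^T *m mpinv S *m X).

Definition Gmat (r : R -> R) p q (X : 'M[R]_(p, q)) (S : 'M[R]_p) : 'M[R]_p :=
  (r (Fstat X S) ^+ 2 / Fstat X S ^+ 2) *:
    (mpinv S *m X *m X^T *m mpinv S *m S).

Definition gfun (r : R -> R) p q (X : 'M[R]_(p, q)) (S : 'M[R]_p) :
    'M[R]_(p, q) :=
  (r (Fstat X S) / Fstat X S) *: (S *m mpinv S *m X).

Definition Hmat (r : R -> R) p q (A : 'M[R]_p) (X : 'M[R]_(p, q))
    (S : 'M[R]_p) : 'M[R]_p :=
  A *m Gmat r X S *m invmx A.

Definition Ytilde m p (q : nat) (A : 'M[R]_p) (Y : 'M[R]_(m, p)) :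
    'M[R]_(m, p) :=
  Num.sqrt q%:R *: (Y *m invmx A).

(* Inverse of [Ytilde] in [Y], for invertible [A] and [0 < q]. *)
Definition Yof m p (q : nat) (A : 'M[R]_p) (Yt : 'M[R]_(m, p)) : 'M[R]_(m, p) :=
  (Num.sqrt q%:R)^-1 *: (Yt *m A).

Definition YtildeH (r : R -> R) m p q (A : 'M[R]_p) (X : 'M[R]_(p, q))
    (Yt : 'M[R]_(m, p)) : 'M[R]_(m, p) :=
  Yt *m Hmat r A X (gram (Yof q A Yt)).

(* Both div_vec(Z) vec(f Z) and tr (nabla f(Z) ^T). The operator ['D_] is total:
   its value is arbitrary where the partial derivative does not exist. *)
Definition mxdiv m n (f : 'M[R]_(m, n) -> 'M[R]_(m, n)) (Z : 'M[R]_(m, n)) : R :=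
  \sum_i \sum_j 'D_(delta_mx i j) (fun W : 'M[R]_(m, n) => f W i j) Z.

End estimation.

(* Main.v *)
(* Stein's identity along single coordinates of X and Y does all the work.  It
   comes from the one-dimensional Cameron-Martin formula, transported to matrices
   by resampling one coordinate: replacing the k-th coordinate of B^-1 (Z - mu) by
   an independent standard normal variable does not change the law of Z, since the
   two laws agree on boxes.

   Identity (iii), for fixed X = x and with phi = r^2 / t^2.  The vector field
   Y |-> phi(F) Y G is singular where Y drops rank, so S^+ is replaced by
   C = (S + delta)^-1, for which U = Y C, W = U Y^T and P = C S satisfy bounds
   uniform in delta (|W| <= 1, U^T U = C S C, ...).  The divergence of the
   regularised field is an explicit expression bounded by constants times
   sup |t phi| and sup |t^2 phi'|; delta -> 0 by dominated convergence.  As F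
   depends on delta this limit requires phi' to be continuous, which is obtained
   by replacing phi with k \int_t^(t+1/k) phi.  Finally phi = r^2 / (t^2 + eps) is
   integrated over X by independence, and eps -> 0: monotone convergence on the
   left, dominated convergence with bound a + b / F on the right.

   That 1 / F is integrable (whence F > 0 almost surely) is Stein's identity in X,
   for fixed S, applied to S S^+ X / (F + eps): the divergence is at least
   (q R - 2) / (F + eps) >= 1 / (F + eps), and Cauchy-Schwarz on the other side
   bounds E 1 / (F + eps) by E |Y|^2 E |Sigma^-1 (X - theta)|^2.

   For (i) and (ii) the divergences are computed pointwise where F > 0 and Y has
   full rank (an event of probability 1) and are bounded by a + b / F.  There
   U = Y S^+ is differentiable with
   dU = (1 - U Y^T) D U^T U + U U^T D (1 - Y^T U) - U D^T U. *)
Require Import Defs.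
From HB Require Import structures.
From mathcomp Require Import all_boot all_order all_algebra.
From mathcomp Require Import all_classical all_reals all_analysis.
From mathcomp Require Import measurable_realfun ring lra.

Set Implicit Arguments.
Unset Strict Implicit.
Unset Printing Implicit Defensive.

Import Order.TTheory GRing.Theory Num.Theory.
Import numFieldTopology.Exports numFieldNormedType.Exports.

Local Open Scope classical_set_scope.
Local Open Scope ring_scope.

(** * Gaussian integration by parts on the line *)

Import HBNNSimple.

(** Two singularities are removed, in a forced order. The loss of rank of [Y] is treated with [x]
    fixed, under bounds that depend on the parameter [e] of [weight]. The zero of F comes
    afterwards, because the bound a + b / F is integrable thanks to the averaging over [X]; nothing
    is known of 1 / F for a fixed [x]. The matrices of deficient rank form a null set, yet they
    cannot just be discarded: integration by parts asks for a bounded derivative along whole lines,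
    and lines cross that set. Independence is available between [X] and S only, not between [X] and
    Y. Every quantity integrated jointly is therefore a function of [X] and S ([gram_div],
    [gram_quad]); those that see Y itself ([reg_root], [reg_hat]) occur for fixed [x] only. In the
    constant nq + p - 2 tr (S S^+) - 1, the - 1 is 1 - 2: the regularised divergence carries + F and
    - 2 tr (v^T W v) with v = U x, and the latter trace tends to F. The term 4 tr ((X^T S^+ X)^2) /
    F^2 is the derivative of t^-2 in r^2 / t^2. *)

Section gauss1_measure.
Context {R : realType}.

(* [normal_prob 0 1] lives on [measurableTypeR R], whose display differs from
   the one of the canonical structure of [R]; this is a copy on [R]. *)
Definition gauss1 : set R -> \bar R := normal_prob 0 1.

Let gauss1_0 : gauss1 set0 = 0%E. Proof. exact: measure0. Qed.

Let gauss1_ge0 A : (0 <= gauss1 A)%E. Proof. exact: measure_ge0. Qed.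

Let gauss1_semi_sigma_additive : semi_sigma_additive gauss1.
Proof. exact: (@measure_semi_sigma_additive _ _ _ (normal_prob (0 : R) 1)). Qed.

HB.instance Definition _ := isMeasure.Build _ _ _ gauss1
  gauss1_0 gauss1_ge0 gauss1_semi_sigma_additive.

Let gauss1_setT : gauss1 setT = 1%E.
Proof. exact: (probability_setT (normal_prob (0 : R) 1)). Qed.

HB.instance Definition _ :=
  @Measure_isProbability.Build _ _ R gauss1 gauss1_setT.

End gauss1_measure.
Arguments gauss1 R : clear implicits.

Section normal_law.
Context {R : realType}.
Implicit Types (f : R -> R) (x h : R).
Local Notation mu := (@lebesgue_measure R).
Local Notation N01 := (gauss1 R).

(** For indicators this is how [normal_prob] is defined; linearity gives nonnegative simple
    functions, and monotone convergence along [nnsfun_approx] on both sides gives the rest. *)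
Lemma ge0_integral_gauss1 (f : R -> \bar R) : measurable_fun [set: R] f ->
  (forall x, 0 <= f x)%E ->
  (\int[N01]_x f x = \int[mu]_x (f x * (normal_pdf 0 1 x)%:E))%E.
Proof.
move=> mf f0.
have mpdf := @measurable_normal_pdf R 0 1.
have pdf0 x : (0 <= (normal_pdf 0 1 x)%:E :> \bar R)%E.
  by rewrite lee_fin normal_pdf_ge0.
pose f_ := nnsfun_approx measurableT mf.
have cf x : (f_ n x)%:E @[n --> \oo] --> f x by exact: cvg_nnsfun_approx.
have nd x m n : (m <= n)%N -> f_ m x <= f_ n x.
  by move=> mn; have /lefP := nd_nnsfun_approx measurableT mf mn.
have mf_ n : measurable_fun [set: R] (fun x => (f_ n x)%:E : \bar R).
  exact/measurable_EFinP.
have mp : measurable_fun [set: R] (fun x => (normal_pdf 0 1 x)%:E : \bar R).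
  exact/measurable_EFinP.
transitivity (limn (fun n => \int[N01]_x (f_ n x)%:E))%E.
  rewrite -monotone_convergence//.
  - by apply: eq_integral => y _; apply/esym/cvg_lim.
  - by move=> n y _; rewrite lee_fin.
  - by move=> y _ m n mn; rewrite lee_fin nd.
rewrite [X in limn X](_ : _ =
    (fun n => \int[mu]_x ((f_ n x)%:E * (normal_pdf 0 1 x)%:E))%E).
  rewrite -monotone_convergence//.
  - apply: eq_integral => y _; apply/cvg_lim => //.
    apply: cvgeZr; [by []|exact: cf].
  - by move=> n; apply: emeasurable_funM; [exact: mf_|exact: mp].
  - by move=> n y _; rewrite mule_ge0// lee_fin.
  - by move=> y _ m n mn; rewrite lee_wpmul2r// lee_fin nd.
apply/funext => n.
under eq_integral do rewrite fimfunE -fsumEFin//.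
under [RHS]eq_integral.
  move=> x _; rewrite fimfunE -fsumEFin// ge0_mule_fsuml; last first.
    by move=> r; exact: nnfun_muleindic_ge0.
  over.
have mi r : measurable_fun [set: R]
    (fun x => (\1_(f_ n @^-1` [set r]) x)%:E : \bar R).
  by apply/measurable_EFinP.
rewrite ge0_integral_fsum//; first last.
- by move=> y x _; rewrite nnfun_muleindic_ge0.
- by move=> r; under eq_fun do rewrite EFinM; apply: emeasurable_funM.
rewrite ge0_integral_fsum//; first last.
- by move=> y x _; rewrite mule_ge0// nnfun_muleindic_ge0.
- move=> r; under eq_fun do rewrite EFinM; apply: emeasurable_funM => //.
    by apply: emeasurable_funM => //; exact: mi.
apply: eq_fsbigr => r rf.
have r0 : 0 <= r by move: rf => /[!inE] -[y _ <-].
under eq_integral do rewrite EFinM.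
rewrite ge0_integralZl//.
rewrite integral_indic// setIT.
under [RHS]eq_integral do rewrite EFinM -muleA.
rewrite ge0_integralZl//; last 2 first.
- by apply: emeasurable_funM; [exact: mi|exact: mp].
- by move=> x _; rewrite mule_ge0// lee_fin.
congr (_ * _)%E; rewrite /gauss1 /normal_prob [LHS]integral_mkcond.
apply: eq_integral => x _; rewrite patchE indicE.
by case: ifPn => _; rewrite ?mul1e ?mul0e.
Qed.

Lemma normal_pdf_shift x h :
  normal_pdf 0 1 (x - h) = normal_pdf 0 1 x * expR (h * x - h ^+ 2 / 2).
Proof.
rewrite !normal_pdfE ?oner_neq0// /normal_fun -mulrA -expRD; congr (_ * expR _).
by rewrite !subr0 expr1n -mulr_natr; field.
Qed.

(** The Cameron-Martin formula: Lebesgue measure is translated by [h], and the shifted density is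
    rewritten with [normal_pdf_shift]. Nonnegativity of [f] spares any integrability condition. *)
Lemma ge0_normal_shift f h : continuous f -> (forall x, 0 <= f x) ->
  (\int[N01]_x (f (x + h))%:E =
   \int[N01]_x (f x * expR (h * x - h ^+ 2 / 2))%:E)%E.
Proof.
move=> cf f0.
have mf : measurable_fun [set: R] f by exact: continuous_measurable_fun.
have me : measurable_fun [set: R] (fun x => expR (h * x - h ^+ 2 / 2)).
  by apply: measurableT_comp => //; exact: measurable_funB.
rewrite ge0_integral_gauss1//; last 2 first.
- apply/measurable_EFinP; apply: (measurableT_comp mf).
  exact: measurable_funD.
- by move=> x; rewrite lee_fin.
rewrite ge0_integral_gauss1//; last 2 first.
- by apply/measurable_EFinP; apply: measurable_funM.
- by move=> x; rewrite lee_fin mulr_ge0// expR_ge0.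
pose G x := f x * normal_pdf 0 1 (x - h).
transitivity (\int[mu]_x (G x)%:E)%E; last first.
  apply: eq_integral => x _; rewrite /G normal_pdf_shift -EFinM.
  by congr EFin; ring.
have dF (x : R) : is_derive x 1 (fun y : R => y + h) 1.
  by apply: is_derive_eq; rewrite addr0.
have F'E : (fun y : R => y + h)^`()%classic = cst 1.
  by apply/funext => x; rewrite derive1E derive_val.
rewrite [RHS](@increasing_ge0_integration_by_substitutionT _ (fun y => y + h)).
- apply: eq_integral => x _; rewrite F'E /= /G.
  by rewrite !fctE mulr1 addrK EFinM.
- by move=> x y xy; rewrite ltrD2r.
- by rewrite F'E; exact: cst_continuous.
- by rewrite F'E; exact: is_cvg_cst.
- by rewrite F'E; exact: is_cvg_cst.
- by move=> x; exact: ex_derive.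
- exact: cvg_addrr_Ny.
- exact: cvg_addrr.
- move=> x; apply: cvgM; first exact: cf.
  apply: (@continuous_comp _ _ _ (fun y => y - h) (normal_pdf 0 1)).
    by apply: cvgB; [exact: cvg_id|exact: cvg_cst].
  by apply: continuous_normal_pdf; rewrite oner_neq0.
- by move=> x; rewrite mulr_ge0// normal_pdf_ge0.
Qed.

End normal_law.

Section difference_quotient.
Context {R : realType}.

(** A derivative taken along a sequence: this is the form that dominated convergence consumes, and
    it exhibits derivatives as limits of measurable functions. *)
Lemma cvg_harmonic_quotient (f : R -> R) (x df : R) : is_derive x 1 f df ->
  n.+1%:R * (f (x + n.+1%:R^-1) - f x) @[n --> \oo] --> df.
Proof.
move=> fx; have /cvg_ex[/= l fl] := @ex_derive _ _ _ _ _ _ _ fx.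
have <- : l = df.
  by rewrite -(@derive_val _ _ _ _ _ _ _ fx); apply/esym/cvg_lim.
have H : (forall n, n.+1%:R^-1 != 0 :> R) /\ n.+1%:R^-1 @[n --> \oo] --> (0 : R).
  by split=> [n|]; [rewrite invr_eq0 pnatr_eq0|exact: cvg_harmonic].
have := (@cvgr_dnbhsP _ _ _ _).1 fl (fun n => n.+1%:R^-1) H.
apply: cvg_trans.
apply: near_eq_cvg; apply: nearW => n /=.
by rewrite invrK [_%:A]mulr1 [x + _]addrC.
Qed.

Lemma lipschitz_of_derive_bounded (f f' : R -> R) (K x y : R) :
  x <= y -> (forall z, x <= z -> is_derive z 1 f (f' z)) ->
  (forall z, x <= z -> `|f' z| <= K) -> `|f y - f x| <= K * (y - x).
Proof.
rewrite le_eqVlt => /predU1P[<-|xy] df bf.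
  by rewrite !subrr normr0 mulr0.
have dxy z : z \in `]x, y[ -> is_derive z 1 f (f' z).
  by rewrite in_itv/= => /andP[/ltW xz _]; exact: df.
have cf : {within `[x, y], continuous f}.
  apply: derivable_within_continuous => z; rewrite in_itv/= => /andP[xz _].
  by have := df _ xz => ?; exact: ex_derive.
have [c cxy ->] := MVT xy dxy cf.
rewrite normrM (gtr0_norm (_ : 0 < y - x)) ?subr_gt0// ler_wpM2r//.
  by rewrite subr_ge0 ltW.
by apply: bf; move: cxy; rewrite in_itv/= => /andP[/ltW].
Qed.

End difference_quotient.

Lemma bounded_integrable d (T : measurableType d) (R : realType)
    (P : probability T R) (f : T -> R) (K : R) :
  measurable_fun [set: T] f -> (forall x, `|f x| <= K) ->
  P.-integrable [set: T] (EFin \o f).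
Proof.
move=> mf bf; apply: measurable_bounded_integrable => //=.
  by rewrite probability_setT ltry.
exists K; split; first exact: num_real.
by move=> y Ky x _ /=; rewrite (le_trans (bf x))// ltW.
Qed.

Section real_dominated_convergence.
Context d (T : measurableType d) (R : realType).
Variable mu : {measure set T -> \bar R}.

Lemma cvg_integral_dominated (f_ : nat -> T -> R) (f g : T -> R) :
  (forall n, measurable_fun [set: T] (f_ n)) -> measurable_fun [set: T] f ->
  {ae mu, forall x, f_ n x @[n --> \oo] --> f x} ->
  mu.-integrable [set: T] (EFin \o g) ->
  {ae mu, forall x n, `|f_ n x| <= g x} ->
  (\int[mu]_x (f_ n x)%:E @[n --> \oo] --> \int[mu]_x (f x)%:E)%E.
Proof.
move=> mf_ mf cf ig bf.
have mf_E n : measurable_fun [set: T] (EFin \o f_ n) by exact/measurable_EFinP.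
have mfE : measurable_fun [set: T] (EFin \o f) by exact/measurable_EFinP.
have cfE : {ae mu, forall x, [set: T] x ->
    (EFin \o f_ n) x @[n --> \oo] --> (EFin \o f) x}.
  by apply: filterS cf => x cfx _; apply: cvg_EFin; [exact: nearW|exact: cfx].
have bfE : {ae mu, forall x n, [set: T] x ->
    (`|(EFin \o f_ n) x| <= (EFin \o g) x)%E}.
  by apply: filterS bf => x bfx n _; rewrite /= lee_fin.
by have [] := dominated_convergence measurableT mf_E mfE cfE ig bfE.
Qed.

End real_dominated_convergence.

Section stein_normal.
Context {R : realType}.
Implicit Types (f : R -> R) (x h : R).
Local Notation N01 := (gauss1 R).

(** Shifting the constant 1 by [c] gives total mass 1 on one side and the exponential moment, times
    exp (- c^2 / 2), on the other. *)
Lemma gauss1_integrable_expR c :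
  N01.-integrable setT (fun z => (expR (c * z))%:E).
Proof.
apply/integrableP; split.
  by apply/measurable_EFinP; apply: measurableT_comp => //; exact: measurable_funM.
under eq_integral do rewrite gee0_abs ?lee_fin ?expR_ge0//.
have := @ge0_normal_shift R (cst 1) c (@cst_continuous _ _ _) (fun=> ler01).
rewrite /= (_ : integral _ _ _ = 1%E); last first.
  by rewrite integral_cst//= probability_setT mul1e.
move=> /esym E.
have : (\int[N01]_x (expR (c ^+ 2 / 2) * (1 * expR (c * x - c ^+ 2 / 2)))%:E
     = (expR (c ^+ 2 / 2))%:E)%E.
  under eq_integral do rewrite EFinM.
  rewrite ge0_integralZl//; first by rewrite E mule1.
  - apply/measurable_EFinP; apply: measurable_funM => //.
    by apply: measurableT_comp => //; exact: measurable_funB.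
under eq_integral do rewrite mul1r -expRD [c ^+ 2 / 2 + _]addrC subrK.
by move=> H; apply: (@le_lt_trans _ _ (expR (c ^+ 2 / 2))%:E); rewrite ?ltry// -H lexx.
Qed.

(** One of c z and - c z equals c |z|, so exp (c |z|) is at most the sum of the two exponentials.
    This function dominates the difference quotients and the first two moments below. *)
Lemma gauss1_integrable_expR_norm (c : R) :
  N01.-integrable setT (fun z => (expR (c * (`|z| + 1)))%:E).
Proof.
have i1 := gauss1_integrable_expR c.
have i2 := gauss1_integrable_expR (- c).
have i3 := integrableD measurableT i1 i2.
have {}i3 := integrableZl measurableT (expR c) i3.
apply: le_integrable i3 => //.
- apply/measurable_EFinP; apply: measurableT_comp => //.
  by apply: measurable_funM => //; exact: measurable_funD.
- move=> x _; rewrite /= !lee_fin (ger0_norm (expR_ge0 _)).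
  rewrite [leRHS]ger0_norm; last first.
    by rewrite mulr_ge0// ?addr_ge0// expR_ge0.
  rewrite mulrDr mulr1 expRD mulrC ler_wpM2l ?expR_ge0//.
  have [x0|x0] := ger0P x; rewrite ?mulrN ?mulNr; first by rewrite lerDl expR_ge0.
  by rewrite lerDr expR_ge0.
Qed.

Lemma le_norm_expRB1 (u : R) : `|expR u - 1| <= `|u| * expR `|u|.
Proof.
have H1 := expR_ge1Dx u.
have [u0|u0] := ger0P u.
  rewrite ger0_norm ?subr_ge0; last by rewrite -expR0 ler_expR.
  have := expR_ge1Dx (- u).
  rewrite -(ler_pM2r (expR_gt0 u)) -expRD addNr expR0 mulrDl mulNr mul1r; lra.
rewrite ltr0_norm; last by rewrite subr_lt0 -expR0 ltr_expR.
apply: (@le_trans _ _ (- u)); first lra.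
by rewrite ler_peMr// ?oppr_ge0 1?ltW// -expR0 ltr_expR oppr_gt0.
Qed.

(** The difference quotient at 0, with increment 1 / (n + 1), of the Cameron-Martin density h |->
    exp (h z - h^2 / 2); its limit is the factor [z] of Stein's identity. *)
Let quot (n : nat) (z : R) : R :=
  n.+1%:R * (expR (n.+1%:R^-1 * z - n.+1%:R^-1 ^+ 2 / 2) - 1).

(** The exponent is at most h (|z| + 1) in absolute value, and n + 1 cancels this h. The remaining
    |z| + 1 is absorbed into a second exponential, whence the 2. *)
Let quot_ub n z : `|quot n z| <= expR (2 * (`|z| + 1)).
Proof.
rewrite /quot normrM ger0_norm//; set h := n.+1%:R^-1.
have h0 : 0 < h by rewrite invr_gt0.
have h1 : h <= 1 by rewrite invf_le1// ler1n.
have hu : `|h * z - h ^+ 2 / 2| <= h * (`|z| + 1).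
  rewrite (le_trans (ler_normB _ _))// normrM (gtr0_norm h0) mulrDr lerD2l mulr1.
  rewrite ger0_norm; last by rewrite divr_ge0// sqr_ge0.
  by rewrite ler_pdivrMr// expr2 ler_pM2l//; lra.
apply: (@le_trans _ _ (n.+1%:R * (h * (`|z| + 1) * expR (`|z| + 1)))).
  rewrite ler_wpM2l//; apply: (le_trans (le_norm_expRB1 _)).
  apply: ler_pM => //.
  rewrite ler_expR (le_trans hu)// ler_piMl//; lra.
have -> : 2 * (`|z| + 1) = (`|z| + 1) + (`|z| + 1) by ring.
rewrite mulrA mulrA mulfV// mul1r [leRHS]expRD ler_wpM2r ?expR_ge0//.
have := expR_ge1Dx (`|z| + 1); lra.
Qed.

Let quot_cvg z : quot n z @[n --> \oo] --> z.
Proof.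
have d1 : is_derive (0 : R) 1 (fun h : R => h * z - h ^+ 2 / 2) z.
  by apply: is_derive_eq; rewrite /GRing.scale/=; ring.
have d : is_derive (0 : R) 1 (fun h : R => expR (h * z - h ^+ 2 / 2)) z.
  apply: is_derive_eq (@is_derive1_comp _ expR _ _ _ _ _ d1) _.
  by rewrite mul0r expr0n/= mul0r subr0 expR0 mul1r.
have := cvg_harmonic_quotient d; apply: cvg_trans; apply: near_eq_cvg.
apply: nearW => n; rewrite /quot add0r; congr (_ * (_ - _)).
by rewrite mul0r expr0n/= mul0r subr0 expR0.
Qed.

(** Cameron-Martin differentiated at h = 0: for every n the quotient of [f] and the quotient of the
    density have equal integrals, and dominated convergence applies to both. *)
Let ge0_normal_stein f (f' : R -> R) (K : R) :
  (forall x, is_derive x 1 f (f' x)) ->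
  (forall x, 0 <= f x <= K) -> (forall x, `|f' x| <= K) ->
  (\int[N01]_x (f' x)%:E = \int[N01]_x (x * f x)%:E)%E.
Proof.
move=> df bf bf'.
have cf : continuous f.
  by move=> x; apply: differentiable_continuous; apply/derivable1_diffP; exact: ex_derive.
have mf : measurable_fun [set: R] f by exact: continuous_measurable_fun.
have mfh h : measurable_fun [set: R] (fun x => f (x + h)).
  by apply: (measurableT_comp mf); exact: measurable_funD.
have f0 x : 0 <= f x by have /andP[] := bf x.
have bfK x : `|f x| <= K by rewrite ger0_norm//; have /andP[] := bf x.
have mquot n : measurable_fun [set: R] (quot n).
  apply: measurable_funM => //; apply: measurable_funB => //.
  by apply: measurableT_comp => //; exact: measurable_funB.
pose l n x := n.+1%:R * (f (x + n.+1%:R^-1) - f x).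
have mlq n : measurable_fun [set: R] (l n).
  by apply: measurable_funM => //; exact: measurable_funB.
have lcvg x : l n x @[n --> \oo] --> f' x by exact: cvg_harmonic_quotient.
have mf' : measurable_fun [set: R] f'.
  by apply: (@measurable_fun_cvg _ _ _ _ l) => // x _; exact: lcvg.
have K0 : 0 <= K by exact: le_trans (bf' 0).
have E n : (\int[N01]_x (l n x)%:E = \int[N01]_x (f x * quot n x)%:E)%E.
  rewrite /l /quot; set h := n.+1%:R^-1.
  have ig : N01.-integrable setT
      (EFin \o (fun x => f x * expR (h * x - h ^+ 2 / 2))).
    apply: (@le_integrable _ _ _ N01 _ _ _
        (fun z => (K * expR (- h ^+ 2 / 2))%:E * (expR (h * z))%:E)%E) => //.
    - apply/measurable_EFinP; apply: measurable_funM => //.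
      by apply: measurableT_comp => //; exact: measurable_funB.
    - move=> x _; rewrite lee_fin !normrM !(ger0_norm (expR_ge0 _)) ger0_norm//.
      rewrite -mulrA -expRD mulNr [- _ + _]addrC.
      by rewrite ler_wpM2r ?expR_ge0// (ger0_norm K0); have /andP[] := bf x.
    - exact: integrableZl (gauss1_integrable_expR h).
  under eq_integral do rewrite EFinM EFinB.
  rewrite integralZl//; last first.
    by apply: integrableB => //; exact: bounded_integrable.
  rewrite integralB//; [|exact: bounded_integrable..].
  rewrite ge0_normal_shift//.
  under [RHS]eq_integral do rewrite mulrCA mulrBr mulr1 EFinM EFinB.
  rewrite integralZl//; last by apply: integrableB => //; exact: bounded_integrable.
  by rewrite integralB//; exact: bounded_integrable.
have c1 : (\int[N01]_x (l n x)%:E @[n --> \oo] --> \int[N01]_x (f' x)%:E)%E.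
  apply: (@cvg_integral_dominated _ _ _ N01 _ _ (fun=> K)) => //.
  - by apply: aeW => x; exact: lcvg.
  - exact: finite_measure_integrable_cst.
  - apply: aeW => x n; rewrite /l normrM ger0_norm//.
    have hx : x <= x + n.+1%:R^-1 by rewrite lerDl.
    have := lipschitz_of_derive_bounded hx (fun z _ => df z) (fun z _ => bf' z).
    rewrite addrAC subrr add0r -(ler_pM2l (_ : 0 < n.+1%:R :> R))//.
    by rewrite mulrCA mulfV// mulr1.
have c2 : (\int[N01]_x (f x * quot n x)%:E @[n --> \oo] -->
           \int[N01]_x (x * f x)%:E)%E.
  apply: (@cvg_integral_dominated _ _ _ N01 _ _
      (fun x => K * expR (2 * (`|x| + 1)))).
  - by move=> n; exact: measurable_funM.
  - exact: measurable_funM.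
  - apply: aeW => x.
    by rewrite mulrC; apply: cvgM; [exact: cvg_cst|exact: quot_cvg].
  - exact: integrableZl (gauss1_integrable_expR_norm 2).
  - by apply: aeW => x n; rewrite normrM ler_pM// quot_ub.
move: c1; under eq_cvg do rewrite E.
move=> c1; exact: (cvg_unique _ c1 c2).
Qed.

(** Adding [K] makes [f] nonnegative; the extra term E [x K] vanishes by the same identity for a
    constant function. *)
Lemma normal_stein f (f' : R -> R) (K : R) :
  (forall x, is_derive x 1 f (f' x)) ->
  (forall x, `|f x| <= K) -> (forall x, `|f' x| <= K) ->
  (\int[N01]_x (f' x)%:E = \int[N01]_x (x * f x)%:E)%E.
Proof.
move=> df bf bf'.
have K0 : 0 <= K by exact: le_trans (bf 0).
have mf : measurable_fun [set: R] f.
  apply: continuous_measurable_fun => x; apply: differentiable_continuous.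
  by apply/derivable1_diffP; exact: ex_derive.
have ix : N01.-integrable setT (fun x => x%:E).
  apply: le_integrable (gauss1_integrable_expR_norm 1) => //.
    exact/measurable_EFinP.
  move=> x _; rewrite /= lee_fin mul1r (ger0_norm (expR_ge0 _)).
  by have := expR_ge1Dx (`|x| + 1); lra.
have ixf : N01.-integrable setT (fun x => (x * f x)%:E).
  apply: le_integrable (integrableZl measurableT K ix) => //.
    by apply/measurable_EFinP; exact: measurable_funM.
  by move=> x _; rewrite lee_fin !normrM mulrC (ger0_norm K0) ler_wpM2r.
have ixK : N01.-integrable setT (fun x => (x * K)%:E).
  under eq_fun do rewrite EFinM muleC.
  exact: integrableZl.
have E1 : (\int[N01]_x (f' x)%:E = \int[N01]_x (x * (f x + K))%:E)%E.
  apply: (@ge0_normal_stein (fun x => f x + K) f' (2 * K)) => x.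
  - by apply: is_derive_eq; rewrite addr0.
  - by have := bf x; rewrite ler_norml => /andP[]; lra.
  - by apply: (le_trans (bf' x)); lra.
have E2 : (\int[N01]_x 0%:E = \int[N01]_x (x * K)%:E)%E.
  apply: (@ge0_normal_stein (fun=> K) (fun=> 0) K) => x.
  - by rewrite K0 lexx.
  - by rewrite normr0.
rewrite E1; under eq_integral do rewrite mulrDr EFinD.
by rewrite integralD_EFin//= -E2 integral0 adde0.
Qed.

Lemma normal_second_moment : (\int[N01]_x (x ^+ 2)%:E < +oo)%E.
Proof.
have := gauss1_integrable_expR_norm 2 => /integrableP[_].
apply: le_lt_trans; apply: ge0_le_integral => //.
- by move=> x _; rewrite lee_fin sqr_ge0.
- by apply/measurable_EFinP; exact: measurable_funX.
- apply: measurableT_comp => //; apply/measurable_EFinP.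
  apply: measurableT_comp => //; apply: measurable_funM => //.
  exact: measurable_funD.
- move=> x _; rewrite /= lee_fin (ger0_norm (expR_ge0 _)).
  have -> : 2 * (`|x| + 1) = (`|x| + 1) + (`|x| + 1) by ring.
  rewrite expRD -real_normK ?num_real// expr2.
  by have H := expR_ge1Dx (`|x| + 1); apply: ler_pM => //; have := normr_ge0 x; lra.
Qed.

End stein_normal.

(** * Equality in law and measurability of matrix functions *)

Section same_law.
Context d1 d2 d (T1 : measurableType d1) (T2 : measurableType d2)
  (U : measurableType d) (R : realType).
Variables (P1 : probability T1 R) (P2 : probability T2 R).
Variables (f1 : T1 -> U) (f2 : T2 -> U).

Definition same_law := forall A : set U, measurable A ->
  P1 (f1 @^-1` A) = P2 (f2 @^-1` A).

Hypotheses (mf1 : measurable_fun [set: T1] f1)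
           (mf2 : measurable_fun [set: T2] f2).

Lemma same_law_pi_system (G : set (set U)) :
  measurable = <<s G >> -> setI_closed G -> G [set: U] ->
  (forall A, G A -> P1 (f1 @^-1` A) = P2 (f2 @^-1` A)) -> same_law.
Proof.
move=> mG GI GT GE.
pose M1 := isMeasurableFun.Build _ _ _ _ _ mf1.
pose F1 : {mfun _ >-> _} := HB.pack f1 M1.
pose M2 := isMeasurableFun.Build _ _ _ _ _ mf2.
pose F2 : {mfun _ >-> _} := HB.pack f2 M2.
move=> A mA.
apply: (@measure_unique _ R U G (fun=> setT) mG GI _ _
  (pushforward P1 F1) (pushforward P2 F2)) => //.
- by apply/seteqP; split=> // x _; exists 0%N.
- move=> _; rewrite /pushforward; apply: (@le_lt_trans _ _ 1%E); last exact: ltry.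
  by apply: probability_le1; rewrite -[X in measurable X]setTI; exact: mf1.
Qed.

Hypothesis f12 : same_law.

Lemma ge0_same_law_integral (g : U -> \bar R) : measurable_fun [set: U] g ->
  (forall u, (0 <= g u)%E) -> (\int[P1]_x g (f1 x) = \int[P2]_x g (f2 x))%E.
Proof.
move=> mg g0.
pose M1 := isMeasurableFun.Build _ _ _ _ _ mf1.
pose F1 : {mfun _ >-> _} := HB.pack f1 M1.
pose M2 := isMeasurableFun.Build _ _ _ _ _ mf2.
pose F2 : {mfun _ >-> _} := HB.pack f2 M2.
have <- := @ge0_integral_pushforward _ _ _ _ R f1 mf1 P1 setT g measurableT mg
  (fun y _ => g0 y).
have <- := @ge0_integral_pushforward _ _ _ _ R f2 mf2 P2 setT g measurableT mg
  (fun y _ => g0 y).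
by apply: eq_measure_integral => A mA _; exact: f12.
Qed.

Lemma same_law_integral (g : U -> \bar R) : measurable_fun [set: U] g ->
  (\int[P1]_x g (f1 x) = \int[P2]_x g (f2 x))%E.
Proof.
move=> mg; rewrite [LHS]integralE [RHS]integralE; congr (_ - _)%E.
- transitivity (\int[P1]_x (g^\+ (f1 x)))%E.
    by apply: eq_integral => x _; rewrite !funeposE.
  rewrite ge0_same_law_integral//; last exact: measurable_funepos.
  by apply: eq_integral => x _; rewrite !funeposE.
- transitivity (\int[P1]_x (g^\- (f1 x)))%E.
    by apply: eq_integral => x _; rewrite !funenegE.
  rewrite ge0_same_law_integral//; last exact: measurable_funeneg.
  by apply: eq_integral => x _; rewrite !funenegE.
Qed.

End same_law.

Section measurable_matrix_functions.
Context d (U : measurableType d) (R : realType).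

Lemma measurable_addmx m n (f g : U -> 'M[R]_(m, n)) :
  measurable_fun [set: U] f -> measurable_fun [set: U] g ->
  measurable_fun [set: U] (fun u => f u + g u).
Proof.
move=> /measurable_fun_mxP mf /measurable_fun_mxP mg.
apply/measurable_fun_mxP => i j; under eq_fun do rewrite mxE.
exact: measurable_funD.
Qed.

Lemma measurable_scalemx m n (k : U -> R) (f : U -> 'M[R]_(m, n)) :
  measurable_fun [set: U] k -> measurable_fun [set: U] f ->
  measurable_fun [set: U] (fun u => k u *: f u).
Proof.
move=> mk /measurable_fun_mxP mf.
apply/measurable_fun_mxP => i j; under eq_fun do rewrite mxE.
exact: measurable_funM.
Qed.

Lemma measurable_trmx m n (f : U -> 'M[R]_(m, n)) :
  measurable_fun [set: U] f -> measurable_fun [set: U] (fun u => (f u)^T).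
Proof.
move=> /measurable_fun_mxP mf.
apply/measurable_fun_mxP => i j; under eq_fun do rewrite mxE.
exact: mf.
Qed.

Lemma measurable_mulmx m n p (f : U -> 'M[R]_(m, n)) (g : U -> 'M[R]_(n, p)) :
  measurable_fun [set: U] f -> measurable_fun [set: U] g ->
  measurable_fun [set: U] (fun u => f u *m g u).
Proof.
move=> /measurable_fun_mxP mf /measurable_fun_mxP mg.
apply/measurable_fun_mxP => i j; under eq_fun do rewrite mxE.
by apply: measurable_sum => k; exact: measurable_funM.
Qed.

Lemma measurable_mxtrace n (f : U -> 'M[R]_n) :
  measurable_fun [set: U] f -> measurable_fun [set: U] (fun u => \tr (f u)).
Proof. by move=> /measurable_fun_mxP mf; exact: measurable_sum. Qed.

Lemma measurable_mxsub m n m' n' (s : 'I_m' -> 'I_m) (t : 'I_n' -> 'I_n)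
    (f : U -> 'M[R]_(m, n)) :
  measurable_fun [set: U] f -> measurable_fun [set: U] (fun u => mxsub s t (f u)).
Proof.
move=> /measurable_fun_mxP mf.
apply/measurable_fun_mxP => i j; under eq_fun do rewrite mxE.
exact: mf.
Qed.

Lemma measurable_det n (f : U -> 'M[R]_n) :
  measurable_fun [set: U] f -> measurable_fun [set: U] (fun u => \det (f u)).
Proof.
move=> /measurable_fun_mxP mf; apply: measurable_sum => s.
by apply: measurable_funM => //; apply: measurable_prod.
Qed.

Lemma measurable_inv_real (f : U -> R) : measurable_fun [set: U] f ->
  measurable_fun [set: U] (fun u => (f u)^-1).
Proof.
move=> mf; apply: (measurableT_comp _ mf).
have -> : [set: R] = ~` [set 0] `|` [set 0] by rewrite setvU.
have m0 : measurable [set 0 : R] by exact: measurable_set1.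
apply/measurable_funU => //; first exact: measurableC.
split; last exact: measurable_fun_set1.
apply: open_continuous_measurable_fun; first by rewrite openC; exact: closed_eq.
by move=> x /set_mem x0; apply: inv_continuous; exact/eqP.
Qed.

Lemma measurable_adjmx n (f : U -> 'M[R]_n) :
  measurable_fun [set: U] f -> measurable_fun [set: U] (fun u => \adj (f u)).
Proof.
move=> mf; apply/measurable_fun_mxP => i j; under eq_fun do rewrite mxE.
apply: measurable_funM => //; apply: measurable_det.
have -> : (fun u => row' j (col' i (f u))) =
          (fun u => mxsub (lift j) (lift i) (f u)).
  by apply/funext => u; apply/matrixP => a b; rewrite !mxE.
exact: measurable_mxsub.
Qed.

Lemma measurable_invmx n (f : U -> 'M[R]_n) :
  measurable_fun [set: U] f -> (forall u, f u \in unitmx) ->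
  measurable_fun [set: U] (fun u => invmx (f u)).
Proof.
move=> mf uf; under eq_fun do rewrite /invmx uf.
apply: measurable_scalemx; last exact: measurable_adjmx.
by apply: measurable_inv_real; exact: measurable_det.
Qed.

Lemma measurable_gram m p (f : U -> 'M[R]_(m, p)) :
  measurable_fun [set: U] f -> measurable_fun [set: U] (fun u => gram (f u)).
Proof. by move=> mf; apply: measurable_mulmx => //; exact: measurable_trmx. Qed.

End measurable_matrix_functions.

(** * Resampling one coordinate *)

Section directional_derivative.
Context (R : realType) (a b : nat).
Implicit Types f : 'M[R]_(a, b) -> R.

Lemma is_derive_line f (f' : 'M[R]_(a, b) -> R) (D : 'M[R]_(a, b)) :
  (forall M, is_derive M D f (f' M)) ->
  forall M (t : R), is_derive t 1 (fun s => f (M + s *: D)) (f' (M + t *: D)).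
Proof.
move=> df M t; have H := df (M + t *: D).
have E : (fun h : R => h^-1 *: (((fun s => f (M + s *: D)) \o shift t) h%:A
    - f (M + t *: D))) = (fun h : R => h^-1 *: ((f \o shift (M + t *: D)) (h *: D)
    - f (M + t *: D))).
  apply/funext => h /=; congr (_ *: (f _ - _)).
  by rewrite [_%:A]mulr1 scalerDl addrCA.
apply: DeriveDef; first by rewrite /derivable E; exact: ex_derive.
by rewrite /derive E; exact: derive_val.
Qed.

Lemma measurable_derivative f (f' : 'M[R]_(a, b) -> R) (D : 'M[R]_(a, b)) :
  measurable_fun [set: 'M[R]_(a, b)] f ->
  (forall M, is_derive M D f (f' M)) ->
  measurable_fun [set: 'M[R]_(a, b)] f'.
Proof.
move=> mf df.
pose q n (M : 'M[R]_(a, b)) := n.+1%:R * (f (M + n.+1%:R^-1 *: D) - f M).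
apply: (@measurable_fun_cvg _ 'M[R]_(a, b) R _ q).
  move=> n; apply: measurable_funM => //; apply: measurable_funB => //.
  by apply: (measurableT_comp mf); apply: measurable_addmx.
move=> M _; have := cvg_harmonic_quotient (is_derive_line df M 0).
by under eq_cvg do rewrite scale0r addr0 add0r; rewrite scale0r addr0.
Qed.

End directional_derivative.

Section resampling.
Context d (Omega : measurableType d) (R : realType) (P : probability Omega R).
Context (a b : nat) (Z : Omega -> 'M[R]_(a, b)).
Variables (D : 'M[R]_(a, b)) (l : 'M[R]_(a, b) -> R).
Hypothesis mZ : measurable_fun [set: Omega] Z.
Hypothesis ml : measurable_fun [set: 'M[R]_(a, b)] l.
Hypothesis lD : forall M s, l (M + s *: D) = l M + s.
Local Notation N01 := (gauss1 R).

(* [l] reads off one coordinate of [Z] in the direction [D]; it is overwritten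
   with the second component of [wt]. *)
Definition resample (wt : Omega * R) : 'M[R]_(a, b) :=
  Z wt.1 + (wt.2 - l (Z wt.1)) *: D.

Lemma measurable_resample : measurable_fun [set: Omega * R] resample.
Proof.
have m1 : measurable_fun [set: Omega * R] (fun wt => Z wt.1).
  by apply: (measurableT_comp mZ); exact: measurable_fst.
apply: measurable_addmx => //; apply: measurable_scalemx => //.
apply: measurable_funB; first exact: measurable_snd.
exact: (measurableT_comp ml).
Qed.

Lemma resampleK wt : l (resample wt) = wt.2.
Proof. by rewrite /resample lD addrC subrK. Qed.

Hypothesis res : same_law P (P \x N01)%E Z resample.

Lemma resample_second_moment : (\int[P]_w (l (Z w) ^+ 2)%:E < +oo)%E.
Proof.
have mg : measurable_fun [set: 'M[R]_(a, b)] (fun M => (l M ^+ 2)%:E : \bar R).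
  by apply/measurable_EFinP; exact: measurable_funX.
rewrite (ge0_same_law_integral mZ measurable_resample res mg); last first.
  by move=> u; rewrite lee_fin sqr_ge0.
rewrite fubini_tonelli1; last 2 first.
- exact: (measurableT_comp mg measurable_resample).
- by move=> x; rewrite lee_fin sqr_ge0.
under eq_integral do rewrite /fubini_F.
under eq_integral do under eq_integral do rewrite resampleK.
rewrite [X in (X < _)%E](_ : _ = (\int[N01]_x (x ^+ 2)%:E * P setT)%E).
  by rewrite [X in (_ * X)%E]probability_setT mule1; exact: normal_second_moment.
by rewrite -integral_cst.
Qed.

(** Once [Z] is replaced by [resample], the coordinate [l] is the second component, independent of
    the first. With the first component frozen, [f] is followed along a line of direction [D], where
    the one-dimensional identity applies. *)
Lemma resample_stein (f f' : 'M[R]_(a, b) -> R) (K : R) :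
  measurable_fun [set: 'M[R]_(a, b)] f ->
  (forall M, is_derive M D f (f' M)) ->
  (forall M, `|f M| <= K) -> (forall M, `|f' M| <= K) ->
  (\int[P]_w (f' (Z w))%:E = \int[P]_w (l (Z w) * f (Z w))%:E)%E.
Proof.
move=> mf df bf bf'.
have dline := is_derive_line df.
have mf' := measurable_derivative mf df.
have K0 : 0 <= K by exact: le_trans (bf 0).
have mg1 : measurable_fun [set: 'M[R]_(a, b)] (fun M => (f' M)%:E : \bar R).
  exact/measurable_EFinP.
have mg2 : measurable_fun [set: 'M[R]_(a, b)] (fun M => (l M * f M)%:E : \bar R).
  by apply/measurable_EFinP; exact: measurable_funM.
have mr := measurable_resample.
rewrite (same_law_integral mZ mr res mg1) (same_law_integral mZ mr res mg2).
have i1 : (P \x N01)%E.-integrable setT (fun wt => (f' (resample wt))%:E).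
  apply: (@bounded_integrable _ _ _ (P \x N01)%E (fun wt => f' (resample wt)) K) => //.
  exact: (measurableT_comp mf').
have i2 : (P \x N01)%E.-integrable setT
    (fun wt => (l (resample wt) * f (resample wt))%:E).
  apply: (@le_integrable _ _ _ (P \x N01)%E _ measurableT _
      (fun wt => (K * (l (resample wt) ^+ 2 + 1))%:E)).
  - exact: (measurableT_comp mg2).
  - move=> wt _; rewrite lee_fin normrM mulrC.
    rewrite [leRHS]ger0_norm; last by rewrite mulr_ge0// addr_ge0// sqr_ge0.
    rewrite ler_pM//.
    have := sqr_ge0 (`|l (resample wt)| - 1); rewrite sqrrB1 real_normK ?num_real//.
    by have := normr_ge0 (l (resample wt)); lra.
  - under eq_fun do rewrite EFinM EFinD.
    apply: integrableZl => //; apply: integrableD => //; last first.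
      apply: (@bounded_integrable _ _ _ (P \x N01)%E (fun=> 1) 1) => // wt.
      by rewrite normr1.
    apply/integrableP; split.
      apply/measurable_EFinP; apply: measurable_funX.
      exact: (measurableT_comp ml).
    have mg : measurable_fun [set: 'M[R]_(a, b)] (fun M => (l M ^+ 2)%:E : \bar R).
      by apply/measurable_EFinP; exact: measurable_funX.
    under eq_integral do rewrite gee0_abs ?lee_fin ?sqr_ge0//.
    rewrite -(ge0_same_law_integral mZ mr res mg).
      exact: resample_second_moment.
    by move=> u; rewrite lee_fin sqr_ge0.
rewrite -(integral12_prod_meas1 i1) -(integral12_prod_meas1 i2).
apply: eq_integral => w _; rewrite /fubini_F.
under [RHS]eq_integral do rewrite resampleK.
apply: (@normal_stein _ (fun t => f (resample (w, t)))
   (fun t => f' (resample (w, t))) K) => t //.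
(* The line starts at its point of coordinate 0, so that its parameter is the coordinate itself. *)
have := dline (Z w - l (Z w) *: D) t.
rewrite -addrA -scaleNr -scalerDl [- l _ + _]addrC.
rewrite (_ : (fun s : R => _) = (fun s => f (resample (w, s))))//.
apply/funext => s; congr (f _).
by rewrite /resample/= -addrA -scalerDl [- l _ + _]addrC.
Qed.

(** On the line through [Z w] of direction [D], [f] is affine with slope [c (Z w)]; a nonzero slope
    leaves a single zero, which the resampled coordinate hits with probability 0. *)
Lemma resample_affine_neq0 (f c : 'M[R]_(a, b) -> R) :
  measurable_fun [set: 'M[R]_(a, b)] f -> measurable_fun [set: 'M[R]_(a, b)] c ->
  (forall M s, f (M + s *: D) = f M + s * c M) ->
  (forall M s, c (M + s *: D) = c M) ->
  {ae P, forall w, f (Z w) = 0 -> c (Z w) = 0}.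
Proof.
move=> mf mc fD cD.
pose E : set 'M[R]_(a, b) := [set M | f M = 0] `&` ~` [set M | c M = 0].
have m0 : measurable [set 0 : R] by exact: measurable_set1.
have mE : measurable E.
  apply: measurableI; last apply: measurableC.
    by rewrite -[X in measurable X]setTI; exact: (mf measurableT _ m0).
  by rewrite -[X in measurable X]setTI; exact: (mc measurableT _ m0).
exists (Z @^-1` E); split; last first.
- by move=> w /= /not_implyP.
- rewrite [LHS](res mE) /product_measure1 /=.
apply: integral0_eq => w _; apply/eqP.
have mx : measurable (xsection (resample @^-1` E) w).
  apply: measurable_xsection.
  by rewrite -[X in measurable X]setTI; exact: (measurable_resample measurableT mE).
have xE t : xsection (resample @^-1` E) w t <->
    f (Z w) + (t - l (Z w)) * c (Z w) = 0 /\ c (Z w) <> 0.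
  by rewrite /xsection /= inE /E /resample /= fD cD.
have [cw|cw] := pselect (c (Z w) = 0).
  rewrite /= (_ : xsection _ _ = set0) ?measure0//.
  by apply/seteqP; split=> // t /xE[_].
rewrite -measure_le0; apply: (@le_trans _ _
    (N01 [set l (Z w) - f (Z w) / c (Z w)])); last first.
  rewrite (_ : N01 _ = 0%E)//; rewrite /gauss1.
  have := @normal_prob_dominates R 0 1 => /null_content_dominatesP.
  by apply => //; exact: lebesgue_measure_set1.
apply: le_measure; rewrite ?inE//.
move=> t /xE[+ _] /=; move/eqP: cw => cw /eqP.
rewrite addrC addr_eq0 => /eqP E1.
by rewrite -mulNr -E1 mulfK// addrC subrK.
- by rewrite -[X in measurable X]setTI; exact: mZ.
Qed.

End resampling.

Lemma same_law_of_integral d1 d2 d (T1 : measurableType d1)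
    (T2 : measurableType d2) (U : measurableType d) (R : realType)
    (P1 : probability T1 R) (P2 : probability T2 R)
    (f1 : T1 -> U) (f2 : T2 -> U) :
  measurable_fun [set: T1] f1 -> measurable_fun [set: T2] f2 ->
  (forall g : U -> \bar R, measurable_fun [set: U] g -> (forall u, (0 <= g u)%E) ->
    (\int[P1]_x g (f1 x) = \int[P2]_x g (f2 x))%E) ->
  same_law P1 P2 f1 f2.
Proof.
move=> mf1 mf2 H A mA.
have m1 : measurable (f1 @^-1` A) by rewrite -[X in measurable X]setTI; exact: mf1.
have m2 : measurable (f2 @^-1` A) by rewrite -[X in measurable X]setTI; exact: mf2.
have E1 : (P1 (f1 @^-1` A) = \int[P1]_x (\1_A (f1 x))%:E)%E.
  by rewrite -[X in P1 X]setIT -(integral_indic P1 measurableT m1).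
have E2 : (P2 (f2 @^-1` A) = \int[P2]_x (\1_A (f2 x))%:E)%E.
  by rewrite -[X in P2 X]setIT -(integral_indic P2 measurableT m2).
rewrite E1 E2 (H (fun u => (\1_A u)%:E))//.
exact/measurable_EFinP/measurable_indic.
Qed.

Section matrix_generators.
Context (R : realType).

Lemma measurable_matrixE m n (G : set (set 'M[R]_(m, n))) :
  G `<=` measurable ->
  (forall i j (B : set R), measurable B ->
    G ((fun M : 'M[R]_(m, n) => M i j) @^-1` B)) ->
  (measurable : set (set 'M[R]_(m, n))) = <<s G >>.
Proof.
move=> Gm GB; apply/seteqP; split.
  apply: sub_sigma_algebra2 => _ [i [j [B [mB ->]]]]; exact: GB.
apply: smallest_sub => //; exact: sigma_algebra_measurable.
Qed.

Definition col_boxes m n : set (set 'M[R]_(m, n)) :=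
  [set A | exists E : 'I_n -> set 'cV[R]_m, (forall j, measurable (E j)) /\
    A = [set M | forall j, E j (col j M)]].

Lemma measurable_col m n j : measurable_fun [set: 'M[R]_(m, n)] (col j).
Proof.
apply/measurable_fun_mxP => i k; under eq_fun do rewrite mxE.
exact: measurable_mx_coord.
Qed.

Lemma setI_closed_col_boxes m n : setI_closed (@col_boxes m n).
Proof.
move=> _ _ [E [mE ->]] [F [mF ->]]; exists (fun j => E j `&` F j); split.
  by move=> j; exact: measurableI.
apply/seteqP; split=> M /=; first by move=> [e f] j; split.
by move=> ef; split=> j; have [] := ef j.
Qed.

Lemma col_boxes_setT m n : col_boxes [set: 'M[R]_(m, n)].
Proof.
by exists (fun=> setT); split=> //; apply/seteqP; split.
Qed.

Lemma measurable_col_box m n (E : 'I_n -> set 'cV[R]_m) :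
  (forall j, measurable (E j)) ->
  measurable [set M : 'M[R]_(m, n) | forall j, E j (col j M)].
Proof.
move=> mE.
rewrite (_ : [set M | _] = \bigcap_(j in [set: 'I_n]) ((col j) @^-1` (E j))).
  apply: fin_bigcap_measurable => // j _.
  by rewrite -[X in measurable X]setTI; exact: measurable_col.
by apply/seteqP; split=> M /= H j; [move=> _|]; exact: H.
Qed.

Lemma measurable_col_boxesE m n :
  (measurable : set (set 'M[R]_(m, n))) = <<s @col_boxes m n >>.
Proof.
apply: measurable_matrixE => [_ [E [mE ->]]|i j B mB].
  exact: measurable_col_box.
exists (fun k => if k == j then (fun c : 'cV[R]_m => c i 0) @^-1` B else setT).
split=> [k|].
  case: ifP => // _; rewrite -[X in measurable X]setTI.
  exact: (measurable_mx_coord i 0).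
apply/seteqP; split=> M /=.
  by move=> BM k; case: eqP => //= ->; rewrite mxE.
by move=> /(_ j); rewrite eqxx /= mxE.
Qed.

End matrix_generators.

Section std_normal_resampling.
Context (R : realType) (p : nat) (nu : probability 'cV[R]_p R).
Hypothesis nuN : is_std_normal nu.
Local Notation N01 := (gauss1 R).

Definition coord_boxes : set (set 'cV[R]_p) :=
  [set A | exists E : 'I_p -> set R, (forall i, measurable (E i)) /\
    A = [set z : 'cV[R]_p | forall i, E i (z i 0)]].

(** On a box both laws are the same product of one-dimensional probabilities: the new variable
    carries the constraint on coordinate [k], which [E'] lifts from the old one. *)
Lemma std_normal_resample (k : 'I_p) :
  same_law nu (nu \x N01)%E id
    (resample id (delta_mx k 0) (fun z : 'cV[R]_p => z k 0)).
Proof.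
have mk : measurable_fun [set: 'cV[R]_p] (fun z : 'cV[R]_p => z k 0).
  exact: measurable_mx_coord.
have mbox (E : 'I_p -> set R) : (forall i, measurable (E i)) ->
    measurable [set z : 'cV[R]_p | forall i, E i (z i 0)].
  move=> mE; rewrite (_ : [set z | _] =
      \bigcap_(i in [set: 'I_p]) ((fun z : 'cV[R]_p => z i 0) @^-1` (E i))).
    apply: fin_bigcap_measurable => // i _.
    by rewrite -[X in measurable X]setTI; exact: measurable_mx_coord.
  by apply/seteqP; split=> M /= H j; [move=> _|]; exact: H.
apply: (@same_law_pi_system _ _ _ _ _ _ _ _ _ _ _ _ _ coord_boxes).
- exact: measurable_id.
- by apply: measurable_resample.
- apply: measurable_matrixE => [_ [E [mE ->]]|i j B mB]; first exact: mbox.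
  exists (fun l => if l == i then B else setT); split=> [l|]; first by case: ifP.
  apply/seteqP; split=> M /=.
    by move=> BM l; case: eqP => //= ->; rewrite -(ord1 j).
  by move=> /(_ i); rewrite eqxx (ord1 j).
- move=> _ _ [E [mE ->]] [F [mF ->]]; exists (fun j => E j `&` F j); split.
    by move=> j; exact: measurableI.
  apply/seteqP; split=> M /=; first by move=> [e f] j; split.
  by move=> ef; split=> j; have [] := ef j.
- by exists (fun=> setT); split=> //; apply/seteqP; split.
- move=> _ [E [mE ->]].
  rewrite preimage_id nuN//.
  pose E' i := if i == k then setT else E i.
  have mE' i : measurable (E' i) by rewrite /E'; case: ifP.
  pose Bx := [set z : 'cV[R]_p | forall i, E' i (z i 0)].
  rewrite (_ : _ @^-1` _ = Bx `*` E k).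
    transitivity (nu Bx * N01 (E k))%E;
      last by apply/esym/product_measure1E => //; exact: mbox.
    rewrite nuN// [RHS]muleC (bigD1 k)//= [in RHS](bigD1 k)//=.
    congr (_ * _)%E.
    rewrite /E' eqxx (_ : normal_prob 0 1 setT = 1%E).
      rewrite mul1e; apply: eq_bigr => i /negbTE ->//.
    exact: probability_setT (normal_prob (0 : R) 1).
  apply/seteqP; split=> -[z t] /=; rewrite /resample /=.
    move=> H; split.
      move=> i; rewrite /E'; case: eqP => // /eqP ik; have := H i.
      by rewrite !mxE (negbTE ik) mulr0 addr0.
    by have := H k; rewrite !mxE eqxx mulr1 addrC subrK.
  move=> [H Et] i; have := H i; rewrite /E' !mxE.
  have [->|ik] := eqVneq i k; first by rewrite mulr1 addrC subrK.
  by rewrite mulr0 addr0.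
Qed.

End std_normal_resampling.

Lemma unitmx_of_mul_tr (R : realType) p (B Gamma : 'M[R]_p) :
  B *m B^T = Gamma -> Gamma \in unitmx -> B \in unitmx.
Proof.
move=> <-; rewrite !unitmxE det_mulmx unitrM => /andP[] //.
Qed.

Section normal_columns.
Context d (Omega : measurableType d) (R : realType) (P : probability Omega R).
Context (p q : nat) (theta : 'M[R]_(p, q)) (Gamma : 'M[R]_p).
Variable Z : Omega -> 'M[R]_(p, q).
Hypothesis mZ : measurable_fun [set: Omega] Z.
Hypothesis uG : Gamma \in unitmx.
Hypothesis Znormal : normal_matrix_cols P theta Gamma Z.
Local Notation N01 := (gauss1 R).

Let set_col (j : 'I_q) (M : 'M[R]_(p, q)) (c : 'cV[R]_p) : 'M[R]_(p, q) :=
  \matrix_(i, k) if k == j then c i 0 else M i k.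

Let col_set_col j M c k :
  col k (set_col j M c) = if k == j then c else col k M.
Proof. by apply/colP => i; rewrite !mxE; case: ifP => // _; rewrite mxE. Qed.

Let measurable_set_col d' (T : measurableType d') j (f : T -> 'M[R]_(p, q))
    (g : T -> 'cV[R]_p) :
  measurable_fun [set: T] f -> measurable_fun [set: T] g ->
  measurable_fun [set: T] (fun t => set_col j (f t) (g t)).
Proof.
move=> /measurable_fun_mxP mf /measurable_fun_mxP mg.
apply/measurable_fun_mxP => i k; under eq_fun do rewrite mxE.
by case: (k == j); [exact: mg|exact: mf].
Qed.

(** [normal_vector] prescribes a law only, so the standard normal vector is brought in on a second
    factor of the probability space. Independence of the columns gives agreement on boxes of
    columns. *)
Let replace_col (j : 'I_q) (B : 'M[R]_p) (nu : probability 'cV[R]_p R) :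
  is_std_normal nu ->
  (forall E : set 'cV[R]_p, measurable E ->
    P ((fun w => col j (Z w)) @^-1` E) =
    nu ((fun z => col j theta + B *m z) @^-1` E)) ->
  same_law P (P \x nu)%E Z
    (fun wz => set_col j (Z wz.1) (col j theta + B *m wz.2)).
Proof.
move=> nuN nuE.
have maff : measurable_fun [set: 'cV[R]_p] (fun z => col j theta + B *m z).
  by apply: measurable_addmx => //; exact: measurable_mulmx.
apply: (@same_law_pi_system _ _ _ _ _ _ _ _ _ _ _ _ _ (@col_boxes R p q)) => //.
- apply: measurable_set_col; first exact: (measurableT_comp mZ).
  by apply: (measurableT_comp maff); exact: measurable_snd.
- exact: measurable_col_boxesE.
- exact: setI_closed_col_boxes.
- exact: col_boxes_setT.
- move=> _ [E [mE ->]].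
  have box E' : (forall k, measurable (E' k)) ->
      P (Z @^-1` [set M | forall k, E' k (col k M)]) =
      (\prod_k P ((fun w => col k (Z w)) @^-1` E' k))%E.
    move=> mE'; have [+ _] := Znormal => <-//; congr (P _).
    by apply/seteqP; split=> w /= H k; [move=> _|]; exact: H.
  rewrite box//.
  pose E' k := if k == j then setT else E k.
  have mE' k : measurable (E' k) by rewrite /E'; case: ifP.
  pose A1 := Z @^-1` [set M | forall k, E' k (col k M)].
  pose A2 := (fun z => col j theta + B *m z) @^-1` (E j).
  rewrite (_ : _ @^-1` _ = A1 `*` A2).
    transitivity (P A1 * nu A2)%E; last first.
      apply/esym/product_measure1E => //.
        rewrite -[X in measurable X]setTI; apply: mZ => //.
        exact: measurable_col_box.
      by rewrite -[X in measurable X]setTI; exact: maff.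
    rewrite /A1 /A2 box// -nuE// [RHS]muleC (bigD1 j)//= [in RHS](bigD1 j)//=.
    congr (_ * _)%E.
    rewrite {1}/E' eqxx preimage_setT probability_setT mul1e.
    by apply: eq_bigr => k /negbTE kj; rewrite /E' kj.
  apply/seteqP; split=> -[w z] /=.
    move=> H; split.
      move=> k; rewrite /E'; case: eqP => // /eqP/negbTE kj; have := H k.
      by rewrite col_set_col kj.
    by have := H j; rewrite col_set_col eqxx.
  move=> [H Ej] k; have := H k; rewrite col_set_col /E'.
  by case: eqP => // ->.
Qed.

(** Column [j] is replaced by an independent copy col j theta + B z, for which resampling z_k is
    [std_normal_resample]; the same replacement, read backwards, restores [Z]. Moving z_k moves
    column [j] along [col k B], which explains the direction. *)
Lemma normal_cols_resample (j : 'I_q) : exists2 B : 'M[R]_p, B *m B^T = Gamma &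
  forall k, same_law P (P \x N01)%E Z
    (resample Z (col k B *m delta_mx 0 j)
       (fun M => (invmx B *m (col j M - col j theta)) k 0)).
Proof.
have [_ /(_ j)[B [nu [BB nuN nuE]]]] := Znormal.
exists B => // k.
have uB := unitmx_of_mul_tr BB uG.
set D := col k B *m delta_mx 0 j.
set l := fun M : 'M[R]_(p, q) => (invmx B *m (col j M - col j theta)) k 0.
have ml : measurable_fun [set: 'M[R]_(p, q)] l.
  apply: (measurableT_comp (measurable_mx_coord k 0)).
  apply: measurable_mulmx => //; apply: measurable_addmx => //.
  exact: measurable_col.
have Hrep := replace_col nuN nuE.
have mrep : measurable_fun [set: Omega * 'cV[R]_p]
    (fun wz => set_col j (Z wz.1) (col j theta + B *m wz.2)).
  apply: measurable_set_col; first exact: (measurableT_comp mZ).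
  apply: measurable_addmx => //; apply: measurable_mulmx => //.
have mres := measurable_resample D mZ ml.
apply: same_law_of_integral => // g mg g0.
(* [h] below integrates the resampled coordinate out, so that the replacement of column [j] is
   applied to [g] on one side and to [h] on the other. *)
pose gr (Mt : 'M[R]_(p, q) * R) : \bar R := g (Mt.1 + (Mt.2 - l Mt.1) *: D).
pose h := fubini_F N01 gr.
have mgr : measurable_fun [set: 'M[R]_(p, q) * R] gr.
  apply: (measurableT_comp mg); apply: measurable_addmx.
    exact: measurable_fst.
  apply: measurable_scalemx => //; apply: measurable_funB.
    exact: measurable_snd.
  by apply: (measurableT_comp ml); exact: measurable_fst.
have mh : measurable_fun [set: 'M[R]_(p, q)] h.
  by apply: measurable_fun_fubini_tonelli_F => // Mt; exact: g0.
have h0 M : (0 <= h M)%E by apply: integral_ge0 => t _; exact: g0.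
transitivity (\int[P]_w h (Z w))%E; last first.
  rewrite fubini_tonelli1//.
  exact: (measurableT_comp mg mres).
rewrite (ge0_same_law_integral mZ mrep Hrep mg g0).
rewrite (ge0_same_law_integral mZ mrep Hrep mh h0).
rewrite (fubini_tonelli1 _ (measurableT_comp mg mrep) (fun=> g0 _)).
rewrite (fubini_tonelli1 _ (measurableT_comp mh mrep) (fun=> h0 _)).
apply: eq_integral => w _; rewrite /fubini_F /=.
pose G z := g (set_col j (Z w) (col j theta + B *m z)).
have mG : measurable_fun [set: 'cV[R]_p] G.
  apply: (measurableT_comp mg); apply: measurable_set_col => //.
  by apply: measurable_addmx => //; exact: measurable_mulmx.
have mk : measurable_fun [set: 'cV[R]_p] (fun z : 'cV[R]_p => z k 0).
  exact: measurable_mx_coord.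
have mrk := measurable_resample (delta_mx k 0) (@measurable_id _ _ setT) mk.
have := ge0_same_law_integral (@measurable_id _ _ setT) mrk
   (std_normal_resample nuN k) mG (fun z => g0 _).
rewrite /G /= => ->.
rewrite (fubini_tonelli1 _ (measurableT_comp mG mrk) (fun=> g0 _)).
apply: eq_integral => z _; rewrite /fubini_F /h /=.
apply: eq_integral => t _; congr (g _).
have lz : l (set_col j (Z w) (col j theta + B *m z)) = z k 0.
  by rewrite /l col_set_col eqxx addrC addKr mulmxA mulVmx// mul1mx.
rewrite lz /resample /=; apply/matrixP => a b; rewrite !mxE.
rewrite big_ord1 !mxE eqxx /=; have [_|bj] := eqVneq b j.
  rewrite mulr1 -addrA; congr (_ + _).
  under eq_bigr do rewrite !mxE mulrDr; rewrite big_split/=; congr (_ + _).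
  rewrite (bigD1 k)//= big1 ?addr0 ?eqxx ?mulr1 1?mulrC//.
  by move=> i /negbTE ik; rewrite ik !mulr0.
by rewrite !mulr0 addr0.
Qed.

End normal_columns.

(** * Integration by parts for normal matrices *)

Section square_integrable.
Context d (T : measurableType d) (R : realType) (P : probability T R).

Implicit Types f g : T -> R.

Definition L2 (f : T -> R) :=
  measurable_fun [set: T] f /\ (\int[P]_x (f x ^+ 2)%:E < +oo)%E.

Lemma L2_sqr_integrable f : L2 f -> P.-integrable setT (fun x => (f x ^+ 2)%:E).
Proof.
move=> [mf ff]; apply/integrableP; split.
  by apply/measurable_EFinP; exact: measurable_funX.
by under eq_integral do rewrite gee0_abs ?lee_fin ?sqr_ge0//.
Qed.

Lemma L2_le f g : measurable_fun [set: T] f ->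
  P.-integrable setT (fun x => (g x)%:E) -> (forall x, f x ^+ 2 <= g x) -> L2 f.
Proof.
move=> mf ig fg; split=> //.
have mg : measurable_fun [set: T] g by exact/measurable_EFinP/(measurable_int P).
have : P.-integrable setT (fun x => (f x ^+ 2)%:E).
  apply: le_integrable ig => //.
    by apply/measurable_EFinP; exact: measurable_funX.
  move=> x _; rewrite /= lee_fin ger0_norm ?sqr_ge0// ger0_norm//.
  by apply: le_trans (fg x); rewrite sqr_ge0.
by move=> /integrableP[_]; under eq_integral do rewrite gee0_abs ?lee_fin ?sqr_ge0//.
Qed.

Lemma L2_add f g : L2 f -> L2 g -> L2 (fun x => f x + g x).
Proof.
move=> Lf Lg; have [mf _] := Lf; have [mg _] := Lg.
apply: (@L2_le _ (fun x => 2 * (f x ^+ 2 + g x ^+ 2))).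
- exact: measurable_funD.
- under eq_fun do rewrite EFinM.
  apply: integrableZl => //; under eq_fun do rewrite EFinD.
  by apply: integrableD => //; exact: L2_sqr_integrable.
- by move=> x; have := sqr_ge0 (f x - g x); rewrite sqrrB sqrrD; lra.
Qed.

Lemma L2_bounded_mul f g K : L2 f -> measurable_fun [set: T] g ->
  (forall x, `|g x| <= K) -> L2 (fun x => g x * f x).
Proof.
move=> Lf mg bg; have [mf _] := Lf.
apply: (@L2_le _ (fun x => K ^+ 2 * f x ^+ 2)).
- exact: measurable_funM.
- under eq_fun do rewrite EFinM.
  by apply: integrableZl => //; exact: L2_sqr_integrable.
- move=> x; rewrite exprMn ler_wpM2r ?sqr_ge0//.
  by rewrite -real_normK ?num_real// lerXn2r ?nnegrE//; exact: le_trans (bg x).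
Qed.

Lemma L2_cst_mul f c : L2 f -> L2 (fun x => c * f x).
Proof. by move=> Lf; apply: (@L2_bounded_mul f (fun=> c) `|c|). Qed.

Lemma L2_sum (I : Type) (s : seq I) (f : I -> T -> R) :
  (forall i, L2 (f i)) -> L2 (fun x => \sum_(i <- s) f i x).
Proof.
move=> Lf; elim: s => [|i s IH].
  under eq_fun do rewrite big_nil; split=> //.
  by under eq_integral do rewrite expr0n; rewrite integral0.
by under eq_fun do rewrite big_cons; exact: L2_add.
Qed.

Lemma L2_integrable f : L2 f -> P.-integrable setT (fun x => (f x)%:E).
Proof.
move=> Lf; have [mf _] := Lf.
apply: (@le_integrable _ _ _ P _ measurableT _ (fun x => (f x ^+ 2 + 1)%:E)) => //.
- exact/measurable_EFinP.
- move=> x _; rewrite lee_fin [leRHS]ger0_norm; last by rewrite addr_ge0// sqr_ge0.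
  have := sqr_ge0 (`|f x| - 1); rewrite sqrrB1 real_normK ?num_real//.
  by have := normr_ge0 (f x); lra.
- under eq_fun do rewrite EFinD; apply: integrableD => //.
    exact: L2_sqr_integrable.
  exact: finite_measure_integrable_cst.
Qed.

End square_integrable.

Lemma invmx_uniq (K : comUnitRingType) n (A B : 'M[K]_n) :
  A *m B = 1%:M -> invmx A = B.
Proof. by move=> AB; have [uA _] := mulmx1_unit AB; rewrite -[LHS]mulmx1 -AB mulKmx. Qed.

Section normal_columns_stein.
Context d (Omega : measurableType d) (R : realType) (P : probability Omega R).
Context (p q : nat) (theta : 'M[R]_(p, q)) (Gamma : 'M[R]_p).
Variable Z : Omega -> 'M[R]_(p, q).
Hypothesis mZ : measurable_fun [set: Omega] Z.
Hypothesis uG : Gamma \in unitmx.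
Hypothesis Znormal : normal_matrix_cols P theta Gamma Z.

Let coord (B : 'M[R]_p) (j : 'I_q) (k : 'I_p) (M : 'M[R]_(p, q)) : R :=
  (invmx B *m (col j M - col j theta)) k 0.

Let measurable_coord B j k : measurable_fun [set: 'M[R]_(p, q)] (coord B j k).
Proof.
apply: (measurableT_comp (measurable_mx_coord k 0)).
apply: measurable_mulmx => //; apply: measurable_addmx => //.
exact: measurable_col.
Qed.

Let coordD B j k M (s : R) : B \in unitmx ->
  coord B j k (M + s *: (col k B *m delta_mx 0 j)) = coord B j k M + s.
Proof.
move=> uB; rewrite /coord.
have -> : col j (M + s *: (col k B *m delta_mx 0 j)) = col j M + s *: col k B.
  apply/colP => i; rewrite !mxE big_ord1 !mxE !eqxx /= mulr1.
  by [].
rewrite addrAC mulmxDr mxE; congr (_ + _).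
by rewrite -scalemxAr mxE colE mulmxA mulVmx// mul1mx mxE !eqxx mulr1.
Qed.

Lemma normal_cols_L2 i j : L2 P (fun w => (Z w - theta) i j).
Proof.
have [B BB resB] := normal_cols_resample mZ uG Znormal j.
have uB := unitmx_of_mul_tr BB uG.
have -> : (fun w => (Z w - theta) i j) =
    (fun w => \sum_k B i k * coord B j k (Z w)).
  apply/funext => w; transitivity ((B *m (invmx B *m (col j (Z w) - col j theta))) i 0).
    by rewrite mulmxA mulmxV// mul1mx !mxE.
  by rewrite mxE.
apply: L2_sum => k; apply: L2_cst_mul; split.
  exact: (measurableT_comp (measurable_coord B j k)).
exact: (resample_second_moment mZ (measurable_coord B j k)
  (fun M s => coordD j k M s uB) (resB k)).
Qed.

(** Along each direction [D k] this is [resample_stein]. The elementary matrix combines these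
    directions with coefficients [invmx B k i]; as Gamma^-1 = B^-T B^-1, the same coefficients
    rebuild the entry of Gamma^-1 (Z - theta) from the coordinates. *)
Lemma normal_cols_stein (f : 'M[R]_(p, q) -> R)
    (f' : 'M[R]_(p, q) -> 'M[R]_(p, q) -> R) (K : R) (i : 'I_p) (j : 'I_q) :
  measurable_fun [set: 'M[R]_(p, q)] f ->
  (forall M D, is_derive M D f (f' M D)) ->
  (forall M D1 D2, f' M (D1 + D2) = f' M D1 + f' M D2) ->
  (forall M c D, f' M (c *: D) = c * f' M D) ->
  (forall M, `|f M| <= K) -> (forall D, exists C, forall M, `|f' M D| <= C) ->
  (\int[P]_w (f' (Z w) (delta_mx i j))%:E =
   \int[P]_w ((invmx Gamma *m (Z w - theta)) i j * f (Z w))%:E)%E.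
Proof.
move=> mf df f'D f'Z bf bf'.
have [B BB resB] := normal_cols_resample mZ uG Znormal j.
have uB := unitmx_of_mul_tr BB uG.
pose D k : 'M[R]_(p, q) := col k B *m delta_mx 0 j.
have mf' k : measurable_fun [set: 'M[R]_(p, q)] (fun M => f' M (D k)).
  by apply: measurable_derivative mf _ => M.
have f'sum M (c : 'I_p -> R) :
    f' M (\sum_k c k *: D k) = \sum_k c k * f' M (D k).
  rewrite (big_morph (f' M) (id1 := 0) (op1 := +%R)) => [|D1 D2|].
  - by apply: eq_bigr => k _.
  - exact: f'D.
  - by rewrite -(scale0r 0) f'Z mul0r.
have Edelta : delta_mx i j = \sum_k (invmx B k i) *: D k.
  apply/matrixP => a c; rewrite summxE.
  transitivity (((B *m invmx B) *m delta_mx i j) a c).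
    by rewrite mulmxV// mul1mx.
  rewrite -mulmxA mxE; apply: eq_bigr => k _.
  rewrite !mxE big_ord1 !mxE eqxx /= mulrCA; congr (_ * _).
  rewrite (bigD1 i)//= big1 ?addr0; last first.
    by move=> l li; rewrite mxE (negbTE li) mulr0.
  by rewrite mxE eqxx.
have Eell M : (invmx Gamma *m (M - theta)) i j =
    \sum_k invmx B k i * coord B j k M.
  transitivity ((invmx Gamma *m (col j M - col j theta)) i 0).
    by rewrite !mxE; apply: eq_bigr => k _; rewrite !mxE.
  have -> : invmx Gamma = (invmx B)^T *m invmx B.
    apply: invmx_uniq; rewrite -BB -mulmxA [B^T *m _]mulmxA trmx_inv.
    by rewrite mulmxV ?unitmx_tr// mul1mx mulmxV.
  rewrite -mulmxA mxE.
  by apply: eq_bigr => k _; rewrite [X in X * _]mxE.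
have i1 k : P.-integrable setT (fun w => (f' (Z w) (D k))%:E).
  have [C bC] := bf' (D k).
  apply: (@bounded_integrable _ _ _ P (fun w => f' (Z w) (D k)) C) => //.
  exact: (measurableT_comp (mf' k)).
have i2 k : P.-integrable setT (fun w => (coord B j k (Z w) * f (Z w))%:E).
  apply: L2_integrable; under eq_fun do rewrite mulrC.
  apply: (@L2_bounded_mul _ _ _ _ _ _ K) => //; last exact: (measurableT_comp mf).
  split; first exact: (measurableT_comp (measurable_coord B j k)).
  exact: (resample_second_moment mZ (measurable_coord B j k)
    (fun M s => coordD j k M s uB) (resB k)).
under eq_integral do rewrite Edelta f'sum -sumEFin.
rewrite integral_sum//; last first.
  by move=> k; under eq_fun do rewrite EFinM; exact: integrableZl.
under [RHS]eq_integral do rewrite Eell mulr_suml -sumEFin.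
rewrite integral_sum//; last first.
  by move=> k; under eq_fun do rewrite -mulrA EFinM; exact: integrableZl.
apply: eq_bigr => k _.
under eq_integral do rewrite EFinM.
under [RHS]eq_integral do rewrite -mulrA EFinM.
rewrite integralZl// integralZl//; congr (_ * _)%E.
have [C bC] := bf' (D k).
apply: (@resample_stein _ _ _ _ _ _ _ (D k) _ mZ (measurable_coord B j k)
  (fun M s => coordD j k M s uB) (resB k) _ _ (K + C)) => // M.
- by apply: (le_trans (bf M)); rewrite lerDl; exact: le_trans (bC 0).
- by apply: (le_trans (bC M)); rewrite lerDr; exact: le_trans (bf 0).
Qed.

End normal_columns_stein.

(** * Leading minors and almost sure full rank *)

Section leading_minor.
Context (R : realType) (p q : nat).

Definition topleft k (kp : (k <= p)%N) (kq : (k <= q)%N) (M : 'M[R]_(p, q)) :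
  'M[R]_k := mxsub (widen_ord kp) (widen_ord kq) M.

Lemma row_free_colsub n (g : 'I_p -> 'I_n) (W : 'M[R]_(p, n)) :
  \det (colsub g W) != 0 -> row_free W.
Proof.
move=> dW; apply/row_freeP; exists (colsub g 1%:M *m invmx (colsub g W)).
rewrite mulmxA; have -> : W *m colsub g 1%:M = colsub g W.
  apply/matrixP => i j; rewrite !mxE (bigD1 (g j))//= big1 ?addr0.
    by rewrite !mxE eqxx mulr1.
  by move=> a /negbTE ag; rewrite !mxE ag mulr0.
by rewrite mulmxV// unitmxE unitfE.
Qed.

Lemma row_free_rowsub n (g : 'I_n -> 'I_p) (B : 'M[R]_p) : injective g ->
  B \in unitmx -> row_free (rowsub g B).
Proof.
move=> gI uB; apply/row_freeP; exists (invmx B *m colsub g 1%:M).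
apply/matrixP => i j.
transitivity ((rowsub g 1%:M *m (B *m (invmx B *m colsub g (1%:M : 'M[R]_p)))) i j).
  rewrite mulmxA; congr ((_ *m _) i j).
  apply/matrixP => a b; rewrite !mxE (bigD1 (g a))//= big1 ?addr0.
    by rewrite !mxE eqxx mul1r.
  by move=> c; rewrite eq_sym => /negbTE ca; rewrite !mxE ca mul0r.
rewrite mulKVmx// !mxE (bigD1 (g i))//= big1 ?addr0.
  by rewrite !mxE eqxx mul1r inj_eq.
by move=> c; rewrite eq_sym => /negbTE ca; rewrite !mxE ca mul0r.
Qed.

End leading_minor.

Section normal_columns_minor.
Context d (Omega : measurableType d) (R : realType) (P : probability Omega R).
Context (p q : nat) (theta : 'M[R]_(p, q)) (Gamma : 'M[R]_p).
Variable Z : Omega -> 'M[R]_(p, q).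
Hypothesis mZ : measurable_fun [set: Omega] Z.
Hypothesis uG : Gamma \in unitmx.
Hypothesis Znormal : normal_matrix_cols P theta Gamma Z.

(* Expanding along its last column, the leading minor of order [k.+1] is affine
   in that column, and the coefficient of its last entry is the leading minor of
   order [k]. *)
Lemma normal_cols_minor k (kp : (k <= p)%N) (kq : (k <= q)%N) :
  {ae P, forall w, \det (topleft kp kq (Z w)) != 0}.
Proof.
elim: k kp kq => [|k IH] kp kq; first by apply: aeW => w; rewrite det_mx00 oner_neq0.
pose j := widen_ord kq ord_max.
have [B BB resB] := normal_cols_resample mZ uG Znormal j.
have uB := unitmx_of_mul_tr BB uG.
pose Q (M : 'M[R]_(p, q)) := \det (topleft kp kq M).
pose cof (M : 'M[R]_(p, q)) : 'rV[R]_k.+1 :=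
  \row_i cofactor (topleft kp kq M) i ord_max.
pose c (l : 'I_p) (M : 'M[R]_(p, q)) := (cof M *m rowsub (widen_ord kp) B) 0 l.
pose D (l : 'I_p) : 'M[R]_(p, q) := col l B *m delta_mx 0 j.
have DE l a b : D l a b = B a l * (b == j)%:R.
  by rewrite /D !mxE big_ord1 !mxE eqxx.
have cofD l M s : cof (M + s *: D l) = cof M.
  apply/rowP => i; rewrite !mxE; congr (_ * \det _).
  apply/matrixP => a b; do 2 rewrite [LHS]mxE [RHS]mxE.
  rewrite [LHS]mxE [RHS]mxE [LHS]mxE [X in _ + X]mxE DE.
  rewrite (_ : _ == j = false) ?mulr0 ?mulr0 ?addr0//.
  apply/negbTE/eqP => /(congr1 val) /=; rewrite /bump leqNgt ltn_ord add0n => H.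
  by have /= := ltn_ord b; rewrite H ltnn.
have QE M : Q M = \sum_i M (widen_ord kp i) j * cof M 0 i.
  rewrite /Q (expand_det_col _ ord_max); apply: eq_bigr => i _.
  by rewrite !mxE.
have QD l M s : Q (M + s *: D l) = Q M + s * c l M.
  rewrite !QE cofD /c [X in _ = _ + _ * X]mxE mulr_sumr -big_split/=.
  apply: eq_bigr => i _; rewrite !mxE big_ord1 !mxE !eqxx /=; ring.
have mtop : measurable_fun [set: 'M[R]_(p, q)] (topleft kp kq).
  exact: measurable_mxsub.
have mQ : measurable_fun [set: 'M[R]_(p, q)] Q by exact: measurable_det.
have mcof : measurable_fun [set: 'M[R]_(p, q)] cof.
  apply/measurable_fun_mxP => a i; under eq_fun do rewrite mxE.
  apply: measurable_funM => //; apply: measurable_det.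
  have -> : (fun u : 'M[R]_(p, q) => row' i (col' ord_max (topleft kp kq u))) =
            (fun u => mxsub (lift i) (lift ord_max) (topleft kp kq u)).
    by apply/funext => u; apply/matrixP => x y; rewrite !mxE.
  exact: measurable_mxsub.
have mc l : measurable_fun [set: 'M[R]_(p, q)] (c l).
  by apply: (measurableT_comp (measurable_mx_coord 0 l)); exact: measurable_mulmx.
pose coord l (M : 'M[R]_(p, q)) : R := (invmx B *m (col j M - col j theta)) l 0.
have mcoord l : measurable_fun [set: 'M[R]_(p, q)] (coord l).
  apply: (measurableT_comp (measurable_mx_coord l 0)).
  apply: measurable_mulmx => //; apply: measurable_addmx => //.
  exact: measurable_col.
have H l : {ae P, forall w, Q (Z w) = 0 -> c l (Z w) = 0}.
  apply: (resample_affine_neq0 mZ (mcoord l) (resB l) mQ (mc l) (QD l)) => M s.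
  by rewrite /c cofD.
have kp' : (k <= p)%N by exact: ltnW.
have kq' : (k <= q)%N by exact: ltnW.
have {}IH := IH kp' kq'.
have {}H : {ae P, forall w, forall l, Q (Z w) = 0 -> c l (Z w) = 0}.
  exact: filter_forall.
apply: filterS2 IH H => w IHw Hw; apply/eqP => Q0.
(* [c l] is the slope of the minor in the direction [D l]. All slopes vanish, so the row of
   cofactors is a relation between the first k + 1 rows of [B], which are independent. *)
have cof0 : cof (Z w) = 0.
  have winj : injective (widen_ord kp) by move=> a b /(congr1 val)/= /val_inj.
  apply: (row_free_inj (row_free_rowsub winj uB)).
  rewrite mul0mx; apply/rowP => l; rewrite [RHS]mxE.
  exact: Hw.
move/eqP: IHw; apply.
have := congr1 (fun u : 'rV[R]_k.+1 => u 0 ord_max) cof0.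
rewrite !mxE /cofactor => /eqP; rewrite mulf_eq0 signr_eq0/= => /eqP <-.
congr (\det _); apply/matrixP => a b; rewrite !mxE.
by congr (Z w _ _); apply: val_inj; rewrite /= /bump leqNgt ltn_ord.
Qed.

End normal_columns_minor.

Section normal_rows.
Context d (Omega : measurableType d) (R : realType) (P : probability Omega R).
Context (m p : nat) (Gamma : 'M[R]_p).
Variable Y : Omega -> 'M[R]_(m, p).
Hypothesis mY : measurable_fun [set: Omega] Y.
Hypothesis uG : Gamma \in unitmx.
Hypothesis Ynormal : normal_matrix_rows P Gamma Y.

Let Yt w := (Y w)^T.

Let mYt : measurable_fun [set: Omega] Yt. Proof. exact: measurable_trmx. Qed.

Lemma normal_rows_tr : normal_matrix_cols P (0 : 'M[R]_(p, m)) Gamma Yt.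
Proof.
have [Yind Yrow] := Ynormal; split=> [E mE|j].
  have := Yind (fun j => trmx @^-1` E j).
  have mtr j : measurable (trmx @^-1` E j : set 'rV[R]_p).
    rewrite -[X in measurable X]setTI.
    by apply: (measurable_trmx (@measurable_id _ _ setT)).
  move=> /(_ mtr).
  have EE j : (fun w => row j (Y w)) @^-1` (trmx @^-1` E j) =
      (fun w => col j (Yt w)) @^-1` E j.
    by apply/seteqP; split=> w /=; rewrite /Yt -tr_row.
  by rewrite (eq_bigr _ (fun j _ => congr1 P (EE j))) (eq_bigcapr (fun j _ => EE j)).
rewrite (_ : col j 0 = 0); last by apply/colP => i; rewrite !mxE.
rewrite (_ : (fun w => _) = (fun w => (row j (Y w))^T))//.
by apply/funext => w; rewrite tr_row.
Qed.

Lemma normal_rows_L2 a i : L2 P (fun w => Y w a i).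
Proof.
have := normal_cols_L2 mYt uG normal_rows_tr i a.
by under eq_fun do rewrite subr0 mxE.
Qed.

Lemma is_derive_tr (f : 'M[R]_(m, p) -> R) (M D : 'M[R]_(p, m)) (df : R) :
  is_derive M^T D^T f df -> is_derive M D (fun N => f N^T) df.
Proof.
move=> H.
have E : (fun h : R => h^-1 *: (((fun N => f N^T) \o shift M) (h *: D) - f M^T))
    = (fun h : R => h^-1 *: ((f \o shift M^T) (h *: D^T) - f M^T)).
  by apply/funext => h /=; congr (_ *: (f _ - _)); rewrite linearD linearZ.
apply: DeriveDef; first by rewrite /derivable E; exact: ex_derive.
by rewrite /derive E; exact: derive_val.
Qed.

Lemma normal_rows_stein (f : 'M[R]_(m, p) -> R)
    (f' : 'M[R]_(m, p) -> 'M[R]_(m, p) -> R) (K : R) (a : 'I_m) (i : 'I_p) :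
  measurable_fun [set: 'M[R]_(m, p)] f ->
  (forall M D, is_derive M D f (f' M D)) ->
  (forall M D1 D2, f' M (D1 + D2) = f' M D1 + f' M D2) ->
  (forall M c D, f' M (c *: D) = c * f' M D) ->
  (forall M, `|f M| <= K) -> (forall D, exists C, forall M, `|f' M D| <= C) ->
  (\int[P]_w (f' (Y w) (delta_mx a i))%:E =
   \int[P]_w ((Y w *m (invmx Gamma)^T) a i * f (Y w))%:E)%E.
Proof.
move=> mf df f'D f'Z bf bf'.
have := @normal_cols_stein _ _ _ P _ _ _ _ _ mYt uG normal_rows_tr
  (fun N => f N^T) (fun N D => f' N^T D^T) K i a.
rewrite /Yt; under eq_integral do rewrite trmxK trmx_delta.
under [X in _ -> _ -> _ -> _ -> _ -> _ -> _ = X]eq_integral.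
  move=> w _; rewrite trmxK subr0.
  rewrite (_ : (invmx Gamma *m _) i a = (Y w *m (invmx Gamma)^T) a i); last first.
    by rewrite -[X in X *m _]trmxK -trmx_mul mxE.
  over.
apply=> //.
- by apply: (measurableT_comp mf); exact: measurable_trmx.
- by move=> M D; apply: is_derive_tr; exact: df.
- by move=> M D1 D2; rewrite linearD f'D.
- by move=> M c D; rewrite linearZ f'Z.
- by move=> D; have [C bC] := bf' D^T; exists C.
Qed.

(** The leading minor of order min (m, p) is almost surely nonzero, which makes the columns of [Y]
    independent if p <= m and its rows otherwise. *)
Lemma normal_rows_full_rank : {ae P, forall w,
  if (p <= m)%N then gram (Y w) \in unitmx else Y w *m (Y w)^T \in unitmx}.
Proof.
case: leqP => pm.
  have := normal_cols_minor mYt uG normal_rows_tr (leqnn p) pm.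
  apply: filterS => w dw; rewrite /gram -[X in _ *m X]trmxK; apply: gram_unitmx.
  apply: (@row_free_colsub _ _ _ (widen_ord pm)); move: dw.
  congr (\det _ != 0); apply/matrixP => i j; rewrite !mxE.
  by congr (Y w _ _); apply: val_inj.
have := normal_cols_minor mYt uG normal_rows_tr (ltnW pm) (leqnn m).
apply: filterS => w dw; apply: gram_unitmx.
apply: (@row_free_colsub _ _ _ (widen_ord (ltnW pm))); rewrite -det_tr; move: dw.
congr (\det _ != 0); apply/matrixP => i j; rewrite !mxE.
by congr (Y w _ _); apply: val_inj.
Qed.

End normal_rows.

Section independent_pair.
Context d (Omega : measurableType d) (R : realType) (P : probability Omega R).
Context d1 d2 (T1 : measurableType d1) (T2 : measurableType d2).
Variables (U : Omega -> T1) (V : Omega -> T2).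
Hypotheses (mU : measurable_fun [set: Omega] U)
           (mV : measurable_fun [set: Omega] V).
Hypothesis UV : independent P U V.

Let mUV : measurable_fun [set: Omega] (fun w => (U w, V w)).
Proof. exact: measurable_fun_pair. Qed.

Let mUV' : measurable_fun [set: Omega * Omega] (fun w => (U w.1, V w.2)).
Proof.
apply: measurable_fun_pair.
  by apply: (measurableT_comp mU); exact: measurable_fst.
by apply: (measurableT_comp mV); exact: measurable_snd.
Qed.

Lemma independent_same_law :
  same_law P (P \x P)%E (fun w => (U w, V w)) (fun w => (U w.1, V w.2)).
Proof.
apply: (@same_law_pi_system _ _ _ _ _ _ _ _ _ _ _ mUV mUV'
  [set A `*` B | A in measurable & B in measurable]).
- exact: measurable_prod_measurableType.
- move=> _ _ [A mA [B mB <-]] [A' mA' [B' mB' <-]].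
  exists (A `&` A'); first exact: measurableI.
  by exists (B `&` B'); [exact: measurableI|rewrite setXI].
- by exists setT => //; exists setT => //; rewrite setXTT.
- move=> _ [A mA [B mB <-]].
  transitivity (P (U @^-1` A `&` V @^-1` B)); first by [].
  rewrite UV//; transitivity ((P \x P)%E ((U @^-1` A) `*` (V @^-1` B))); last by [].
  apply/esym/product_measure1E.
    by rewrite -[X in measurable X]setTI; exact: mU.
  by rewrite -[X in measurable X]setTI; exact: mV.
Qed.

Lemma ge0_independent_integral (g : T1 * T2 -> \bar R) :
  measurable_fun [set: T1 * T2] g -> (forall u, (0 <= g u)%E) ->
  (\int[P]_w g (U w, V w) = \int[P]_w \int[P]_w' g (U w, V w'))%E.
Proof.
move=> mg g0.
rewrite (ge0_same_law_integral mUV mUV' independent_same_law mg g0).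
by rewrite fubini_tonelli1//; exact: (measurableT_comp mg mUV').
Qed.

(** This order of integration averages over [X] first, with S fixed, as the bound on 1 / F
    requires. *)
Lemma ge0_independent_integral2 (g : T1 * T2 -> \bar R) :
  measurable_fun [set: T1 * T2] g -> (forall u, (0 <= g u)%E) ->
  (\int[P]_w g (U w, V w) = \int[P]_w' \int[P]_w g (U w, V w'))%E.
Proof.
move=> mg g0.
rewrite (ge0_same_law_integral mUV mUV' independent_same_law mg g0).
have mg' := measurableT_comp mg mUV'.
by rewrite (fubini_tonelli1 _ mg' (fun=> g0 _)) (fubini_tonelli _ mg' (fun=> g0 _)).
Qed.

Lemma measurable_inner_integral2 (g : T1 * T2 -> \bar R) :
  measurable_fun [set: T1 * T2] g -> (forall u, (0 <= g u)%E) ->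
  measurable_fun [set: Omega] (fun w' => \int[P]_w g (U w, V w'))%E.
Proof.
move=> mg g0; have mg' := measurableT_comp mg mUV'.
exact: (@measurable_fun_fubini_tonelli_G _ _ _ _ _ P _ mg' (fun u => g0 _)).
Qed.

Lemma bounded_independent_integral (g : T1 * T2 -> R) (K : R) :
  measurable_fun [set: T1 * T2] g -> (forall w w', `|g (U w, V w')| <= K) ->
  (\int[P]_w (g (U w, V w))%:E = \int[P]_w \int[P]_w' (g (U w, V w'))%:E)%E.
Proof.
move=> mg bg.
have mgE : measurable_fun [set: T1 * T2] (EFin \o g) by exact/measurable_EFinP.
rewrite (same_law_integral mUV mUV' independent_same_law mgE).
rewrite -(@integral12_prod_meas1 _ _ _ _ _ P P
  (fun w => (g (U w.1, V w.2))%:E))//.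
apply: (@bounded_integrable _ _ _ (P \x P)%E (fun w => g (U w.1, V w.2)) K) => //.
exact: (measurableT_comp mg mUV').
Qed.

End independent_pair.

(** * Resolvents and Moore-Penrose inverses of Gram matrices *)

Section frobenius.
Context {R : realFieldType}.

Definition fro2 m n (A : 'M[R]_(m, n)) : R := \sum_i \sum_j A i j ^+ 2.

Lemma fro2_ge0 m n (A : 'M[R]_(m, n)) : 0 <= fro2 A.
Proof. by apply: sumr_ge0 => i _; apply: sumr_ge0 => j _; exact: sqr_ge0. Qed.

Lemma mxtrace_mul_tr m n (A B : 'M[R]_(m, n)) :
  \tr (A^T *m B) = \sum_i \sum_j A i j * B i j.
Proof.
rewrite exchange_big /=; apply: eq_bigr => j _; rewrite mxE.
by apply: eq_bigr => i _; rewrite mxE.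
Qed.

Lemma fro2E m n (A : 'M[R]_(m, n)) : fro2 A = \tr (A^T *m A).
Proof. by rewrite mxtrace_mul_tr. Qed.

Lemma fro2_tr m n (A : 'M[R]_(m, n)) : fro2 A^T = fro2 A.
Proof. by rewrite !fro2E trmxK mxtrace_mulC. Qed.

Lemma fro2_eq0 m n (A : 'M[R]_(m, n)) : fro2 A = 0 -> A = 0.
Proof.
move=> /eqP; rewrite psumr_eq0; last first.
  by move=> i _; apply: sumr_ge0 => j _; exact: sqr_ge0.
move=> /allP A0; apply/matrixP => i j; rewrite mxE.
have := A0 i (mem_index_enum i); rewrite psumr_eq0; last first.
  by move=> k _; exact: sqr_ge0.
by move=> /allP /(_ j (mem_index_enum j)); rewrite /= sqrf_eq0 => /eqP.
Qed.

Lemma sqr_entry_le_fro2 m n (A : 'M[R]_(m, n)) i j : A i j ^+ 2 <= fro2 A.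
Proof.
rewrite /fro2 (bigD1 i)//= (bigD1 j)//= -addrA lerDl addr_ge0//.
  by apply: sumr_ge0 => k _; exact: sqr_ge0.
by apply: sumr_ge0 => k _; apply: sumr_ge0 => l _; exact: sqr_ge0.
Qed.

Lemma norm_mxtrace_mul_tr_le m n (A B : 'M[R]_(m, n)) :
  2 * `|\tr (A^T *m B)| <= fro2 A + fro2 B.
Proof.
have H (s : R) : s ^+ 2 = 1 -> 2 * (s * \tr (A^T *m B)) <= fro2 A + fro2 B.
  move=> s2; rewrite mxtrace_mul_tr /fro2 -big_split/= !mulr_sumr.
  apply: ler_sum => i _; rewrite -big_split/= !mulr_sumr; apply: ler_sum => j _ /=.
  have := sqr_ge0 (A i j - s * B i j); rewrite sqrrB exprMn s2 mul1r; lra.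
have [t0|t0] := ger0P (\tr (A^T *m B)).
  by have := H 1; rewrite expr1n mul1r; exact.
by have := H (-1); rewrite sqrrN expr1n mulN1r; exact.
Qed.

(* Lagrange's identity. *)
Lemma sum_cauchy_schwarz (I : finType) (a b : I -> R) :
  (\sum_i a i * b i) ^+ 2 <= (\sum_i a i ^+ 2) * (\sum_i b i ^+ 2).
Proof.
have : 0 <= \sum_i \sum_j (a i * b j - a j * b i) ^+ 2.
  by apply: sumr_ge0 => i _; apply: sumr_ge0 => j _; exact: sqr_ge0.
have -> : \sum_i \sum_j (a i * b j - a j * b i) ^+ 2 =
   \sum_i \sum_j (a i ^+ 2 * b j ^+ 2) + \sum_i \sum_j (b i ^+ 2 * a j ^+ 2)
   - 2 * \sum_i \sum_j ((a i * b i) * (a j * b j)).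
  rewrite mulr_sumr -big_split/= -sumrB; apply: eq_bigr => i _.
  by rewrite mulr_sumr -big_split/= -sumrB; apply: eq_bigr => j _; ring.
have E (u v : I -> R) :
    \sum_i \sum_j u i * v j = (\sum_i u i) * (\sum_j v j).
  by rewrite mulr_suml; apply: eq_bigr => i _; rewrite mulr_sumr.
rewrite !E expr2; lra.
Qed.

Lemma fro2_mul m n p (A : 'M[R]_(m, n)) (B : 'M[R]_(n, p)) :
  fro2 (A *m B) <= fro2 A * fro2 B.
Proof.
rewrite /fro2 mulr_suml; apply: ler_sum => i _.
rewrite [X in _ <= _ * X]exchange_big /= mulr_sumr; apply: ler_sum => k _.
rewrite mxE; exact: sum_cauchy_schwarz.
Qed.

(** Bounding |v_i v_j| by (v_i^2 + v_j^2) / 2 over all pairs of indices produces the factor m,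
    without any operator norm. *)
Lemma norm_quad_le m n (W : 'M[R]_m) (V : 'M[R]_(m, n)) (c : R) :
  (forall i j, `|W i j| <= c) -> `|\tr (V^T *m W *m V)| <= c * m%:R * fro2 V.
Proof.
move=> Wc.
have -> : \tr (V^T *m W *m V) = \sum_i \sum_j \sum_k (W i j * (V i k * V j k)).
  rewrite -mulmxA mxtrace_mul_tr; apply: eq_bigr => i _; rewrite exchange_big /=.
  apply: eq_bigr => k _; rewrite mxE mulr_sumr.
  by apply: eq_bigr => j _; rewrite mulrCA.
pose v i := \sum_k V i k ^+ 2.
apply: (@le_trans _ _ (\sum_i \sum_j (c * ((v i + v j) / 2)))).
  apply: (le_trans (ler_norm_sum _ _ _)); apply: ler_sum => i _.
  apply: (le_trans (ler_norm_sum _ _ _)); apply: ler_sum => j _.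
  apply: (le_trans (ler_norm_sum _ _ _)).
  rewrite /v -big_split/= mulr_suml mulr_sumr; apply: ler_sum => k _.
  rewrite normrM ler_pM// normrM.
  have := sqr_ge0 (`|V i k| - `|V j k|); rewrite sqrrB !real_normK ?num_real//; lra.
under eq_bigr do rewrite -mulr_sumr -mulr_suml.
rewrite -mulr_sumr -mulr_suml.
have -> : \sum_i \sum_j (v i + v j) = 2 * m%:R * fro2 V.
  under eq_bigr do rewrite big_split/= sumr_const card_ord -mulr_natl.
  rewrite big_split/= -mulr_sumr sumr_const card_ord -mulr_natl.
  by rewrite -/(fro2 V); ring.
by rewrite le_eqVlt; apply/orP; left; apply/eqP; field.
Qed.

End frobenius.

Section resolvent.
Context {R : realType}.

Definition resolv m p (de : R) (Y : 'M[R]_(m, p)) : 'M[R]_p :=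
  invmx (gram Y + de%:M).

Context (m p : nat) (de : R) (de_gt0 : 0 < de).
Implicit Types Y : 'M[R]_(m, p).

Lemma gram_tr Y : (gram Y)^T = gram Y.
Proof. by rewrite trmx_mul trmxK. Qed.

(** The matrix is N N^T for the block row N = (Y^T, sqrt de I), whose rows are independent because
    of the second block. *)
Lemma gram_shift_unitmx Y : gram Y + de%:M \in unitmx.
Proof.
have s0 : Num.sqrt de != 0 by rewrite gt_eqF// sqrtr_gt0.
have -> : gram Y + de%:M =
    row_mx Y^T (Num.sqrt de)%:M *m (row_mx Y^T (Num.sqrt de)%:M)^T.
  rewrite tr_row_mx trmxK mul_row_col tr_scalar_mx -scalar_mxM -expr2.
  by rewrite sqr_sqrtr// ltW.
apply: gram_unitmx; apply/row_freeP.
exists (col_mx 0 (Num.sqrt de)^-1%:M).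
by rewrite mul_row_col mulmx0 add0r -scalar_mxM mulfV.
Qed.

Section resolvent_theory.
Variable Y : 'M[R]_(m, p).
Let S := gram Y.
Let C := resolv de Y.
Let U := Y *m C.
Let W := U *m Y^T.

Lemma mul_resolv : C *m (S + de%:M) = 1%:M.
Proof. exact: mulVmx (gram_shift_unitmx Y). Qed.

Lemma resolv_mul : (S + de%:M) *m C = 1%:M.
Proof. exact: mulmxV (gram_shift_unitmx Y). Qed.

Lemma resolv_tr : C^T = C.
Proof. by rewrite trmx_inv linearD/= tr_scalar_mx gram_tr. Qed.

Lemma resolv_gram : C *m S = 1%:M - de *: C.
Proof. by rewrite -mul_resolv mulmxDr mul_mx_scalar addrK. Qed.

Lemma gram_resolv : S *m C = 1%:M - de *: C.
Proof. by rewrite -resolv_mul mulmxDl mul_scalar_mx addrK. Qed.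

Lemma resolv_comm : S *m C = C *m S.
Proof. by rewrite resolv_gram gram_resolv. Qed.

Lemma trU_U : U^T *m U = C *m S *m C.
Proof. by rewrite trmx_mul resolv_tr !mulmxA. Qed.

(** Here and in [W_id] a symmetric matrix is a sum of two positive semidefinite terms, one of them
    quadratic in that same matrix. Comparing diagonals bounds its entries whatever [Y] is. *)
Let trU_U_id : U^T *m U + de *: (C^T *m C) = C.
Proof.
by rewrite trU_U resolv_tr resolv_gram mulmxBl mul1mx -scalemxAl subrK.
Qed.

Let W_tr : W^T = W.
Proof. by rewrite !trmx_mul trmxK resolv_tr mulmxA. Qed.

Let W_id : W^T *m W + de *: (U *m U^T) = W.
Proof.
have -> : W^T *m W = U *m (S *m C) *m Y^T.
  by rewrite W_tr /W /U /S /gram !mulmxA.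
have -> : U *m U^T = U *m C *m Y^T.
  by rewrite [X in _ *m X]trmx_mul resolv_tr mulmxA.
by rewrite gram_resolv mulmxBr mulmx1 mulmxBl -scalemxAr -scalemxAl subrK.
Qed.

Lemma diag_sqr n k (A : 'M[R]_(n, k)) i j : A i j ^+ 2 <= (A^T *m A) j j.
Proof.
rewrite mxE (bigD1 i)//= mxE -expr2 lerDl; apply: sumr_ge0 => a _.
by rewrite mxE -expr2 sqr_ge0.
Qed.

Let ge0_diag n k (A : 'M[R]_(n, k)) j : 0 <= (A^T *m A) j j.
Proof. by rewrite mxE; apply: sumr_ge0 => a _; rewrite mxE -expr2 sqr_ge0. Qed.

Let diagC j : C j j <= de^-1.
Proof.
have H := congr1 (fun A : 'M[R]_p => A j j) trU_U_id; rewrite mxE [X in _ + X]mxE in H.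
have H1 := ge0_diag U j; have H2 := diag_sqr C j j.
have H3 : de * C j j ^+ 2 <= C j j.
  by rewrite -[leRHS]H; have := ler_wpM2l (ltW de_gt0) H2; lra.
have [c0|c0] := leP (C j j) 0; first by apply: (le_trans c0); rewrite invr_ge0 ltW.
rewrite -(ler_pM2l de_gt0) mulfV ?gt_eqF// -(ler_pM2r c0) mul1r -mulrA -expr2.
exact: H3.
Qed.

Lemma resolv_bound i j : `|C i j| <= de^-1.
Proof.
have H := congr1 (fun A : 'M[R]_p => A j j) trU_U_id; rewrite mxE [X in _ + X]mxE in H.
have H1 := ge0_diag U j; have H2 := diag_sqr C i j; have H3 := diagC j.
have H4 : de * C i j ^+ 2 <= de^-1 by have := ler_wpM2l (ltW de_gt0) H2; lra.
rewrite -(@ler_pXn2r _ 2)// ?nnegrE// ?invr_ge0 ?(ltW de_gt0)//.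
rewrite real_normK ?num_real// -(ler_pM2l de_gt0); apply: le_trans H4 _.
by rewrite expr2 mulrA mulfV ?gt_eqF// mul1r.
Qed.

Lemma sqr_mul_resolv_bound a i : U a i ^+ 2 <= de^-1.
Proof.
have H := congr1 (fun A : 'M[R]_p => A i i) trU_U_id; rewrite mxE [X in _ + X]mxE in H.
have H1 := diag_sqr U a i; have H2 := ge0_diag C i; have H3 := diagC i.
by have := mulr_ge0 (ltW de_gt0) H2; lra.
Qed.

(** By the diagonal of [W_id], each squared entry of column c is at most W c c. For the diagonal
    entry this forces W c c <= 1, and then the whole column is bounded by 1. *)
Lemma mul_resolv_tr_bound a b : `|W a b| <= 1.
Proof.
have H c : W c c ^+ 2 <= W c c /\ forall a', W a' c ^+ 2 <= W c c.
  have HH := congr1 (fun A : 'M[R]_m => A c c) W_id; rewrite mxE [X in _ + X]mxE in HH.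
  have Hd : 0 <= de * (U *m U^T) c c.
    by rewrite mulr_ge0 ?(ltW de_gt0)// -{1}[U]trmxK; exact: ge0_diag.
  by split=> [|a']; rewrite -[leRHS]HH; [have := diag_sqr W c c|have := diag_sqr W a' c];
    lra.
have [H1 /(_ a) H2] := H b.
have H3 : W b b <= 1.
  have [c0|c0] := leP (W b b) 0; first by apply: (le_trans c0).
  by rewrite -(ler_pM2r c0) mul1r -expr2.
rewrite -(@ler_pXn2r _ 2)// ?nnegrE// expr1n real_normK ?num_real//; lra.
Qed.

End resolvent_theory.

End resolvent.

(** In a full rank factorisation Q = c w, cancelling the outer factors in Q Q = Q leaves w c = 1, an
    identity of size rank Q; the trace is cyclic. *)
Lemma mxtrace_idempotent (K : fieldType) m (Q : 'M[K]_m) : Q *m Q = Q -> \tr Q = (\rank Q)%:R.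
Proof.
move=> QQ; rewrite -{1}(mulmx_base Q) mxtrace_mulC.
suff -> : row_base Q *m col_base Q = 1%:M by rewrite mxtrace1.
apply: (row_free_inj (row_base_free Q)); rewrite mul1mx.
have /row_fullP[L LC] := col_base_full Q.
have : (col_base Q *m row_base Q) *m (col_base Q *m row_base Q) =
       col_base Q *m row_base Q by rewrite mulmx_base QQ.
move: (col_base Q) (row_base Q) LC => c w LC /(congr1 (mulmx L)).
by rewrite !mulmxA LC !mul1mx.
Qed.

Section moore_penrose_gram.
Context {R : realType}.

Lemma mpinv_tr p (S : 'M[R]_p) : S^T = S -> (mpinv S)^T = mpinv S.
Proof.
move=> St; have [a b c e] := mpinvP S.
apply: (@is_mpinv_uniq _ _ _ S); last exact: mpinvP.
have E1 : S *m (mpinv S)^T = mpinv S *m S by rewrite -e trmx_mul St.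
have E2 : (mpinv S)^T *m S = S *m mpinv S by rewrite -c trmx_mul St.
split.
- by have := congr1 trmx a; rewrite !trmx_mul St mulmxA.
- by have := congr1 trmx b; rewrite !trmx_mul St mulmxA.
- by rewrite E1 e.
- by rewrite E2 c.
Qed.

Lemma mxtrace_mul_mpinv m n (S : 'M[R]_(m, n)) : \tr (S *m mpinv S) = (\rank S)%:R.
Proof.
have [a b c e] := mpinvP S.
rewrite mxtrace_idempotent ?mulmxA ?a//; congr (_%:R).
apply/eqP; rewrite eqn_leq mxrankM_maxl/= -{1}a.
exact: mxrankM_maxl.
Qed.

Context (m p : nat) (Y : 'M[R]_(m, p)).
Let S := gram Y.
Let B := mpinv S.

Lemma mpinv_gram_tr : B^T = B. Proof. exact/mpinv_tr/gram_tr. Qed.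

Lemma mpinv_gram_comm : S *m B = B *m S.
Proof.
have [_ _ c _] := mpinvP S.
by rewrite -[LHS]c trmx_mul mpinv_gram_tr gram_tr.
Qed.

Lemma mpinv_gram_proj_tr : (S *m B)^T = S *m B.
Proof. by have [_ _ c _] := mpinvP S. Qed.

Lemma gram_mpinv_gram : S *m B *m S = S.
Proof. by have [a _ _ _] := mpinvP S. Qed.

Lemma gram_gram_mpinv : S *m (S *m B) = S.
Proof. by rewrite mpinv_gram_comm mulmxA gram_mpinv_gram. Qed.

Lemma mpinv_gram_mpinv : B *m S *m B = B.
Proof. by have [_ b _ _] := mpinvP S. Qed.

Lemma mpinv_gram_fro : B = (Y *m B)^T *m (Y *m B).
Proof.
by rewrite trmx_mul mpinv_gram_tr -{1}mpinv_gram_mpinv /S /gram !mulmxA.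
Qed.

(** The squared Frobenius norm of Y (1 - S S^+) is a trace containing the factor S (1 - S S^+) =
    0. *)
Lemma mul_gram_proj : Y *m (S *m B) = Y.
Proof.
apply/eqP; rewrite -subr_eq0 -{2}[Y]mulmx1 -mulmxBr; apply/eqP/fro2_eq0.
rewrite fro2E trmx_mul mulmxA -[_ *m Y^T *m Y]mulmxA -/(gram Y) -/S.
rewrite -mulmxA mulmxBr mulmx1 gram_gram_mpinv subrr.
by rewrite mulmx0 linear0.
Qed.

Variables (de : R) (de_gt0 : 0 < de).
Let C := resolv de Y.

(** The error of the regularised projection is [de] times a product that stays bounded, since C S
    does. Convergence follows without a spectral decomposition. *)
Lemma resolv_gram_proj : C *m S - S *m B = - (de *: (C *m S *m B)).
Proof.
have -> : S *m B = C *m S + de *: (C *m S *m B).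
  rewrite -{1}[S *m B]mul1mx -(mul_resolv de_gt0 Y) -/C mulmxDr mulmxDl.
  by rewrite mul_mx_scalar -scalemxAl -mulmxA gram_gram_mpinv -mulmxA.
by rewrite opprD addrA subrr add0r.
Qed.

(** [C] diverges on the kernel of S as [de] tends to 0; C S C is here expressed through C S, which
    converges. *)
Lemma resolv_gram_resolv : C *m S *m C = C *m S *m (C *m S) *m B.
Proof.
have -> : C *m S *m (C *m S) *m B = C *m ((S *m C) *m (S *m B)).
  by rewrite !mulmxA.
rewrite (resolv_comm de_gt0 Y) -[C *m S *m (S *m B)]mulmxA gram_gram_mpinv.
by rewrite -[in RHS](resolv_comm de_gt0 Y) mulmxA.
Qed.

End moore_penrose_gram.

(** * Entrywise limits and derivatives of matrices *)

Section entrywise_limits.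
Context {R : realType} {T : Type} (F : set_system T) {FF : Filter F}.

Definition mxcvg m n (f : T -> 'M[R]_(m, n)) (A : 'M[R]_(m, n)) :=
  forall i j, f t i j @[t --> F] --> A i j.

Lemma cvg_sum_real (I : finType) (f : I -> T -> R) (a : I -> R) :
  (forall i, f i t @[t --> F] --> a i) ->
  \sum_i f i t @[t --> F] --> \sum_i a i.
Proof.
by move=> fa; apply: cvg_big => //; exact: add_continuous.
Qed.

Lemma cvg_prod_real (I : finType) (f : I -> T -> R) (a : I -> R) :
  (forall i, f i t @[t --> F] --> a i) ->
  \prod_i f i t @[t --> F] --> \prod_i a i.
Proof.
by move=> fa; apply: cvg_big => //; exact: mul_continuous.
Qed.

Lemma mxcvg_cst m n (A : 'M[R]_(m, n)) : mxcvg (fun=> A) A.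
Proof. by move=> i j; exact: cvg_cst. Qed.

Lemma mxcvg_add m n (f g : T -> 'M[R]_(m, n)) A B :
  mxcvg f A -> mxcvg g B -> mxcvg (fun t => f t + g t) (A + B).
Proof.
by move=> fA gB i j; under eq_cvg do rewrite mxE; rewrite mxE; exact: cvgD.
Qed.

Lemma mxcvg_opp m n (f : T -> 'M[R]_(m, n)) A :
  mxcvg f A -> mxcvg (fun t => - f t) (- A).
Proof.
by move=> fA i j; under eq_cvg do rewrite mxE; rewrite mxE; exact: cvgN.
Qed.

Lemma mxcvg_scale m n (k : T -> R) (f : T -> 'M[R]_(m, n)) (c : R) A :
  k t @[t --> F] --> c -> mxcvg f A -> mxcvg (fun t => k t *: f t) (c *: A).
Proof.
by move=> kc fA i j; under eq_cvg do rewrite mxE; rewrite mxE; exact: cvgM.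
Qed.

Lemma mxcvg_mul m n p (f : T -> 'M[R]_(m, n)) (g : T -> 'M[R]_(n, p)) A B :
  mxcvg f A -> mxcvg g B -> mxcvg (fun t => f t *m g t) (A *m B).
Proof.
move=> fA gB i j; under eq_cvg do rewrite mxE; rewrite mxE.
by apply: cvg_sum_real => k; exact: cvgM.
Qed.

Lemma mxcvg_trace n (f : T -> 'M[R]_n) A :
  mxcvg f A -> \tr (f t) @[t --> F] --> \tr A.
Proof. by move=> fA; apply: cvg_sum_real => i; exact: fA. Qed.

Lemma mxcvg_det n (f : T -> 'M[R]_n) A :
  mxcvg f A -> \det (f t) @[t --> F] --> \det A.
Proof.
move=> fA; apply: cvg_sum_real => s; apply: cvgM; first exact: cvg_cst.
by apply: cvg_prod_real => i; exact: fA.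
Qed.

Lemma mxcvg_adj n (f : T -> 'M[R]_n) A :
  mxcvg f A -> mxcvg (fun t => \adj (f t)) (\adj A).
Proof.
move=> fA i j; under eq_cvg do rewrite mxE; rewrite mxE.
apply: cvgM; first exact: cvg_cst.
apply: mxcvg_det => a b; under eq_cvg do rewrite !mxE; rewrite !mxE.
exact: fA.
Qed.

Lemma mxcvg_near_unitmx n (f : T -> 'M[R]_n) A :
  mxcvg f A -> A \in unitmx -> \forall t \near F, f t \in unitmx.
Proof.
move=> fA uA; have dA : \det A != 0 by rewrite -unitfE -unitmxE.
have := @cvgr_neq0 _ _ _ F FF _ (\det A) (mxcvg_det fA) dA.
by apply: filterS => t; rewrite unitmxE unitfE.
Qed.

Lemma mxcvg_near_eq m n (f g : T -> 'M[R]_(m, n)) A :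
  (\forall t \near F, f t = g t) -> mxcvg f A -> mxcvg g A.
Proof.
move=> fg fA i j; apply: cvg_trans (fA i j); apply: near_eq_cvg.
by apply: filterS fg => t ->.
Qed.

Lemma mxcvg_invmx n (f : T -> 'M[R]_n) A :
  mxcvg f A -> A \in unitmx -> mxcvg (fun t => invmx (f t)) (invmx A).
Proof.
move=> fA uA.
apply: (@mxcvg_near_eq _ _ (fun t => (\det (f t))^-1 *: \adj (f t))).
  by apply: filterS (mxcvg_near_unitmx fA uA) => t ut; rewrite /invmx ut.
rewrite /invmx uA; apply: mxcvg_scale; last exact: mxcvg_adj.
by apply: cvgV; [rewrite -unitfE -unitmxE|exact: mxcvg_det].
Qed.

End entrywise_limits.

(** * Directional derivatives of matrix expressions *)

Section directional_calculus.
Context {R : realType} {V : normedModType R}.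
Implicit Types (x v : V).

Lemma is_derive_lineP (f : V -> R) x v (df : R) :
  is_derive x v f df <-> h^-1 * (f (h *: v + x) - f x) @[h --> 0^'] --> df.
Proof.
split=> [H|H].
  have /cvg_ex[/= l fl] := @ex_derive _ _ _ _ _ _ _ H.
  have <- : l = df by rewrite -(@derive_val _ _ _ _ _ _ _ H); apply/esym/cvg_lim.
  exact: fl.
by apply: DeriveDef; [apply/cvg_ex; exists df|apply/cvg_lim].
Qed.

Lemma is_derive_along (f : V -> R) x v (df : R) :
  is_derive x v f df <-> is_derive (0 : R) 1 (fun h : R => f (h *: v + x)) df.
Proof.
have E : (fun h : R => h^-1 *: (((fun s : R => f (s *: v + x)) \o shift (0 : R)) h%:A
      - f ((0 : R) *: v + x))) =
    (fun h : R => h^-1 * (f (h *: v + x) - f x)).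
  by apply/funext => h /=; rewrite addr0 [_%:A]mulr1 scale0r add0r.
split=> [/is_derive_lineP|].
  rewrite -E => H; apply: DeriveDef; first by apply/cvg_ex; exists df.
  exact/cvg_lim.
move=> H; apply/is_derive_lineP; rewrite -E.
have /cvg_ex[/= l fl] := @ex_derive _ _ _ _ _ _ _ H.
have <- : l = df by rewrite -(@derive_val _ _ _ _ _ _ _ H); apply/esym/cvg_lim.
exact: fl.
Qed.

Lemma is_derive_comp_real (phi : R -> R) (f : V -> R) x v (dphi df : R) :
  is_derive (f x) 1 phi dphi -> is_derive x v f df ->
  is_derive x v (fun y => phi (f y)) (dphi * df).
Proof.
move=> dp /is_derive_along H; apply/is_derive_along.
apply: (@is_derive1_comp R phi (fun h : R => f (h *: v + x))).
by rewrite scale0r add0r.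
Qed.

(** This concerns a single direction [v]; that [df] is linear in the direction is proved apart, as
    [mxlin]. *)
Definition mxder m n (f : V -> 'M[R]_(m, n)) x v (df : 'M[R]_(m, n)) :=
  forall i j, is_derive x v (fun y => f y i j) (df i j).

Lemma mxderP m n (f : V -> 'M[R]_(m, n)) x v df : mxder f x v df <->
  mxcvg 0^' (fun h : R => h^-1 *: (f (h *: v + x) - f x)) df.
Proof.
split=> H i j.
  by have /is_derive_lineP := H i j; under [in X in _ -> X]eq_cvg do rewrite !mxE.
by apply/is_derive_lineP; have := H i j; under [in X in X -> _]eq_cvg do rewrite !mxE.
Qed.

Lemma is_derive_sum_real (I : finType) (f : I -> V -> R) x v (df : I -> R) :
  (forall i, is_derive x v (f i) (df i)) ->
  is_derive x v (fun y => \sum_i f i y) (\sum_i df i).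
Proof.
move=> H; apply/is_derive_lineP.
have : \sum_i (h^-1 * (f i (h *: v + x) - f i x)) @[h --> 0^'] --> \sum_i df i.
  by apply: cvg_sum_real => i; apply/is_derive_lineP.
by under eq_cvg do rewrite -mulr_sumr sumrB.
Qed.

Lemma mxder_cst m n (A : 'M[R]_(m, n)) x v : mxder (fun=> A) x v 0.
Proof. by move=> i j; rewrite mxE; exact: is_derive_cst. Qed.

Lemma mxder_add m n (f g : V -> 'M[R]_(m, n)) x v df dg :
  mxder f x v df -> mxder g x v dg ->
  mxder (fun y => f y + g y) x v (df + dg).
Proof.
move=> Hf Hg i j; under eq_fun do rewrite mxE; rewrite mxE.
exact: (@is_deriveD _ _ _ (fun y => f y i j) (fun y => g y i j)).
Qed.

Lemma mxder_scale m n (k : V -> R) (f : V -> 'M[R]_(m, n)) x v dk df :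
  is_derive x v k dk -> mxder f x v df ->
  mxder (fun y => k y *: f y) x v (dk *: f x + k x *: df).
Proof.
move=> Hk Hf i j; under eq_fun do rewrite mxE; rewrite !mxE.
have := @is_deriveM _ _ k (fun y => f y i j) x v dk (df i j) Hk (Hf i j).
by move=> H; apply: is_derive_eq H _; rewrite addrC /GRing.scale/= [_ * dk]mulrC.
Qed.

Lemma mxder_mul m n p (f : V -> 'M[R]_(m, n)) (g : V -> 'M[R]_(n, p)) x v df dg :
  mxder f x v df -> mxder g x v dg ->
  mxder (fun y => f y *m g y) x v (df *m g x + f x *m dg).
Proof.
move=> Hf Hg i j; under eq_fun do rewrite mxE.
rewrite !mxE -big_split/=; apply: is_derive_sum_real => k.
have := @is_deriveM _ _ (fun y => f y i k) (fun y => g y k j) x v _ _ (Hf i k) (Hg k j).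
by move=> H; apply: is_derive_eq H _; rewrite addrC /GRing.scale/= [_ * df _ _]mulrC.
Qed.

Lemma mxder_tr m n (f : V -> 'M[R]_(m, n)) x v df :
  mxder f x v df -> mxder (fun y => (f y)^T) x v df^T.
Proof. by move=> Hf i j; under eq_fun do rewrite mxE; rewrite mxE; exact: Hf. Qed.

Lemma is_derive_trace n (f : V -> 'M[R]_n) x v df :
  mxder f x v df -> is_derive x v (fun y => \tr (f y)) (\tr df).
Proof. by move=> Hf; apply: is_derive_sum_real => i; exact: Hf. Qed.

Lemma mxder_eq m n (f : V -> 'M[R]_(m, n)) x v df df' :
  mxder f x v df -> df = df' -> mxder f x v df'.
Proof. by move=> H <-. Qed.

Lemma mxder_cvg m n (f : V -> 'M[R]_(m, n)) x v df :
  mxder f x v df -> mxcvg 0^' (fun h : R => f (h *: v + x)) (f x).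
Proof.
move=> /mxderP H.
have H1 : mxcvg (0 : R)^' (fun h : R => h *: (h^-1 *: (f (h *: v + x) - f x)) + f x)
    (0 *: df + f x).
  apply: mxcvg_add; last exact: mxcvg_cst.
  by apply: mxcvg_scale => //; apply: nbhs_dnbhs.
rewrite scale0r add0r in H1; apply: mxcvg_near_eq H1.
near=> h; rewrite scalerA mulfV ?scale1r ?subrK//.
by near: h; exact: nbhs_dnbhs_neq.
Unshelve. all: end_near. Qed.

(** From A_h^-1 - A^-1 = - A_h^-1 (A_h - A) A^-1, valid for small h since invertibility is an open
    condition, and from the continuity of inversion. *)
Lemma mxder_invmx n (f : V -> 'M[R]_n) x v df : mxder f x v df ->
  f x \in unitmx ->
  mxder (fun y => invmx (f y)) x v (- (invmx (f x) *m df *m invmx (f x))).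
Proof.
move=> H ux; have fc := mxder_cvg H; move/mxderP : H => H; apply/mxderP.
have H1 : mxcvg (0 : R)^' (fun h : R => - (invmx (f (h *: v + x)) *m
     (h^-1 *: (f (h *: v + x) - f x)) *m invmx (f x)))
    (- (invmx (f x) *m df *m invmx (f x))).
  apply: mxcvg_opp; apply: mxcvg_mul; last exact: mxcvg_cst.
  by apply: mxcvg_mul => //; exact: mxcvg_invmx.
apply: mxcvg_near_eq H1; apply: filterS (mxcvg_near_unitmx fc ux) => h uh.
rewrite -scalemxAr -scalemxAl -scalerN; congr (_ *: _).
by rewrite mulmxBr mulVmx// mulmxBl mul1mx mulmxK// opprB.
Qed.

End directional_calculus.

Section matrix_variable.
Context {R : realType} (m n : nat).

Lemma mxder_id (M D : 'M[R]_(m, n)) : mxder id M D D.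
Proof.
apply/mxderP; apply: (@mxcvg_near_eq _ _ _ _ _ _ (fun=> D)); last exact: mxcvg_cst.
near=> h; rewrite addrK scalerA mulVf ?scale1r//.
by near: h; exact: nbhs_dnbhs_neq.
Unshelve. all: end_near. Qed.

Lemma mxder_gram (M D : 'M[R]_(m, n)) :
  mxder (fun N : 'M[R]_(m, n) => gram N) M D (D^T *m M + M^T *m D).
Proof. by apply: mxder_mul; [apply: mxder_tr|]; exact: mxder_id. Qed.

End matrix_variable.

Section bounded_matrices.
Context {R : realType} {T : Type}.

Definition mxbnd m n (f : T -> 'M[R]_(m, n)) :=
  exists K, forall t i j, `|f t i j| <= K.

Lemma mxbnd_cst m n (A : 'M[R]_(m, n)) : mxbnd (fun=> A).
Proof.
exists (\sum_i \sum_j `|A i j|) => _ i j.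
rewrite (bigD1 i)//= (bigD1 j)//= -addrA lerDl addr_ge0//; apply: sumr_ge0 => // k _.
exact: sumr_ge0.
Qed.

Lemma mxbnd_add m n (f g : T -> 'M[R]_(m, n)) :
  mxbnd f -> mxbnd g -> mxbnd (fun t => f t + g t).
Proof.
move=> [K fK] [L gL]; exists (K + L) => t i j; rewrite mxE.
by rewrite (le_trans (ler_normD _ _))// lerD.
Qed.

Lemma mxbnd_opp m n (f : T -> 'M[R]_(m, n)) : mxbnd f -> mxbnd (fun t => - f t).
Proof. by move=> [K fK]; exists K => t i j; rewrite mxE normrN. Qed.

Lemma mxbnd_scale m n (k : T -> R) (f : T -> 'M[R]_(m, n)) :
  (exists K, forall t, `|k t| <= K) -> mxbnd f -> mxbnd (fun t => k t *: f t).
Proof.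
move=> [K kK] [L fL]; exists (K * L) => t i j; rewrite mxE normrM.
by rewrite ler_pM.
Qed.

Lemma mxbnd_mul m n p (f : T -> 'M[R]_(m, n)) (g : T -> 'M[R]_(n, p)) :
  mxbnd f -> mxbnd g -> mxbnd (fun t => f t *m g t).
Proof.
move=> [K fK] [L gL]; exists (\sum_(k < n) (K * L)) => t i j; rewrite mxE.
apply: (le_trans (ler_norm_sum _ _ _)); apply: ler_sum => k _.
by rewrite normrM ler_pM.
Qed.

Lemma mxbnd_tr m n (f : T -> 'M[R]_(m, n)) : mxbnd f -> mxbnd (fun t => (f t)^T).
Proof. by move=> [K fK]; exists K => t i j; rewrite mxE. Qed.

Lemma bnd_trace n (f : T -> 'M[R]_n) : mxbnd f -> exists K, forall t, `|\tr (f t)| <= K.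
Proof.
move=> [K fK]; exists (\sum_(i < n) K) => t.
by apply: (le_trans (ler_norm_sum _ _ _)); apply: ler_sum.
Qed.

End bounded_matrices.

(** * The regularised field *)

Section matrix_linear.
Context {R : realType} (m n : nat).

Definition mxlin a b (g : 'M[R]_(m, n) -> 'M[R]_(a, b)) :=
  (forall D1 D2, g (D1 + D2) = g D1 + g D2) /\
  (forall c D, g (c *: D) = c *: g D).


Lemma mxlin_tr a b (g : 'M[R]_(m, n) -> 'M[R]_(a, b)) :
  mxlin g -> mxlin (fun D => (g D)^T).
Proof. by move=> [gD gZ]; split=> [D1 D2|c D]; rewrite ?gD ?gZ ?linearD ?linearZ. Qed.

Lemma mxlin_add a b (g h : 'M[R]_(m, n) -> 'M[R]_(a, b)) :
  mxlin g -> mxlin h -> mxlin (fun D => g D + h D).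
Proof.
move=> [gD gZ] [hD hZ]; split=> [D1 D2|c D]; rewrite ?gD ?gZ ?hD ?hZ.
  by rewrite addrACA.
by rewrite scalerDr.
Qed.

Lemma mxlin_opp a b (g : 'M[R]_(m, n) -> 'M[R]_(a, b)) :
  mxlin g -> mxlin (fun D => - g D).
Proof. by move=> [gD gZ]; split=> [D1 D2|c D]; rewrite ?gD ?gZ ?opprD ?scalerN. Qed.

Lemma mxlin_scale a b k (g : 'M[R]_(m, n) -> 'M[R]_(a, b)) :
  mxlin g -> mxlin (fun D => k *: g D).
Proof.
move=> [gD gZ]; split=> [D1 D2|c D]; rewrite ?gD ?gZ ?scalerDr//.
by rewrite !scalerA mulrC.
Qed.

Lemma mxlin_mull a b c (A : 'M[R]_(c, a)) (g : 'M[R]_(m, n) -> 'M[R]_(a, b)) :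
  mxlin g -> mxlin (fun D => A *m g D).
Proof. by move=> [gD gZ]; split=> [D1 D2|k D]; rewrite ?gD ?gZ ?mulmxDr ?scalemxAr. Qed.

Lemma mxlin_mulr a b c (A : 'M[R]_(b, c)) (g : 'M[R]_(m, n) -> 'M[R]_(a, b)) :
  mxlin g -> mxlin (fun D => g D *m A).
Proof. by move=> [gD gZ]; split=> [D1 D2|k D]; rewrite ?gD ?gZ ?mulmxDl ?scalemxAl. Qed.

Lemma mxlin_trace_scale a b c (g : 'M[R]_(m, n) -> 'M[R]_a) (B : 'M[R]_(b, c)) :
  mxlin g -> mxlin (fun D => \tr (g D) *: B).
Proof.
move=> [gD gZ]; split=> [D1 D2|k D]; rewrite ?gD ?gZ ?linearD ?linearZ/=.
  by rewrite scalerDl.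
by rewrite scalerA mulrC.
Qed.

End matrix_linear.

(** * Divergences as traces *)

Section elementary_sums.
Context {R : realType} (m p : nat).

Lemma mul_delta_mul a b (A : 'M[R]_(a, m)) (B : 'M[R]_(p, b)) i j k l :
  (A *m delta_mx i j *m B) k l = A k i * B j l.
Proof.
rewrite mxE (bigD1 j)//= big1 ?addr0; last first.
  move=> c cj; rewrite mxE big1 ?mul0r// => e _.
  by rewrite mxE (negbTE cj) andbF mulr0.
rewrite mxE (bigD1 i)//= big1 ?addr0.
  by rewrite mxE !eqxx mulr1.
by move=> e /negbTE ei; rewrite mxE ei mulr0.
Qed.

(** The left side is the divergence of the linear map D |-> A D B. The dimensions m and p of the
    final constant enter through this product of traces, with A or B an identity or a projection. *)
Lemma sum_mul_delta_mul (A : 'M[R]_m) (B : 'M[R]_p) :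
  \sum_i \sum_j (A *m delta_mx i j *m B) i j = \tr A * \tr B.
Proof.
rewrite /mxtrace mulr_suml; apply: eq_bigr => i _; rewrite mulr_sumr.
by apply: eq_bigr => j _; rewrite mul_delta_mul.
Qed.

Lemma sum_mul_trdelta_mul (A B : 'M[R]_(m, p)) :
  \sum_i \sum_j (A *m (delta_mx i j)^T *m B) i j = \tr (A^T *m B).
Proof.
rewrite mxtrace_mul_tr; apply: eq_bigr => i _; apply: eq_bigr => j _.
rewrite trmx_delta mxE (bigD1 i)//= big1 ?addr0; last first.
  move=> c ci; rewrite mxE big1 ?mul0r// => e _.
  by rewrite mxE (negbTE ci) andbF mulr0.
rewrite mxE (bigD1 j)//= big1 ?addr0.
  by rewrite mxE !eqxx mulr1.
by move=> e /negbTE ei; rewrite mxE ei mulr0.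
Qed.

Lemma sum_trace_delta (L : 'M[R]_(p, m)) (G : 'M[R]_(m, p)) :
  \sum_i \sum_j \tr (L *m delta_mx i j) * G i j = \tr (L *m G).
Proof.
rewrite -[L in RHS]trmxK mxtrace_mul_tr; apply: eq_bigr => i _; apply: eq_bigr => j _.
congr (_ * _); rewrite -[L *m _]mulmx1 -mulmxA; rewrite /mxtrace (bigD1 j)//= big1 ?addr0.
  by rewrite mulmxA mul_delta_mul !mxE eqxx mulr1.
by move=> k kj; rewrite mulmxA mul_delta_mul !mxE eq_sym (negbTE kj) mulr0.
Qed.

End elementary_sums.

Ltac trace_cycle A B :=
  transitivity (\tr (A *m B));
    [by rewrite !mulmxA|rewrite [LHS]mxtrace_mulC !mulmxA].

Lemma mxtraceB (V : zmodType) n (A B : 'M[V]_n) : \tr (A - B) = \tr A - \tr B.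
Proof. exact: raddfB. Qed.

Lemma mxtraceN (V : zmodType) n (A : 'M[V]_n) : \tr (- A) = - \tr A.
Proof. exact: raddfN. Qed.

Section divergence_algebra.
Context {R : realType} (m p q : nat) (x : 'M[R]_(p, q)).
Variables (u : 'M[R]_(m, p)) (v : 'M[R]_(m, q)) (w : 'M[R]_m).
Variables (c P : 'M[R]_p) (de : R).
Hypotheses (Pc : P *m c = u^T *m u) (uP : u *m P = w *m u) (ux : u *m x = v).
Hypotheses (trw : \tr w = \tr P) (c_P : de *: c = 1%:M - P).
Hypotheses (P_tr : P^T = P) (w_tr : w^T = w).

Let xPc : x^T *m P *m c *m x = v^T *m v.
Proof. by rewrite -[x^T *m P *m c]mulmxA Pc -ux trmx_mul !mulmxA. Qed.

Let xPu : x^T *m P *m u^T = v^T *m w.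
Proof. by rewrite -ux -mulmxA -{1}P_tr -trmx_mul uP !trmx_mul w_tr mulmxA. Qed.

(** The letters [u], [v], [w], [c], [P] stand for [reg_root], its product with [x], [reg_hat],
    [resolv] and [reg_proj] at one matrix; [du] and [dc] are then the derivatives of [reg_root] and
    [resolv]. *)
Let du (D : 'M[R]_(m, p)) := D *m c - u *m D^T *m u - w *m D *m c.
Let dc (D : 'M[R]_(m, p)) := - (c *m D^T *m u + u^T *m D *m c).

Lemma sum_dstat :
  \sum_i \sum_j
    (\tr (v^T *m du (delta_mx i j) *m x) *+ 2) * (v *m x^T *m P) i j =
  2 * (\tr (v^T *m v *m (v^T *m v)) - 2 * \tr (v^T *m v *m (v^T *m w *m v))).
Proof.
(* [L] represents the linear form D |-> tr (v^T (du D) x) as D |-> tr (L D), so that the sum over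
   elementary matrices becomes one trace. *)
pose L := c *m x *m v^T - (v *m v^T *m u)^T - c *m x *m v^T *m w.
have EdF D : \tr (v^T *m du D *m x) = \tr (L *m D).
  rewrite /L /du !mulmxBr !mulmxBl !mxtraceB; congr (_ - _ - _).
  - by trace_cycle (v^T *m D) (c *m x).
  - rewrite -[RHS]mxtrace_tr trmx_mul trmxK.
    transitivity (\tr ((v^T *m u) *m (D^T *m v))); first by rewrite -ux !mulmxA.
    by rewrite [LHS]mxtrace_mulC !mulmxA.
  - by trace_cycle (v^T *m w *m D) (c *m x).
transitivity (2 * \sum_i \sum_j \tr (L *m delta_mx i j) * (v *m x^T *m P) i j).
  rewrite mulr_sumr; apply: eq_bigr => i _; rewrite mulr_sumr.
  by apply: eq_bigr => j _; rewrite EdF; ring.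
rewrite sum_trace_delta; congr (_ * _); rewrite !mulmxBl !mxtraceB.
have -> : \tr (c *m x *m v^T *m (v *m x^T *m P)) = \tr (v^T *m v *m (v^T *m v)).
  trace_cycle (c *m x *m (v^T *m v)) (x^T *m P).
  by rewrite xPc ?mulmxA.
have -> : \tr ((v *m v^T *m u)^T *m (v *m x^T *m P)) =
    \tr (v^T *m v *m (v^T *m w *m v)).
  rewrite !trmx_mul trmxK.
  trace_cycle (u^T *m (v *m v^T) *m v) (x^T *m P).
  by rewrite xPu; trace_cycle (v^T *m w *m v) (v^T *m v).
have -> : \tr (c *m x *m v^T *m w *m (v *m x^T *m P)) =
    \tr (v^T *m v *m (v^T *m w *m v)).
  trace_cycle (c *m x *m (v^T *m w *m v)) (x^T *m P).
  by rewrite xPc.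
ring.
Qed.

Lemma sum_dfield :
  \sum_i \sum_j
    (du (delta_mx i j) *m x *m x^T *m P - de *: (v *m x^T *m dc (delta_mx i j))) i j =
  (m%:R + p%:R + 1 - 2 * \tr P) * \tr (v^T *m v) - 2 * \tr (v^T *m w *m v).
Proof.
(* Five terms of the form A D B or A D^T B. With F = tr (v^T v) and t = tr (v^T w v), their
   divergences are, in order, m F, - t, - (tr P) F, F - t and (p - tr P) F. *)
have EdV D : du D *m x *m x^T *m P - de *: (v *m x^T *m dc D) =
    1%:M *m D *m (c *m x *m x^T *m P) + (- u) *m D^T *m (v *m x^T *m P)
    + (- w) *m D *m (c *m x *m x^T *m P)
    + (v *m x^T *m (de *: c)) *m D^T *m u + (v *m x^T *m u^T) *m D *m (de *: c).
  rewrite /dc mulmxN scalerN opprK mulmxDr scalerDr -addrA; congr (_ + _).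
    by rewrite /du !mulmxBl mul1mx !mulNmx -ux !mulmxA.
  by rewrite -!scalemxAr -!scalemxAl !mulmxA.
under eq_bigr => i _ do (under eq_bigr => j _ do rewrite EdV 4!mxE;
  rewrite !big_split/=).
rewrite !big_split/= !sum_mul_delta_mul !sum_mul_trdelta_mul.
have -> : \tr (- w) = - \tr P by rewrite linearN/= trw.
have -> : \tr (de *: c) = p%:R - \tr P by rewrite c_P linearB/= mxtrace1.
rewrite c_P mxtrace1.
have -> : \tr (c *m x *m x^T *m P) = \tr (v^T *m v).
  by trace_cycle (c *m x) (x^T *m P); rewrite xPc.
have -> : \tr ((- u)^T *m (v *m x^T *m P)) = - \tr (v^T *m w *m v).
  rewrite linearN/= mulNmx linearN/=; congr (- _).
  by trace_cycle (u^T *m v) (x^T *m P); rewrite xPu.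
have -> : \tr ((v *m x^T *m (1%:M - P))^T *m u) =
    \tr (v^T *m v) - \tr (v^T *m w *m v).
  rewrite -[LHS]mxtrace_tr trmx_mul trmxK.
  trace_cycle (u^T *m v) (x^T *m (1%:M - P)).
  rewrite mulmxBr mulmx1 !mulmxBl linearB/= xPu; congr (_ - _).
  by rewrite -trmx_mul ux.
have -> : \tr (v *m x^T *m u^T) = \tr (v^T *m v).
  by rewrite -mulmxA -trmx_mul ux mxtrace_mulC.
ring.
Qed.

End divergence_algebra.

Section regularised_field.
Context {R : realType} (m p q : nat) (x : 'M[R]_(p, q)).
Variables (de : R) (de_gt0 : 0 < de).
Variables (phi phi' : R -> R) (K : R).
Hypothesis dphi : forall t : R, 0 <= t -> is_derive t 1 phi (phi' t).
Hypothesis phi_bound : forall t, 0 <= t -> `|phi t| <= K.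
Hypothesis phi'_bound : forall t, 0 <= t -> `|phi' t| <= K.
Implicit Types Y D : 'M[R]_(m, p).

Local Notation C := (resolv de).
(* As [de] tends to 0, [C] tends to [mpinv (gram Y)] only up to a divergent term
   on the kernel; [reg_root] and [reg_proj] converge to [Y *m mpinv (gram Y)] and
   to the projection [gram Y *m mpinv (gram Y)]. *)
Definition reg_root Y : 'M[R]_(m, p) := Y *m C Y.
Local Notation U := reg_root.
Definition reg_hat Y : 'M[R]_m := U Y *m Y^T.
Local Notation W := reg_hat.
Definition reg_proj Y : 'M[R]_p := 1%:M - de *: C Y.
Local Notation P := reg_proj.
Definition reg_stat Y : R := fro2 (U Y *m x).
Local Notation F := reg_stat.
Definition reg_dir Y : 'M[R]_(m, p) := U Y *m x *m x^T *m P Y.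
Local Notation V := reg_dir.
Definition reg_field Y : 'M[R]_(m, p) := phi (F Y) *: V Y.

Let dC Y D : 'M[R]_p := - (C Y *m D^T *m U Y + (U Y)^T *m D *m C Y).
Let dU Y D : 'M[R]_(m, p) :=
  D *m C Y - U Y *m D^T *m U Y - W Y *m D *m C Y.
Let dF Y D : R := \tr ((U Y *m x)^T *m dU Y D *m x) *+ 2.
Let dV Y D : 'M[R]_(m, p) :=
  dU Y D *m x *m x^T *m P Y - de *: (U Y *m x *m x^T *m dC Y D).

Definition reg_field' Y D : 'M[R]_(m, p) :=
  (phi' (F Y) * dF Y D) *: V Y + phi (F Y) *: dV Y D.

Lemma reg_stat_ge0 Y : 0 <= F Y. Proof. exact: fro2_ge0. Qed.

Lemma mxder_resolv Y D : mxder C Y D (dC Y D).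
Proof.
have H : mxder (fun N => gram N + de%:M) Y D (D^T *m Y + Y^T *m D).
  have := mxder_add (mxder_gram Y D) (mxder_cst (de%:M : 'M[R]_p) Y D).
  by rewrite addr0.
apply: mxder_eq (mxder_invmx H (gram_shift_unitmx de_gt0 Y)) _.
rewrite -/(C Y) /dC; congr (- _); rewrite mulmxDr mulmxDl; congr (_ + _).
  by rewrite /U !mulmxA.
by rewrite /U trmx_mul resolv_tr !mulmxA.
Qed.

Lemma mxder_reg_root Y D : mxder U Y D (dU Y D).
Proof.
apply: mxder_eq (mxder_mul (mxder_id Y D) (mxder_resolv Y D)) _.
rewrite /dC /dU mulmxN mulmxDr opprD addrA; congr (_ - _ - _).
  by rewrite /U !mulmxA.
by rewrite /W /U trmx_mul resolv_tr !mulmxA.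
Qed.

Lemma is_derive_reg_stat Y D : is_derive Y D F (dF Y D).
Proof.
have -> : F = (fun N => \tr ((U N *m x)^T *m (U N *m x))).
  by apply/funext => N; rewrite /F fro2E.
have HU : mxder (fun N => U N *m x) Y D (dU Y D *m x).
  have := mxder_mul (mxder_reg_root Y D) (mxder_cst x Y D).
  by rewrite mulmx0 addr0.
apply: is_derive_eq (is_derive_trace (mxder_mul (mxder_tr HU) HU)) _.
rewrite linearD/= -mxtrace_tr trmx_mul trmxK /dF mulr2n.
by rewrite mulmxA.
Qed.

Lemma mxder_reg_dir Y D : mxder V Y D (dV Y D).
Proof.
have HU : mxder (fun N => U N *m x *m x^T) Y D (dU Y D *m x *m x^T).
  have := mxder_mul (mxder_mul (mxder_reg_root Y D) (mxder_cst x Y D))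
    (mxder_cst x^T Y D).
  by rewrite !mulmx0 !addr0.
have HP : mxder P Y D (- (de *: dC Y D)).
  have := mxder_add (mxder_cst (1%:M : 'M[R]_p) Y D)
    (mxder_scale (is_derive_cst (- de) Y D) (mxder_resolv Y D)).
  rewrite scale0r !add0r scaleNr; congr mxder.
  by apply/funext => N; rewrite /P scaleNr.
apply: mxder_eq (mxder_mul HU HP) _.
by rewrite /dV mulmxN -scalemxAr.
Qed.

Lemma mxder_reg_field Y D : mxder reg_field Y D (reg_field' Y D).
Proof.
have H := is_derive_comp_real (dphi (reg_stat_ge0 Y)) (is_derive_reg_stat Y D).
exact: mxder_scale H (mxder_reg_dir Y D).
Qed.

Let bC : mxbnd (fun Y : 'M[R]_(m, p) => C Y). Proof. by exists de^-1; apply: resolv_bound. Qed.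

Let bU : mxbnd (fun Y : 'M[R]_(m, p) => U Y).
Proof.
exists (1 + de^-1) => Y i j.
have := sqr_mul_resolv_bound de_gt0 Y i j; rewrite -/(U Y).
have := sqr_ge0 (`|U Y i j| - 1); rewrite sqrrB1 real_normK ?num_real//.
have := normr_ge0 (U Y i j); have : 0 < de^-1 by rewrite invr_gt0.
nra.
Qed.

Let bW : mxbnd (fun Y : 'M[R]_(m, p) => W Y). Proof. by exists 1; apply: mul_resolv_tr_bound. Qed.

Let bP : mxbnd (fun Y : 'M[R]_(m, p) => P Y).
Proof.
apply: mxbnd_add; first exact: mxbnd_cst.
apply: mxbnd_opp; apply: mxbnd_scale bC.
by exists `|de|.
Qed.

Let bV : mxbnd (fun Y : 'M[R]_(m, p) => V Y).
Proof. by do ![apply: mxbnd_mul => //; try exact: mxbnd_cst]. Qed.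

Let bdC D : mxbnd (fun Y => dC Y D).
Proof.
apply: mxbnd_opp; apply: mxbnd_add; apply: mxbnd_mul => //; apply: mxbnd_mul => //.
- exact: mxbnd_cst.
- exact: mxbnd_tr.
- exact: mxbnd_cst.
Qed.

Let bdU D : mxbnd (fun Y => dU Y D).
Proof.
apply: mxbnd_add; last first.
  apply: mxbnd_opp; apply: mxbnd_mul => //; apply: mxbnd_mul => //.
  exact: mxbnd_cst.
apply: mxbnd_add; first by apply: mxbnd_mul => //; exact: mxbnd_cst.
apply: mxbnd_opp; apply: mxbnd_mul => //; apply: mxbnd_mul => //.
exact: mxbnd_cst.
Qed.

Let bdV D : mxbnd (fun Y => dV Y D).
Proof.
apply: mxbnd_add.
  by do ![apply: mxbnd_mul => //; try exact: mxbnd_cst].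
apply: mxbnd_opp; apply: mxbnd_scale; first by exists `|de|.
by do ![apply: mxbnd_mul => //; try exact: mxbnd_cst].
Qed.

Let bdF D : exists c, forall Y, `|dF Y D| <= c.
Proof.
have : mxbnd (fun Y => (U Y *m x)^T *m dU Y D *m x).
  apply: mxbnd_mul; last exact: mxbnd_cst.
  apply: mxbnd_mul => //; apply: mxbnd_tr; apply: mxbnd_mul => //.
  exact: mxbnd_cst.
move=> /bnd_trace[c bc]; exists (c *+ 2) => Y.
by rewrite /dF normrMn lerMn2r/=.
Qed.

Lemma mxbnd_reg_field : mxbnd reg_field.
Proof.
apply: mxbnd_scale bV; exists K => Y; apply: phi_bound; exact: reg_stat_ge0.
Qed.

Lemma mxbnd_reg_field' D : mxbnd (fun Y => reg_field' Y D).
Proof.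
apply: mxbnd_add; apply: mxbnd_scale => //.
  have [c bc] := bdF D; exists (K * c) => Y; rewrite normrM ler_pM//.
  by apply: phi'_bound; exact: reg_stat_ge0.
by exists K => Y; apply: phi_bound; exact: reg_stat_ge0.
Qed.

Lemma mxlin_reg_field' Y : mxlin (reg_field' Y).
Proof.
have ldC : mxlin (dC Y).
  apply: mxlin_opp; apply: mxlin_add; apply: mxlin_mulr; apply: mxlin_mull => //.
  exact: mxlin_tr.
have ldU : mxlin (dU Y).
  apply: mxlin_add; last first.
    by apply: mxlin_opp; apply: mxlin_mulr; exact: mxlin_mull.
  apply: mxlin_add; first exact: mxlin_mulr.
  by apply: mxlin_opp; apply: mxlin_mulr; apply: mxlin_mull; exact: mxlin_tr.
have ldV : mxlin (dV Y).
  apply: mxlin_add; first by do !apply: mxlin_mulr.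
  by apply: mxlin_opp; apply: mxlin_scale; exact: mxlin_mull.
apply: mxlin_add; last exact: mxlin_scale.
have : mxlin (fun D => \tr ((phi' (F Y) * 2) *: ((U Y *m x)^T *m dU Y D *m x)) *: V Y).
  apply: mxlin_trace_scale; apply: mxlin_scale; apply: mxlin_mulr.
  exact: mxlin_mull.
congr mxlin; apply/funext => D.
by rewrite linearZ/= -mulrA mulr_natl.
Qed.

Lemma measurable_resolv d (T : measurableType d) (f : T -> 'M[R]_(m, p)) :
  measurable_fun [set: T] f -> measurable_fun [set: T] (fun t => C (f t)).
Proof.
move=> mf; apply: measurable_invmx => [|u]; last exact: gram_shift_unitmx.
by apply: measurable_addmx => //; exact: measurable_gram.
Qed.

Definition reg_div Y : R :=
  let v := U Y *m x in
  phi (F Y) * ((m%:R + p%:R + 1 - 2 * \tr (P Y)) * F Y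
               - 2 * \tr (v^T *m W Y *m v))
  + 2 * phi' (F Y) * (\tr (v^T *m v *m (v^T *m v))
                      - 2 * \tr (v^T *m v *m (v^T *m W Y *m v))).

Let P_gram Y : P Y = gram Y *m C Y. Proof. by rewrite gram_resolv. Qed.

Let P_tr Y : (P Y)^T = P Y.
Proof. by rewrite linearB/= linearZ/= tr_scalar_mx resolv_tr. Qed.

Let W_tr Y : (W Y)^T = W Y.
Proof. by rewrite !trmx_mul trmxK resolv_tr mulmxA. Qed.

Let PC Y : P Y *m C Y = (U Y)^T *m U Y.
Proof. by rewrite trU_U P_gram resolv_comm. Qed.

Let UP Y : U Y *m P Y = W Y *m U Y.
Proof. by rewrite P_gram /W /U /gram !mulmxA. Qed.

Let trW Y : \tr (W Y) = \tr (P Y).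
Proof. by rewrite mxtrace_mulC P_gram /U mulmxA. Qed.

Lemma mul_tr_reg_root Y : Y^T *m U Y = P Y.
Proof. by rewrite P_gram /U mulmxA. Qed.

Lemma sum_reg_field' Y :
  \sum_i \sum_j reg_field' Y (delta_mx i j) i j = reg_div Y.
Proof.
have C_P : de *: C Y = 1%:M - P Y by rewrite opprB addrC subrK.
rewrite /reg_field'.
under eq_bigr => i _ do
  (under eq_bigr => j _ do rewrite mxE mxE [X in _ + X]mxE -mulrA;
   rewrite big_split/= -!mulr_sumr).
rewrite big_split/= -!mulr_sumr /reg_div /=.
rewrite (sum_dstat (PC Y) (UP Y) (erefl _) (P_tr Y) (W_tr Y)).
rewrite (sum_dfield (PC Y) (UP Y) (erefl _) (trW Y) C_P (P_tr Y) (W_tr Y)).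
by rewrite /F fro2E; ring.
Qed.

End regularised_field.

(** * Vanishing regularisation *)

Section vanishing_resolvent.
Context {R : realType}.

Lemma mxcvg_bounded_scale m n (k : nat -> R) (f : nat -> 'M[R]_(m, n)) :
  k l @[l --> \oo] --> 0 -> mxbnd f -> mxcvg \oo (fun l => k l *: f l) 0.
Proof.
move=> k0 [K fK] i j; under eq_cvg do rewrite mxE; rewrite mxE.
have K0 : 0 <= K by exact: le_trans (fK 0%N i j).
have H : `|k l| * K @[l --> \oo] --> 0.
  by rewrite -(mul0r K) -(normr0 R); apply: cvgM; [exact: cvg_norm|exact: cvg_cst].
apply/norm_cvg0P; apply: (squeeze_cvgr _ (cvg_cst 0) H).
by apply: nearW => l; rewrite normr_ge0 normrM ler_wpM2l.
Qed.

Variables (m p : nat) (Y : 'M[R]_(m, p)).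
Let S := gram Y.
Let B := mpinv S.
Let de (n : nat) : R := n.+1%:R^-1.
Let de_gt0 n : 0 < de n. Proof. by rewrite invr_gt0. Qed.

Lemma resolv_proj_bound n i j : `|reg_proj (de n) Y i j| <= 2.
Proof.
have H := resolv_bound (de_gt0 n) Y i j.
have -> : reg_proj (de n) Y i j = (i == j)%:R - de n * resolv (de n) Y i j.
  by rewrite /reg_proj; do 3 rewrite mxE; rewrite mxE.
apply: (le_trans (ler_normB _ _)); rewrite normrM (gtr0_norm (de_gt0 n)).
have : de n * `|resolv (de n) Y i j| <= 1.
  by rewrite -ler_pdivlMl ?mulr1.
have : `|(i == j)%:R : R| <= 1 by case: (i == j); rewrite ?normr1 ?normr0.
lra.
Qed.

Lemma cvg_reg_proj : mxcvg \oo (fun n => reg_proj (de n) Y) (S *m B).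
Proof.
have E n : reg_proj (de n) Y = S *m B + - (de n *: (reg_proj (de n) Y *m B)).
  rewrite /reg_proj -(resolv_gram (de_gt0 n)).
  by rewrite -(resolv_gram_proj Y (de_gt0 n)) addrC subrK.
have H : mxcvg \oo (fun n => S *m B + - (de n *: (reg_proj (de n) Y *m B)))
    (S *m B + - 0).
  apply: mxcvg_add; first exact: mxcvg_cst.
  apply: mxcvg_opp; apply: mxcvg_bounded_scale; first exact: cvg_harmonic.
  by apply: mxbnd_mul; [exists 2 => n; exact: resolv_proj_bound|exact: mxbnd_cst].
rewrite subr0 in H; apply: mxcvg_near_eq H.
by apply: nearW => n; rewrite -E.
Qed.

Lemma cvg_trU_U :
  mxcvg \oo (fun n => (reg_root (de n) Y)^T *m reg_root (de n) Y) B.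
Proof.
have H : mxcvg \oo (fun n => reg_proj (de n) Y *m reg_proj (de n) Y *m B)
    (S *m B *m (S *m B) *m B).
  apply: mxcvg_mul; last exact: mxcvg_cst.
  by apply: mxcvg_mul; exact: cvg_reg_proj.
have EB : S *m B *m (S *m B) *m B = B.
  rewrite mulmxA [X in X *m B](_ : _ = S *m B); last by rewrite gram_mpinv_gram.
  by rewrite mpinv_gram_comm mpinv_gram_mpinv.
rewrite EB in H; apply: mxcvg_near_eq H; apply: nearW => n.
rewrite /reg_root trU_U resolv_gram_resolv//.
by rewrite /reg_proj -(resolv_gram (de_gt0 n)).
Qed.

End vanishing_resolvent.

Section measurable_moore_penrose.
Context {R : realType} (m p : nat).
Let de (n : nat) : R := n.+1%:R^-1.

(** Tikhonov's formula. As S^T = (gram S) S^+, the left side is [reg_proj] times S^+, and the limit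
    of [reg_proj] fixes S^+. Since [mpinv] is defined by choice, its measurability is drawn from
    this limit. *)
Lemma cvg_mpinv (S : 'M[R]_(m, p)) :
  mxcvg \oo (fun n => resolv (de n) S *m S^T) (mpinv S).
Proof.
have de_gt0 n : 0 < de n by rewrite invr_gt0.
have [a b c e] := mpinvP S.
have E1 : S^T = gram S *m mpinv S by rewrite -{1}a trmx_mul c /gram mulmxA.
have E2 : gram S *m mpinv (gram S) *m mpinv S = mpinv S.
  rewrite -{1}b -{1}e trmx_mul !mulmxA.
  have -> : gram S *m mpinv (gram S) *m S^T = S^T.
    by rewrite -mpinv_gram_proj_tr -trmx_mul mul_gram_proj.
  by rewrite -trmx_mul e b.
have H : mxcvg \oo (fun n => reg_proj (de n) S *m mpinv S)
    (gram S *m mpinv (gram S) *m mpinv S).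
  by apply: mxcvg_mul; [exact: cvg_reg_proj|exact: mxcvg_cst].
rewrite E2 in H; apply: mxcvg_near_eq H; apply: nearW => n.
by rewrite {1}E1 mulmxA resolv_gram.
Qed.

Lemma measurable_mpinv d (T : measurableType d) (f : T -> 'M[R]_(m, p)) :
  measurable_fun [set: T] f -> measurable_fun [set: T] (fun t => mpinv (f t)).
Proof.
move=> mf; apply/measurable_fun_mxP => i j.
apply: (@measurable_fun_cvg _ T R _ (fun n t => (resolv (de n) (f t) *m (f t)^T) i j)).
  move=> n; apply: (measurableT_comp (measurable_mx_coord i j)).
  apply: measurable_mulmx; last exact: measurable_trmx.
  by apply: measurable_resolv => //; rewrite invr_gt0.
by move=> t _; exact: cvg_mpinv.
Qed.

End measurable_moore_penrose.

Section sum_integrals.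
Context d (T : measurableType d) (R : realType) (P : {measure set T -> \bar R}).

Lemma integrable_sum_real (I : Type) (s : seq I) (f : I -> T -> R) :
  (forall i, P.-integrable [set: T] (fun x => (f i x)%:E)) ->
  P.-integrable [set: T] (fun x => (\sum_(i <- s) f i x)%:E).
Proof.
move=> fi; under eq_fun do rewrite -sumEFin.
exact: integrable_sum.
Qed.

Lemma eq_integral_sum_real (I : Type) (s : seq I) (f g : I -> T -> R) :
  (forall i, P.-integrable [set: T] (fun x => (f i x)%:E)) ->
  (forall i, P.-integrable [set: T] (fun x => (g i x)%:E)) ->
  (forall i, \int[P]_x (f i x)%:E = \int[P]_x (g i x)%:E)%E ->
  (\int[P]_x (\sum_(i <- s) f i x)%:E = \int[P]_x (\sum_(i <- s) g i x)%:E)%E.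
Proof.
move=> fi gi fg; under eq_integral do rewrite -sumEFin.
under [RHS]eq_integral do rewrite -sumEFin.
by rewrite !integral_sum//; apply: eq_bigr.
Qed.

End sum_integrals.

Section stein_regularised_field.
Context d (Omega : measurableType d) (R : realType) (P : probability Omega R).
Context (m p q : nat) (Gamma : 'M[R]_p).
Variable Y : Omega -> 'M[R]_(m, p).
Hypothesis mY : measurable_fun [set: Omega] Y.
Hypothesis uG : Gamma \in unitmx.

Hypothesis Ynormal : normal_matrix_rows P Gamma Y.
Variables (x : 'M[R]_(p, q)) (de : R) (de_gt0 : 0 < de).
Variables (phi phi' : R -> R) (K : R).
Hypothesis mphi : measurable_fun [set: R] phi.
Hypothesis dphi : forall t : R, 0 <= t -> is_derive t 1 phi (phi' t).
Hypothesis phi_bound : forall t : R, 0 <= t -> `|phi t| <= K.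
Hypothesis phi'_bound : forall t : R, 0 <= t -> `|phi' t| <= K.

Lemma measurable_reg_proj : measurable_fun [set: 'M[R]_(m, p)] (reg_proj de).
Proof.
have -> : reg_proj de = (fun Z : 'M[R]_(m, p) => 1%:M + (- de) *: resolv de Z).
  by apply/funext => Z; rewrite /reg_proj scaleNr.
apply: measurable_addmx => //; apply: measurable_scalemx => //.
exact: measurable_resolv.
Qed.

Lemma measurable_reg_root : measurable_fun [set: 'M[R]_(m, p)] (reg_root de).
Proof. by apply: measurable_mulmx => //; exact: measurable_resolv. Qed.

Lemma measurable_fro2 d' (T : measurableType d') k l (f : T -> 'M[R]_(k, l)) :
  measurable_fun [set: T] f -> measurable_fun [set: T] (fun t => fro2 (f t)).
Proof.
move=> /measurable_fun_mxP mf; do 2 apply: measurable_sum => ?.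
exact: measurable_funX.
Qed.

Lemma measurable_reg_stat : measurable_fun [set: 'M[R]_(m, p)] (reg_stat x de).
Proof.
by apply: measurable_fro2; apply: measurable_mulmx => //; exact: measurable_reg_root.
Qed.

Lemma measurable_reg_field :
  measurable_fun [set: 'M[R]_(m, p)] (reg_field x de phi).
Proof.
apply: measurable_scalemx; first exact: measurableT_comp measurable_reg_stat.
apply: measurable_mulmx; last exact: measurable_reg_proj.
do 2 (apply: measurable_mulmx => //).
exact: measurable_reg_root.
Qed.

(** The factor Z^T produced by Stein's identity meets U at the head of the field, and Z^T U = P;
    moving the last P by cyclicity leaves a quadratic form in P x. *)
Lemma trace_reg_field (Z : 'M[R]_(m, p)) :
  \sum_i \sum_j (Z *m (invmx Gamma)^T) i j * reg_field x de phi Z i j =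
  phi (reg_stat x de Z) *
    \tr ((reg_proj de Z *m x)^T *m invmx Gamma *m (reg_proj de Z *m x)).
Proof.
rewrite -mxtrace_mul_tr /reg_field -scalemxAr mxtraceZ; congr (_ * _).
rewrite /reg_dir trmx_mul trmxK.
have H := mul_tr_reg_root de_gt0 Z.
set U := reg_root de Z in H *; set Q := reg_proj de Z in H *.
have QT : Q^T = Q by rewrite /Q /reg_proj linearB/= linearZ/= tr_scalar_mx resolv_tr.
have -> : invmx Gamma *m Z^T *m (U *m x *m x^T *m Q) =
    invmx Gamma *m Q *m x *m x^T *m Q by rewrite -H !mulmxA.
rewrite trmx_mul QT.
transitivity (\tr ((invmx Gamma *m Q *m x) *m (x^T *m Q))).
  by rewrite !mulmxA.
by rewrite mxtrace_mulC !mulmxA.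
Qed.

Lemma measurable_reg_div :
  measurable_fun [set: 'M[R]_(m, p)] (reg_div x de phi phi').
Proof.
have -> : reg_div x de phi phi' = (fun Z : 'M[R]_(m, p) =>
    \sum_i \sum_j reg_field' x de phi phi' Z (delta_mx i j) i j).
  by apply/funext => Z; rewrite (sum_reg_field' _ de_gt0).
apply: measurable_sum => i; apply: measurable_sum => j.
apply: (@measurable_derivative _ _ _ (fun Z => reg_field x de phi Z i j)).
  by have /measurable_fun_mxP := measurable_reg_field; apply.
by move=> Z; exact: mxder_reg_field.
Qed.

Lemma reg_stein :
  (\int[P]_w (reg_div x de phi phi' (Y w))%:E =
   \int[P]_w (phi (reg_stat x de (Y w)) *
    \tr ((reg_proj de (Y w) *m x)^T *m invmx Gamma *m (reg_proj de (Y w) *m x)))%:E)%E.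
Proof.
under eq_integral do rewrite -(sum_reg_field' _ de_gt0).
under [RHS]eq_integral do rewrite -trace_reg_field.
have [c bf] := mxbnd_reg_field m x de_gt0 phi_bound.
have mf (i : 'I_m) (j : 'I_p) := (measurable_fun_mxP _).1 measurable_reg_field i j.
have df (Z D : 'M[R]_(m, p)) : mxder (reg_field x de phi) Z D (reg_field' x de phi phi' Z D).
  exact: mxder_reg_field.
have mf' i j (D : 'M[R]_(m, p)) := measurable_derivative (mf i j) (fun Z => df Z D i j).
have bf' (D : 'M[R]_(m, p)) := mxbnd_reg_field' x de_gt0 phi_bound phi'_bound D.
have mYG : measurable_fun [set: Omega] (fun w => Y w *m (invmx Gamma)^T).
  exact: measurable_mulmx.
have LY i j : L2 P (fun w => (Y w *m (invmx Gamma)^T) i j).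
  under eq_fun do rewrite mxE.
  apply: L2_sum => k; under eq_fun do rewrite mulrC.
  by apply: L2_cst_mul; exact: (normal_rows_L2 mY uG Ynormal).
have i1 i j : P.-integrable setT
    (fun w => (reg_field' x de phi phi' (Y w) (delta_mx i j) i j)%:E).
  have [c' bc'] := bf' (delta_mx i j).
  apply: (@bounded_integrable _ _ _ P _ c') => //.
  exact: (measurableT_comp (mf' i j _)).
have i2 i j : P.-integrable setT (fun w =>
    ((Y w *m (invmx Gamma)^T) i j * reg_field x de phi (Y w) i j)%:E).
  apply: L2_integrable; under eq_fun do rewrite mulrC.
  apply: (@L2_bounded_mul _ _ _ _ _ _ c) => //.
  exact: (measurableT_comp (mf i j)).
apply: eq_integral_sum_real => [i|i|i].
- by apply: integrable_sum_real => j.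
- by apply: integrable_sum_real => j.
apply: eq_integral_sum_real => // j.
apply: (normal_rows_stein mY uG Ynormal (f := fun Z => reg_field x de phi Z i j)
  (f' := fun Z D => reg_field' x de phi phi' Z D i j) (K := c)) => //.
- by move=> Z D; exact: df.
- by move=> Z D1 D2; rewrite (mxlin_reg_field' x de phi phi' Z).1 mxE.
- by move=> Z a D; rewrite (mxlin_reg_field' x de phi phi' Z).2 mxE.
- by move=> D; have [b bb] := bf' D; exists b.
Qed.

End stein_regularised_field.

Lemma fro2_gram (K : realFieldType) m n (v : 'M[K]_(m, n)) :
  fro2 (v^T *m v) = \tr (v^T *m v *m (v^T *m v)).
Proof. by rewrite fro2E trmx_mul trmxK. Qed.

(** * The statistics of S and their regularised versions *)

Section trace_statistics.
Context {R : realType} (p q : nat).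

Definition Tstat (x : 'M[R]_(p, q)) (S : 'M[R]_p) : R :=
  \tr (x^T *m mpinv S *m x *m (x^T *m mpinv S *m x)).

Context (m : nat) (x : 'M[R]_(p, q)) (Y : 'M[R]_(m, p)).
Let S := gram Y.
Let v := Y *m mpinv S *m x.

Lemma quad_mpinv_gram : x^T *m mpinv S *m x = v^T *m v.
Proof. by rewrite {1}/S mpinv_gram_fro -/S !trmx_mul !mulmxA. Qed.

Lemma Fstat_gram : Fstat x S = fro2 v.
Proof. by rewrite /Fstat quad_mpinv_gram fro2E. Qed.

Lemma Fstat_gram_ge0 : 0 <= Fstat x S.
Proof. by rewrite Fstat_gram fro2_ge0. Qed.

Lemma Tstat_gram : Tstat x S = fro2 (v^T *m v).
Proof. by rewrite /Tstat quad_mpinv_gram fro2_gram. Qed.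

Lemma Tstat_gram_ge0 : 0 <= Tstat x S.
Proof. by rewrite Tstat_gram fro2_ge0. Qed.

Lemma Tstat_gram_le : Tstat x S <= Fstat x S ^+ 2.
Proof.
rewrite Tstat_gram Fstat_gram (le_trans (fro2_mul _ _))//.
by rewrite fro2_tr expr2.
Qed.

End trace_statistics.

Section regularised_statistics.
Context {R : realType} (m p q : nat) (x : 'M[R]_(p, q)) (Y : 'M[R]_(m, p)).
Let de (n : nat) : R := n.+1%:R^-1.
Let de_gt0 n : 0 < de n. Proof. by rewrite invr_gt0. Qed.
Let v n := reg_root (de n) Y *m x.
Let W n := reg_hat (de n) Y.
Let Q n := reg_proj (de n) Y.
Let S := gram Y.
Let M := x^T *m mpinv S *m x.

Lemma reg_hat_root n : W n *m reg_root (de n) Y = reg_root (de n) Y *m Q n.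
Proof.
rewrite /W /Q /reg_proj -gram_resolv// /reg_hat /reg_root /gram !mulmxA.
by rewrite -(mulmxA _ Y^T).
Qed.

Lemma cvg_reg_quad : mxcvg \oo (fun n => (v n)^T *m v n) M.
Proof.
have H : mxcvg \oo
    (fun n => x^T *m ((reg_root (de n) Y)^T *m reg_root (de n) Y) *m x) M.
  apply: mxcvg_mul; last exact: mxcvg_cst.
  by apply: mxcvg_mul; [exact: mxcvg_cst|exact: cvg_trU_U].
apply: mxcvg_near_eq H; apply: nearW => n.
by rewrite /v; move: (reg_root _ _) => u; rewrite trmx_mul !mulmxA.
Qed.

Lemma cvg_reg_quad_hat : mxcvg \oo (fun n => (v n)^T *m W n *m v n) M.
Proof.
have H : mxcvg \oo
    (fun n => x^T *m ((reg_root (de n) Y)^T *m reg_root (de n) Y *m Q n) *m x)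
    (x^T *m (mpinv S *m (S *m mpinv S)) *m x).
  apply: mxcvg_mul; last exact: mxcvg_cst.
  apply: mxcvg_mul; first exact: mxcvg_cst.
  by apply: mxcvg_mul; [exact: cvg_trU_U|exact: cvg_reg_proj].
have E : mpinv S *m (S *m mpinv S) = mpinv S.
  by rewrite mulmxA; have [] := mpinvP S.
rewrite E in H; apply: mxcvg_near_eq H; apply: nearW => n.
have -> : (v n)^T *m W n *m v n =
    x^T *m (reg_root (de n) Y)^T *m (W n *m reg_root (de n) Y) *m x.
  rewrite /v; move: (reg_root _ _) (W n) => u V.
  by rewrite trmx_mul !mulmxA.
by rewrite reg_hat_root; move: (reg_root _ _) (Q n) => u V; rewrite !mulmxA.
Qed.

Lemma cvg_reg_stat : reg_stat x (de n) Y @[n --> \oo] --> Fstat x S.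
Proof.
under eq_cvg do rewrite /reg_stat fro2E.
by apply: mxcvg_trace; exact: cvg_reg_quad.
Qed.

Lemma reg_quad_hat_bound n :
  `|\tr ((v n)^T *m W n *m v n)| <= m%:R * reg_stat x (de n) Y.
Proof.
rewrite -[X in X * _]mul1r; apply: norm_quad_le => i j.
by rewrite /W /reg_hat /reg_root mul_resolv_tr_bound.
Qed.

Lemma reg_quad2_bound n :
  `|\tr ((v n)^T *m v n *m ((v n)^T *m v n))| <= reg_stat x (de n) Y ^+ 2.
Proof.
rewrite -fro2_gram ger0_norm ?fro2_ge0// (le_trans (fro2_mul _ _))// fro2_tr.
by rewrite -expr2.
Qed.

(** The inequality 2 |tr (A^T B)| <= |A|^2 + |B|^2, with the factor 2 given up. The entries of W are
    at most 1, so its squared norm is at most m^2, the origin of the constant. *)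
Lemma reg_quad2_hat_bound n :
  `|\tr ((v n)^T *m v n *m ((v n)^T *m W n *m v n))| <=
    (1 + m%:R ^+ 2) * reg_stat x (de n) Y ^+ 2.
Proof.
set F := reg_stat x (de n) Y.
have F0 : 0 <= F by exact: fro2_ge0.
have H := norm_mxtrace_mul_tr_le ((v n)^T *m v n) ((v n)^T *m W n *m v n).
have E : ((v n)^T *m v n)^T = (v n)^T *m v n.
  by move: (v n) => u; rewrite trmx_mul trmxK.
rewrite E in H.
have H1 : fro2 ((v n)^T *m v n) <= F ^+ 2.
  by rewrite (le_trans (fro2_mul _ _))// fro2_tr -expr2.
have HW : fro2 (W n) <= m%:R ^+ 2.
  rewrite /fro2 (@le_trans _ _ (\sum_(i < m) \sum_(j < m) 1))//.
    apply: ler_sum => i _; apply: ler_sum => j _.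
    rewrite -real_normK ?num_real// expr_le1//.
    by rewrite /W /reg_hat /reg_root mul_resolv_tr_bound.
  by rewrite !sumr_const !card_ord -mulrnA expr2 natrM.
have H2 : fro2 ((v n)^T *m W n *m v n) <= m%:R ^+ 2 * F ^+ 2.
  rewrite (le_trans (fro2_mul _ _))// (le_trans (ler_wpM2r F0 (fro2_mul _ _)))//.
  rewrite fro2_tr -/F [F * _]mulrC -mulrA -expr2 ler_wpM2r//.
  exact: sqr_ge0.
have := fro2_ge0 ((v n)^T *m v n).
have : 0 <= m%:R ^+ 2 * F ^+ 2 :> R by rewrite mulr_ge0 ?sqr_ge0.
have := sqr_ge0 F.
lra.
Qed.

Lemma trace_reg_proj_bound n : `|\tr (Q n)| <= 2 * p%:R.
Proof.
rewrite (le_trans (ler_norm_sum _ _ _))//.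
rewrite (le_trans (ler_sum _ (fun i _ => resolv_proj_bound Y n i i)))//.
by rewrite sumr_const card_ord mulr_natr.
Qed.

(** From P = Y^T U. It yields one power of F at the cost of |Y|^2, so that phi (F) times the
    quadratic form is dominated by a multiple of |Y|^2, which is integrable. *)
Lemma fro2_reg_proj n : fro2 (Q n *m x) <= fro2 Y * reg_stat x (de n) Y.
Proof.
rewrite /Q -mul_tr_reg_root// -mulmxA (le_trans (fro2_mul _ _))//.
by rewrite fro2_tr.
Qed.

End regularised_statistics.

Lemma integrable_cst_probability d (T : measurableType d) (R : realType)
    (P : probability T R) (c : R) : P.-integrable [set: T] (fun=> c%:E).
Proof. by apply: (@bounded_integrable _ _ _ P (fun=> c) `|c|). Qed.

Section stein_gram.
Context d (Omega : measurableType d) (R : realType) (P : probability Omega R).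
Context (m p q : nat) (Gamma : 'M[R]_p).
Variable Y : Omega -> 'M[R]_(m, p).
Hypothesis mY : measurable_fun [set: Omega] Y.
Hypothesis uG : Gamma \in unitmx.
Hypothesis Ynormal : normal_matrix_rows P Gamma Y.
Variable (x : 'M[R]_(p, q)).
Variables (phi phi' : R -> R) (K : R).
Hypothesis mphi : measurable_fun [set: R] phi.
Hypothesis dphi : forall t : R, 0 <= t -> is_derive t 1 phi (phi' t).
Hypothesis phi_bound : forall t : R, 0 <= t -> `|phi t| <= K.
Hypothesis mul_phi_bound : forall t : R, 0 <= t -> `|t * phi t| <= K.
Hypothesis sqr_phi'_bound : forall t : R, 0 <= t -> `|t ^+ 2 * phi' t| <= K.

(* The limit as [de] tends to 0 of [reg_div], and the exact divergence of
   [gram_field] at matrices of full rank. *)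
Definition gram_div (x : 'M[R]_(p, q)) (phi phi' : R -> R) (S : 'M[R]_p) : R :=
  let F := Fstat x S in
  phi F * ((m%:R + p%:R - 1 - 2 * \tr (S *m mpinv S)) * F)
  - 2 * phi' F * Tstat x S.

Definition gram_quad (Lambda : 'M[R]_p) (x : 'M[R]_(p, q)) (phi : R -> R)
    (S : 'M[R]_p) : R :=
  phi (Fstat x S) * \tr ((S *m mpinv S *m x)^T *m Lambda *m (S *m mpinv S *m x)).

Let de (n : nat) : R := n.+1%:R^-1.
Let de_gt0 n : 0 < de n. Proof. by rewrite invr_gt0. Qed.
Let K0 : 0 <= K. Proof. exact: le_trans (phi_bound (lexx 0)). Qed.

Section continuous_derivative.
Hypothesis phi'_bound : forall t : R, 0 <= t -> `|phi' t| <= K.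
Hypothesis phi'_cont : forall t : R, 0 <= t -> {for t, continuous phi'}.

Let phi_cont (t : R) : 0 <= t -> {for t, continuous phi}.
Proof.
move=> t0; apply: differentiable_continuous; apply/derivable1_diffP.
by have := dphi t0 => ?; exact: ex_derive.
Qed.

Lemma cvg_reg_div (Z : 'M[R]_(m, p)) :
  reg_div x (de n) phi phi' Z @[n --> \oo] --> gram_div x phi phi' (gram Z).
Proof.
have F0 := Fstat_gram_ge0 x Z.
have cF : reg_stat x (de n) Z @[n --> \oo] --> Fstat x (gram Z).
  exact: cvg_reg_stat.
have c1 : phi (reg_stat x (de n) Z) @[n --> \oo] --> phi (Fstat x (gram Z)).
  by apply: continuous_cvg => //; exact: phi_cont.
have c2 : phi' (reg_stat x (de n) Z) @[n --> \oo] --> phi' (Fstat x (gram Z)).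
  by apply: continuous_cvg => //; exact: phi'_cont.
have cq := @cvg_reg_quad _ _ _ _ x Z.
have ch := @cvg_reg_quad_hat _ _ _ _ x Z.
have ct := mxcvg_trace (@cvg_reg_proj _ _ _ Z) : \tr (reg_proj (de n) Z) @[n --> \oo] --> _.
(* The target is put in the shape of [reg_div]. In the limit [reg_hat] drops out of both traces
   containing it, which then tend to F and [Tstat]: hence + 1 becomes - 1, and 1 - 2 leaves - 2 phi'
   T. *)
have -> : gram_div x phi phi' (gram Z) =
   phi (Fstat x (gram Z)) *
     ((m%:R + p%:R + 1 - 2 * \tr (gram Z *m mpinv (gram Z))) * Fstat x (gram Z)
      - 2 * Fstat x (gram Z))
   + 2 * phi' (Fstat x (gram Z)) *
     (Tstat x (gram Z) - 2 * Tstat x (gram Z)).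
  by rewrite /gram_div; ring.
rewrite /reg_div; apply: cvgD; apply: cvgM => //.
- apply: cvgB.
    apply: cvgM => //; apply: cvgB; first exact: cvg_cst.
    by apply: cvgM; [exact: cvg_cst|exact: ct].
  by apply: cvgM; [exact: cvg_cst|apply: mxcvg_trace; exact: ch].
- by apply: cvgM => //; exact: cvg_cst.
- apply: cvgB; first by apply: mxcvg_trace; exact: mxcvg_mul.
  apply: cvgM; first exact: cvg_cst.
  by apply: mxcvg_trace; exact: mxcvg_mul.
Qed.

Lemma cvg_reg_lhs (Z : 'M[R]_(m, p)) :
  phi (reg_stat x (de n) Z) * \tr ((reg_proj (de n) Z *m x)^T *m invmx Gamma *m
     (reg_proj (de n) Z *m x)) @[n --> \oo] -->
  gram_quad (invmx Gamma) x phi (gram Z).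
Proof.
have F0 := Fstat_gram_ge0 x Z.
have c := mxcvg_mul (@cvg_reg_proj _ _ _ Z) (@mxcvg_cst _ _ \oo _ _ _ x).
apply: cvgM.
  apply: continuous_cvg; first exact: phi_cont.
  exact: cvg_reg_stat.
apply: mxcvg_trace; apply: mxcvg_mul; last exact: c.
apply: mxcvg_mul; last exact: mxcvg_cst.
by move=> i j; rewrite mxE; under eq_cvg do rewrite mxE; exact: c.
Qed.

Lemma reg_div_bound n (Z : 'M[R]_(m, p)) :
  `|reg_div x (de n) phi phi' Z| <=
    (m%:R + p%:R + 1 + 4 * p%:R + 2 * m%:R + 2 * (3 + 2 * m%:R ^+ 2)) * K.
Proof.
rewrite /reg_div.
have F0 : 0 <= reg_stat x (de n) Z by exact: fro2_ge0.
have := trace_reg_proj_bound Z n.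
have := reg_quad_hat_bound x Z n.
have := reg_quad2_bound x Z n.
have := reg_quad2_hat_bound x Z n.
have := mul_phi_bound F0; have := sqr_phi'_bound F0.
set F := reg_stat x _ Z in F0 *.
set a := \tr (_ *m (_ *m reg_hat _ _ *m _)); set b := \tr (_ *m (_ *m (_ *m _))).
set c := \tr (_ *m reg_hat _ _ *m _); set t := \tr (reg_proj _ _).
set f := phi F; set f' := phi' F.
move=> h1 h2 ha hb hc ht.
have m0 : 0 <= m%:R :> R by []. have p0 : 0 <= p%:R :> R by [].
have -> : f * ((m%:R + p%:R + 1 - 2 * t) * F - 2 * c) + 2 * f' * (b - 2 * a) =
   (m%:R + p%:R + 1 - 2 * t) * (F * f) - 2 * (c * f) + 2 * (f' * b - 2 * (f' * a)).
  by ring.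
have e1 : `|(m%:R + p%:R + 1 - 2 * t) * (F * f)| <=
    (m%:R + p%:R + 1 + 4 * p%:R) * K.
  rewrite normrM ler_pM//.
  rewrite (le_trans (ler_normB _ _))// normrM [`|2|]ger0_norm//.
  rewrite [`|_ + _ + _|]ger0_norm ?addr_ge0//; lra.
have e2 : `|c * f| <= m%:R * K.
  rewrite normrM (le_trans (ler_wpM2r (normr_ge0 _) hc))//.
  rewrite -mulrA ler_wpM2l//.
  by rewrite -[X in X * _](ger0_norm F0) -normrM.
have e3 z k : 0 <= k -> `|z| <= k * F ^+ 2 -> `|f' * z| <= k * K.
  move=> k0 hz; rewrite normrM (le_trans (ler_wpM2l (normr_ge0 _) hz))//.
  rewrite mulrCA ler_wpM2l//.
  rewrite mulrC -[X in X * _](ger0_norm (sqr_ge0 F)) -normrM.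
  exact: h1.
have e4 : `|f' * b| <= 1 * K by apply: e3 => //; rewrite mul1r.
have e5 : `|f' * a| <= (1 + m%:R ^+ 2) * K.
  by apply: e3 => //; rewrite addr_ge0// sqr_ge0.
have := K0.
move: e1 e2 e4 e5; rewrite !ler_norml; lra.
Qed.

Lemma reg_lhs_bound c n (Z : 'M[R]_(m, p)) :
  (forall i j, `|invmx Gamma i j| <= c) -> 0 <= c ->
  `|phi (reg_stat x (de n) Z) * \tr ((reg_proj (de n) Z *m x)^T *m invmx Gamma *m
     (reg_proj (de n) Z *m x))| <= c * p%:R * K * fro2 Z.
Proof.
move=> bc c0.
have F0 : 0 <= reg_stat x (de n) Z by exact: fro2_ge0.
have h1 := norm_quad_le (reg_proj (de n) Z *m x) bc.
have h2 := fro2_reg_proj x Z n.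
have h3 := mul_phi_bound F0.
rewrite normrM (le_trans (ler_wpM2l (normr_ge0 _) h1))//.
have h4 := ler_wpM2l (mulr_ge0 c0 (ler0n R p)) h2.
rewrite (le_trans (ler_wpM2l (normr_ge0 _) h4))//.
set F := reg_stat _ _ _ in F0 h3 *.
rewrite [leLHS](_ : _ = c * p%:R * fro2 Z * (F * `|phi F|)); last by ring.
rewrite [leRHS](_ : _ = c * p%:R * fro2 Z * K); last by ring.
rewrite ler_wpM2l//; first by rewrite !mulr_ge0// fro2_ge0.
by rewrite -[X in X * _](ger0_norm F0) -normrM.
Qed.

Lemma fro2_integrable : P.-integrable setT (fun w => (fro2 (Y w))%:E).
Proof.
apply: integrable_sum_real => i; apply: integrable_sum_real => j.
by apply: L2_sqr_integrable; exact: (normal_rows_L2 mY uG Ynormal).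
Qed.

Lemma gram_stein_continuous :
  (\int[P]_w (gram_div x phi phi' (gram (Y w)))%:E =
   \int[P]_w (gram_quad (invmx Gamma) x phi (gram (Y w)))%:E)%E.
Proof.
have mdiv n : measurable_fun [set: Omega]
    (fun w => reg_div x (de n) phi phi' (Y w)).
  by apply: measurableT_comp => //; exact: (measurable_reg_div _ _ mphi dphi).
have mlhs n : measurable_fun [set: Omega] (fun w =>
    phi (reg_stat x (de n) (Y w)) * \tr ((reg_proj (de n) (Y w) *m x)^T *m
      invmx Gamma *m (reg_proj (de n) (Y w) *m x))).
  have mQ : measurable_fun [set: Omega] (fun w => reg_proj (de n) (Y w) *m x).
    apply: measurable_mulmx => //.
    by apply: (measurableT_comp _ mY); exact: measurable_reg_proj.
  apply: measurable_funM.
    apply: (measurableT_comp mphi).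
    by apply: (measurableT_comp _ mY); exact: measurable_reg_stat.
  apply: measurable_mxtrace; apply: measurable_mulmx => //.
  by apply: measurable_mulmx => //; exact: measurable_trmx.
have mdiv0 : measurable_fun [set: Omega]
    (fun w => gram_div x phi phi' (gram (Y w))).
  by apply: (measurable_fun_cvg mdiv) => w _; exact: cvg_reg_div.
have mlhs0 : measurable_fun [set: Omega]
    (fun w => gram_quad (invmx Gamma) x phi (gram (Y w))).
  by apply: (measurable_fun_cvg mlhs) => w _; exact: cvg_reg_lhs.
have [c bc] := @mxbnd_cst _ unit _ _ (invmx Gamma).
have bc' i j : `|invmx Gamma i j| <= `|c|.
  by rewrite (le_trans (bc tt i j))// ler_norm.
have L1 := cvg_integral_dominated mdiv mdiv0 (aeW P (fun w => @cvg_reg_div (Y w)))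
  (integrable_cst_probability P _)
  (aeW P (fun w n => reg_div_bound n (Y w))).
have iF : P.-integrable setT (fun w => (`|c| * p%:R * K * fro2 (Y w))%:E).
  under eq_fun do rewrite EFinM.
  exact: integrableZl fro2_integrable.
have L2 := cvg_integral_dominated mlhs mlhs0 (aeW P (fun w => @cvg_reg_lhs (Y w)))
  iF (aeW P (fun w n => reg_lhs_bound n (Y w) bc' (normr_ge0 c))).
have [e1 e2] := (cvg_lim (@ereal_hausdorff R) L1, cvg_lim (@ereal_hausdorff R) L2).
rewrite -e1 -e2; apply: congr_lim; apply/funext => n.
exact: (reg_stein mY uG Ynormal _ _ mphi dphi phi_bound).
Qed.

End continuous_derivative.

End stein_gram.

(** The base point -1 puts the half-line t >= 0 in the interior, so that the derivative at 0 is
    two-sided. Up to -1 the integral is over an empty interval or a point and vanishes, whence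
    measurability on the whole line. *)
Lemma continuous_antiderivative (R : realType) (f : R -> R) :
  continuous f -> exists F : R -> R,
    measurable_fun [set: R] F /\ forall t : R, 0 <= t -> is_derive t 1 F (f t).
Proof.
move=> cf; pose F t := (\int[lebesgue_measure]_(s in `[(-1 : R), t]) f s)%R.
have dF (t : R) : -1 < t -> is_derive t 1 F (f t).
  move=> t1; have fi : lebesgue_measure.-integrable `[(-1 : R), t + 1] (EFin \o f).
    apply: continuous_compact_integrable; first exact: segment_compact.
    exact: continuous_subspaceT.
  have tt1 : t < t + 1 by rewrite ltrDl.
  have [d <-] := continuous_FTC1_closed tt1 fi t1 (cf t).
  by rewrite derive1E; exact: derivableP.
exists F; split; last by move=> t t0; apply: dF; rewrite (lt_le_trans _ t0)// ltrN10.
have -> : [set: R] = `](-1 : R), +oo[ `|` `]-oo, (-1 : R)].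
  by rewrite setUC -itv_bndbnd_setU ?set_itvNyy.
apply/measurable_funU => //; split.
  apply: open_continuous_measurable_fun; first exact: interval_open.
  move=> t; rewrite inE/= in_itv/= andbT => t1.
  apply: differentiable_continuous; apply/derivable1_diffP.
  by have := dF _ t1 => ?; exact: ex_derive.
apply: (@eq_measurable_fun _ _ R R _ (fun=> 0) F) => [t|]; last exact: measurable_cst.
rewrite inE/= in_itv/= le_eqVlt => /predU1P[->|t1].
  by rewrite /F set_itv1 Rintegral_set1.
by rewrite /F set_itv_ge ?Rintegral_set0// bnd_simp -ltNge.
Qed.

Section measurable_statistics.
Context d (T : measurableType d) (R : realType) (p q : nat).
Variables (X : T -> 'M[R]_(p, q)) (S : T -> 'M[R]_p).
Hypothesis mX : measurable_fun [set: T] X.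
Hypothesis mS : measurable_fun [set: T] S.

Let mQ : measurable_fun [set: T] (fun t => (X t)^T *m mpinv (S t) *m X t).
Proof.
apply: measurable_mulmx => //; apply: measurable_mulmx; last exact: measurable_mpinv.
exact: measurable_trmx.
Qed.

Lemma measurable_Fstat : measurable_fun [set: T] (fun t => Fstat (X t) (S t)).
Proof. exact: measurable_mxtrace. Qed.

Lemma measurable_Tstat : measurable_fun [set: T] (fun t => Tstat (X t) (S t)).
Proof. by apply: measurable_mxtrace; exact: measurable_mulmx. Qed.

Lemma measurable_gram_div m (phi phi' : R -> R) :
  measurable_fun [set: R] phi -> measurable_fun [set: R] phi' ->
  measurable_fun [set: T] (fun t => gram_div m (X t) phi phi' (S t)).
Proof.
move=> mphi mphi'; have mF := measurable_Fstat; have mT := measurable_Tstat.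
apply: measurable_funB; apply: measurable_funM => //.
- exact: measurableT_comp.
- apply: measurable_funM => //; apply: measurable_funB => //.
  apply: measurable_funM => //; apply: measurable_mxtrace.
  by apply: measurable_mulmx => //; exact: measurable_mpinv.
- by apply: measurable_funM => //; exact: measurableT_comp.
Qed.

Lemma measurable_gram_quad (Lambda : 'M[R]_p) (phi : R -> R) :
  measurable_fun [set: R] phi ->
  measurable_fun [set: T] (fun t => gram_quad Lambda (X t) phi (S t)).
Proof.
move=> mphi; have mF := measurable_Fstat.
have mP : measurable_fun [set: T] (fun t => S t *m mpinv (S t) *m X t).
  by apply: measurable_mulmx => //; apply: measurable_mulmx => //; exact: measurable_mpinv.
apply: measurable_funM; first exact: measurableT_comp.
apply: measurable_mxtrace; apply: measurable_mulmx => //.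
by apply: measurable_mulmx => //; exact: measurable_trmx.
Qed.

End measurable_statistics.

Section gram_bounds.
Context (R : realType) (m p q : nat) (x : 'M[R]_(p, q)) (Z : 'M[R]_(m, p)).
Let S := gram Z.
Let F := Fstat x S.

Let F0 : 0 <= F. Proof. exact: Fstat_gram_ge0. Qed.

(** Here m + 3 p + 1 bounds |m + p - 1 - 2 rank S|, and the other 2 comes from Tstat <= F^2 in the
    term with [phi']. *)
Lemma gram_div_bound (phi phi' : R -> R) (K : R) :
  `|F * phi F| <= K -> `|F ^+ 2 * phi' F| <= K ->
  `|gram_div m x phi phi' S| <= (m%:R + 3 * p%:R + 3) * K.
Proof.
move=> h1 h2; rewrite /gram_div -/F mxtrace_mul_mpinv.
have T0 := Tstat_gram_ge0 x Z; have T1 := Tstat_gram_le x Z.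
rewrite -/S -/F in T0 T1.
have rp : (\rank S)%:R <= p%:R :> R by rewrite ler_nat rank_leq_row.
have r0 : 0 <= (\rank S)%:R :> R by [].
have m0 : 0 <= m%:R :> R by [].
set k := (\rank S)%:R in rp r0 *; set t := Tstat x S in T0 T1 *.
have -> : phi F * ((m%:R + p%:R - 1 - 2 * k) * F) - 2 * phi' F * t =
  (m%:R + p%:R - 1 - 2 * k) * (F * phi F) - 2 * (t * phi' F) by ring.
have e1 : `|(m%:R + p%:R - 1 - 2 * k) * (F * phi F)| <= (m%:R + 3 * p%:R + 1) * K.
  by rewrite normrM ler_pM// ler_norml; apply/andP; split; lra.
have e2 : `|t * phi' F| <= K.
  rewrite (le_trans _ h2)// !normrM ler_wpM2r//.
  by rewrite !ger0_norm// sqr_ge0.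
by move: e1 e2; rewrite !ler_norml; lra.
Qed.

Lemma gram_quad_bound (Lambda : 'M[R]_p) (phi : R -> R) (K c : R) :
  (forall i j, `|Lambda i j| <= c) -> 0 <= c -> `|F * phi F| <= K ->
  `|gram_quad Lambda x phi S| <= c * p%:R * K * fro2 Z.
Proof.
move=> bc c0 h; rewrite /gram_quad -/F normrM.
have h1 := norm_quad_le (S *m mpinv S *m x) bc.
rewrite (le_trans (ler_wpM2l (normr_ge0 _) h1))//.
have h2 : fro2 (S *m mpinv S *m x) <= fro2 Z * F.
  rewrite /F Fstat_gram -/S {1}/S /gram -!mulmxA (le_trans (fro2_mul _ _))//.
  by rewrite fro2_tr !mulmxA.
have h4 := ler_wpM2l (mulr_ge0 c0 (ler0n R p)) h2.
rewrite (le_trans (ler_wpM2l (normr_ge0 _) h4))//.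
rewrite [leLHS](_ : _ = c * p%:R * fro2 Z * (F * `|phi F|)); last by ring.
rewrite [leRHS](_ : _ = c * p%:R * fro2 Z * K); last by ring.
rewrite ler_wpM2l//; first by rewrite !mulr_ge0// fro2_ge0.
by rewrite -[X in X * _](ger0_norm F0) -normrM.
Qed.

End gram_bounds.

Section stein_gram_derivable.
Context d (Omega : measurableType d) (R : realType) (P : probability Omega R).
Context (m p q : nat) (Gamma : 'M[R]_p).
Variable Y : Omega -> 'M[R]_(m, p).
Hypothesis mY : measurable_fun [set: Omega] Y.
Hypothesis uG : Gamma \in unitmx.
Hypothesis Ynormal : normal_matrix_rows P Gamma Y.
Variable (x : 'M[R]_(p, q)).
Variables (phi phi' : R -> R) (K : R).
Hypothesis dphi : forall t : R, is_derive t 1 phi (phi' t).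
Hypothesis phi_bound : forall t : R, 0 <= t -> `|phi t| <= K.
Hypothesis mul_phi_bound : forall t : R, 0 <= t -> `|t * phi t| <= K.
Hypothesis phi'_bound : forall t : R, 0 <= t -> `|phi' t| <= K.
Hypothesis sqr_phi'_bound : forall t : R, 0 <= t -> `|t ^+ 2 * phi' t| <= K.

Let cphi : continuous phi.
Proof.
move=> t; apply: differentiable_continuous; apply/derivable1_diffP.
by have := dphi t => ?; exact: ex_derive.
Qed.

Let mphi : measurable_fun [set: R] phi.
Proof. exact: continuous_measurable_fun. Qed.

Lemma gram_stein :
  (\int[P]_w (gram_div m x phi phi' (gram (Y w)))%:E =
   \int[P]_w (gram_quad (invmx Gamma) x phi (gram (Y w)))%:E)%E.
Proof.
have [F [mF dF]] := continuous_antiderivative cphi.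
pose psi n t := n.+1%:R * (F (t + n.+1%:R^-1) - F t).
pose psi' n t := n.+1%:R * (phi (t + n.+1%:R^-1) - phi t).
have i0 n : 0 < n.+1%:R^-1 :> R by rewrite invr_gt0.
have dpsi n (t : R) : 0 <= t -> is_derive t 1 (psi n) (psi' n t).
  move=> t0.
  have d1 : is_derive t 1 (fun s => F (s + n.+1%:R^-1)) (phi (t + n.+1%:R^-1)).
    have h : is_derive t 1 (fun s => s + n.+1%:R^-1) (1 : R).
      have := is_deriveD (is_derive_id t (1 : R)) (is_derive_cst (n.+1%:R^-1 : R) t (1 : R)).
      by rewrite addr0.
    have := @is_derive_comp_real R R F (fun s : R => s + n.+1%:R^-1) t 1 _ _
      (dF _ (addr_ge0 t0 (ltW (i0 n)))) h.
    by rewrite mulr1.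
  have d2 := dF t t0.
  by rewrite /psi /psi'; apply: is_derive_eq; rewrite /GRing.scale/=; ring.
(* The mean value theorem makes each value of [psi n] or [psi' n] at t a value of [phi] or [phi'] at
   some s >= t. As t <= s, the bounds with weights 1, t and t^2 carry over with the same [K]. *)
have mvt (G g : R -> R) n (t : R) : 0 <= t ->
    (forall s : R, 0 <= s -> is_derive s 1 G (g s)) ->
    exists2 s, t <= s & n.+1%:R * (G (t + n.+1%:R^-1) - G t) = g s.
  move=> t0 dG; have tn : t < t + n.+1%:R^-1 by rewrite ltrDl.
  have dG' s : s \in `]t, t + n.+1%:R^-1[ -> is_derive s 1 G (g s).
    by rewrite in_itv/= => /andP[ts _]; apply: dG; rewrite (le_trans t0)// ltW.
  have cG : {within `[t, t + n.+1%:R^-1], continuous G}.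
    apply: derivable_within_continuous => s; rewrite in_itv/= => /andP[ts _].
    by have := dG _ (le_trans t0 ts) => ?; exact: ex_derive.
  have [s] := MVT tn dG' cG; rewrite in_itv/= => /andP[ts _] ->.
  exists s; first exact: ltW.
  by rewrite addrAC subrr add0r mulrCA divff ?mulr1.
have psiE n (t : R) : 0 <= t -> exists2 s, t <= s & psi n t = phi s.
  by move=> t0; exact: mvt.
have psi'E n (t : R) : 0 <= t -> exists2 s, t <= s & psi' n t = phi' s.
  by move=> t0; exact: mvt.
have b1 n (t : R) : 0 <= t -> `|psi n t| <= K.
  by move=> t0; have [s ts ->] := psiE n t t0; apply: phi_bound; exact: le_trans ts.
have b2 n (t : R) : 0 <= t -> `|t * psi n t| <= K.
  move=> t0; have [s ts ->] := psiE n t t0.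
  have s0 := le_trans t0 ts.
  rewrite (le_trans _ (mul_phi_bound s0))// !normrM ler_wpM2r// !ger0_norm//.
have b3 n (t : R) : 0 <= t -> `|psi' n t| <= K.
  by move=> t0; have [s ts ->] := psi'E n t t0; apply: phi'_bound; exact: le_trans ts.
have b4 n (t : R) : 0 <= t -> `|t ^+ 2 * psi' n t| <= K.
  move=> t0; have [s ts ->] := psi'E n t t0.
  have s0 := le_trans t0 ts.
  rewrite (le_trans _ (sqr_phi'_bound s0))// !normrM ler_wpM2r//.
  by rewrite !ger0_norm ?ler_pM.
have shift_cont n : continuous (fun t : R => phi (t + n.+1%:R^-1)).
  move=> t; apply: (@continuous_comp R R R (fun t : R => t + n.+1%:R^-1) phi).
    by apply: cvgD; [exact: cvg_id|exact: cvg_cst].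
  exact: cphi.
have cpsi' n : continuous (psi' n).
  move=> t; apply: cvgM; first exact: cvg_cst.
  by apply: cvgB; [exact: shift_cont|exact: cphi].
have mpsi n : measurable_fun [set: R] (psi n).
  apply: measurable_funM => //; apply: measurable_funB => //.
  by apply: (measurableT_comp mF); exact: measurable_funD.
have mpsi' n : measurable_fun [set: R] (psi' n) by exact: continuous_measurable_fun.
have cp (t : R) : 0 <= t -> psi n t @[n --> \oo] --> phi t.
  by move=> t0; exact: cvg_harmonic_quotient (dF t t0).
have cp' (t : R) : psi' n t @[n --> \oo] --> phi' t.
  exact: cvg_harmonic_quotient (dphi t).
have mphi' : measurable_fun [set: R] phi'.
  by apply: (measurable_fun_cvg mpsi') => t _; exact: cp'.
have mS : measurable_fun [set: Omega] (fun w => gram (Y w)).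
  exact: measurable_gram.
have E n := gram_stein_continuous mY uG Ynormal x (mpsi n) (dpsi n) (b1 n) (b2 n)
  (b4 n) (b3 n) (fun t _ => cpsi' n t).
have F0 w : 0 <= Fstat x (gram (Y w)) by exact: Fstat_gram_ge0.
have c1 w : gram_div m x (psi n) (psi' n) (gram (Y w)) @[n --> \oo] -->
    gram_div m x phi phi' (gram (Y w)).
  apply: cvgB.
    by apply: cvgM; [exact: cp|exact: cvg_cst].
  apply: cvgM; last exact: cvg_cst.
  by apply: cvgM; [exact: cvg_cst|exact: cp'].
have c2 w : gram_quad (invmx Gamma) x (psi n) (gram (Y w)) @[n --> \oo] -->
    gram_quad (invmx Gamma) x phi (gram (Y w)).
  by apply: cvgM; [exact: cp|exact: cvg_cst].
have [c bc] := @mxbnd_cst _ unit _ _ (invmx Gamma).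
have bc' i j : `|invmx Gamma i j| <= `|c|.
  by rewrite (le_trans (bc tt i j))// ler_norm.
have L1 := cvg_integral_dominated
  (fun n => measurable_gram_div (measurable_cst x) mS m (mpsi n) (mpsi' n))
  (measurable_gram_div (measurable_cst x) mS m mphi mphi')
  (aeW P c1) (integrable_cst_probability P _)
  (aeW P (fun w n => gram_div_bound (b2 n _ (F0 w)) (b4 n _ (F0 w)))).
have iF : P.-integrable setT (fun w => (`|c| * p%:R * K * fro2 (Y w))%:E).
  under eq_fun do rewrite EFinM.
  exact: integrableZl (fro2_integrable mY uG Ynormal).
have L2 := cvg_integral_dominated
  (fun n => measurable_gram_quad (measurable_cst x) mS (invmx Gamma) (mpsi n))
  (measurable_gram_quad (measurable_cst x) mS (invmx Gamma) mphi)
  (aeW P c2) iF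
  (aeW P (fun w n => gram_quad_bound bc' (normr_ge0 c) (b2 n _ (F0 w)))).
have [e1 e2] := (cvg_lim (@ereal_hausdorff R) L1, cvg_lim (@ereal_hausdorff R) L2).
by rewrite -e1 -e2; apply: congr_lim; apply/funext => n; exact: E.
Qed.

End stein_gram_derivable.

(** * Integrability of the inverse statistic *)

Lemma fro2Z (K : realFieldType) m n (c : K) (A : 'M[K]_(m, n)) :
  fro2 (c *: A) = c ^+ 2 * fro2 A.
Proof.
rewrite mulr_sumr; apply: eq_bigr => i _; rewrite mulr_sumr.
by apply: eq_bigr => j _; rewrite mxE exprMn.
Qed.

Lemma is_derive_fro2_mul (R : realType) m p q (V : 'M[R]_(m, p))
    (x D : 'M[R]_(p, q)) :
  is_derive x D (fun y => fro2 (V *m y)) (2 * \tr ((V *m x)^T *m V *m D)).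
Proof.
have h : mxder (fun y : 'M[R]_(p, q) => V *m y) x D (V *m D).
  apply: (mxder_eq (mxder_mul (mxder_cst V x D) (mxder_id x D))).
  by rewrite mul0mx add0r.
have h2 := is_derive_trace (mxder_mul (mxder_tr h) h).
have -> : 2 * \tr ((V *m x)^T *m V *m D) =
    \tr ((V *m D)^T *m (V *m x) + (V *m x)^T *m (V *m D)).
  rewrite mxtraceD -mulmxA; move: (V *m x) (V *m D) => a b.
  by rewrite -[X in _ = X + _]mxtrace_tr trmx_mul trmxK; ring.
have -> // : (fun y : 'M[R]_(p, q) => fro2 (V *m y)) =
    (fun y => \tr ((V *m y)^T *m (V *m y))).
by apply/funext => y; rewrite fro2E.
Qed.

Section divergence_in_columns.
Context (R : realType) (m p q : nat) (Z : 'M[R]_(m, p)) (x : 'M[R]_(p, q)).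
Let S := gram Z.
Let Q := S *m mpinv S.
Let V := Z *m mpinv S.

Lemma sum_gram_proj_delta :
  \sum_(i < p) \sum_(j < q) (Q *m delta_mx i j) i j = (q * \rank S)%:R.
Proof.
under eq_bigr => i _ do under eq_bigr => j _ do rewrite -[Q *m _]mulmx1.
by rewrite sum_mul_delta_mul mxtrace_mul_mpinv mxtrace1 mulrC natrM.
Qed.

Lemma sum_dFstat_proj :
  \sum_i \sum_j \tr ((V *m x)^T *m V *m delta_mx i j) * (Q *m x) i j = fro2 (V *m x).
Proof.
have VQ : V *m Q = V.
  by rewrite /V /Q -mulmxA (mulmxA (mpinv S)) /S mpinv_gram_mpinv.
by rewrite sum_trace_delta mulmxA -(mulmxA _ V Q) VQ -mulmxA fro2E.
Qed.

End divergence_in_columns.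

Section stein_columns.
Context d (Omega : measurableType d) (R : realType) (P : probability Omega R).
Context (p q : nat) (theta : 'M[R]_(p, q)) (Sigma : 'M[R]_p).
Variable X : Omega -> 'M[R]_(p, q).
Hypothesis mX : measurable_fun [set: Omega] X.
Hypothesis uS : Sigma \in unitmx.
Hypothesis Xnormal : normal_matrix_cols P theta Sigma X.

Definition score (x : 'M[R]_(p, q)) := invmx Sigma *m (x - theta).

Lemma score_L2 i j : L2 P (fun w => score (X w) i j).
Proof.
under eq_fun do rewrite mxE.
apply: L2_sum => k; apply: L2_cst_mul.
exact: (normal_cols_L2 mX uS Xnormal).
Qed.

Lemma fro2_score_integrable :
  P.-integrable setT (fun w => (fro2 (score (X w)))%:E).
Proof.
apply: integrable_sum_real => i; apply: integrable_sum_real => j.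
by apply: L2_sqr_integrable; exact: score_L2.
Qed.

Context (m : nat) (Z : 'M[R]_(m, p)) (eps : R) (eps_gt0 : 0 < eps).
Let S := gram Z.
Let Q := S *m mpinv S.
Let V := Z *m mpinv S.
Let F (x : 'M[R]_(p, q)) := fro2 (V *m x).
Let dF (x D : 'M[R]_(p, q)) : R := 2 * \tr ((V *m x)^T *m V *m D).
Let f i j (x : 'M[R]_(p, q)) : R := (F x + eps)^-1 * (Q *m x) i j.
Let f' i j (x D : 'M[R]_(p, q)) : R :=
  - (F x + eps) ^- 2 * dF x D * (Q *m x) i j + (F x + eps)^-1 * (Q *m D) i j.

Let F0 x : 0 <= F x. Proof. exact: fro2_ge0. Qed.
Let Fe0 x : 0 < F x + eps. Proof. by rewrite ltr_wpDl. Qed.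

Let derF x D : is_derive x D F (dF x D).
Proof. exact: is_derive_fro2_mul. Qed.

Let derf i j x D : is_derive x D (f i j) (f' i j x D).
Proof.
have h1 : is_derive x D (fun y => (F y + eps)^-1) (- (F x + eps) ^- 2 * dF x D).
  apply: (@is_derive_comp_real R _ (fun t => (t + eps)^-1) F) => //.
  have h : is_derive (F x) 1 (fun t => t + eps) (1 : R).
    have := is_deriveD (is_derive_id (F x) (1 : R)) (is_derive_cst eps (F x) (1 : R)).
    by rewrite addr0.
  apply: is_derive_eq; first by apply: is_deriveV; rewrite gt_eqF.
  by rewrite /GRing.scale/= mulr1.
have h2 : mxder (fun y : 'M[R]_(p, q) => Q *m y) x D (Q *m D).
  apply: (mxder_eq (mxder_mul (mxder_cst Q x D) (mxder_id x D))).
  by rewrite mul0mx add0r.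
have h3 := is_deriveM h1 (h2 i j : is_derive x D (fun y => (Q *m y) i j) _).
by apply: (is_derive_eq h3); rewrite /GRing.scale/= /f'; ring.
Qed.

Let Qx (x : 'M[R]_(p, q)) : Q *m x = Z^T *m (V *m x).
Proof. by rewrite /Q /V /S /gram !mulmxA. Qed.

(** A squared entry is at most |Z|^2 F by [Qx], and s <= 1 + s^2; the right side exceeds 1 + |Z|^2
    F. *)
Let Qx_bound x i j : `|(Q *m x) i j| <= (eps^-1 + fro2 Z) * (F x + eps).
Proof.
have h : (Q *m x) i j ^+ 2 <= fro2 Z * F x.
  rewrite (le_trans (sqr_entry_le_fro2 _ _ _))// Qx (le_trans (fro2_mul _ _))//.
  by rewrite fro2_tr.
have h2 : 1 + fro2 Z * F x <= (eps^-1 + fro2 Z) * (F x + eps).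
  have -> : (eps^-1 + fro2 Z) * (F x + eps) =
    eps^-1 * eps + fro2 Z * F x + (eps^-1 * F x + fro2 Z * eps) by ring.
  rewrite mulVf ?gt_eqF// lerDl addr_ge0// mulr_ge0// ?fro2_ge0// ?invr_ge0// ltW//.
apply: le_trans h2; rewrite -real_normK ?num_real// in h.
move: h (normr_ge0 ((Q *m x) i j)); set t := `|_| => h t0.
nra.
Qed.

Let f_bound i j x : `|f i j x| <= eps^-1 + fro2 Z.
Proof. by rewrite /f normrM [`|_^-1|]gtr0_norm ?invr_gt0// mulrC ler_pdivrMr. Qed.

Let inv_bound x : (F x + eps)^-1 <= eps^-1.
Proof. by rewrite lef_pV2 ?posrE// lerDr. Qed.

Let f'_bound i j D : exists C, forall x, `|f' i j x D| <= C.
Proof.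
pose c := `|(Q *m D) i j|.
exists ((1 + eps^-1 * fro2 (V *m D)) * (eps^-1 + fro2 Z) + eps^-1 * c) => x.
have e0 : 0 <= (F x + eps)^-1 by rewrite invr_ge0 ltW.
rewrite /f' (le_trans (ler_normD _ _))// lerD//; last first.
  by rewrite normrM (ger0_norm e0) ler_wpM2r.
have -> : - (F x + eps) ^- 2 * dF x D * (Q *m x) i j =
    - ((F x + eps)^-1 * dF x D) * f i j x.
  by rewrite /f expr2 invfM; ring.
rewrite normrM normrN ler_pM// normrM (ger0_norm e0).
have h : `|dF x D| <= F x + fro2 (V *m D).
  by rewrite /dF -mulmxA normrM ger0_norm// norm_mxtrace_mul_tr_le.
rewrite (le_trans (ler_wpM2l e0 h))// mulrDr lerD//.
  by rewrite mulrC ler_pdivrMr// mul1r lerDl ltW.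
by rewrite ler_wpM2r// fro2_ge0.
Qed.

Let sum_f' x : \sum_i \sum_j f' i j x (delta_mx i j) =
  (q * \rank S)%:R * (F x + eps)^-1 - 2 * F x * (F x + eps) ^- 2.
Proof.
have s1 : \sum_i \sum_j \tr ((V *m x)^T *m V *m delta_mx i j) * (Q *m x) i j = F x.
  exact: sum_dFstat_proj.
have s2 : \sum_(i < p) \sum_(j < q) (Q *m delta_mx i j) i j = (q * \rank S)%:R :> R.
  exact: sum_gram_proj_delta.
rewrite -s2 -{2}s1 !(mulr_suml, mulr_sumr) -sumrB; apply: eq_bigr => i _.
rewrite !(mulr_suml, mulr_sumr) -sumrB; apply: eq_bigr => j _.
by rewrite /f' /dF; ring.
Qed.

Let sum_f x : \sum_i \sum_j score x i j * f i j x =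
  (F x + eps)^-1 * \tr ((Z *m score x)^T *m (V *m x)).
Proof.
transitivity ((F x + eps)^-1 * \tr ((score x)^T *m (Q *m x))).
  rewrite mxtrace_mul_tr mulr_sumr; apply: eq_bigr => i _.
  by rewrite mulr_sumr; apply: eq_bigr => j _; rewrite /f; ring.
by rewrite Qx; congr (_ * \tr _); move: (score x) => y; rewrite trmx_mul !mulmxA.
Qed.

Let mF : measurable_fun [set: 'M[R]_(p, q)] F.
Proof. by apply: measurable_fro2; exact: measurable_mulmx. Qed.

Let minv : measurable_fun [set: 'M[R]_(p, q)] (fun x => (F x + eps)^-1).
Proof. by apply: measurable_inv_real; exact: measurable_funD. Qed.

Let mf i j : measurable_fun [set: 'M[R]_(p, q)] (f i j).
Proof.
apply: measurable_funM => //; apply: (measurableT_comp (measurable_mx_coord i j)).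
exact: measurable_mulmx.
Qed.

Let stein_div :
  (\int[P]_w ((q * \rank S)%:R * (F (X w) + eps)^-1
      - 2 * F (X w) * (F (X w) + eps) ^- 2)%:E =
   \int[P]_w ((F (X w) + eps)^-1 * \tr ((Z *m score (X w))^T *m (V *m X w)))%:E)%E.
Proof.
under eq_integral do rewrite -sum_f'.
under [RHS]eq_integral do rewrite -sum_f.
have i1 i j : P.-integrable setT (fun w => (f' i j (X w) (delta_mx i j))%:E).
  have [c bc] := f'_bound i j (delta_mx i j).
  apply: (@bounded_integrable _ _ _ P _ c) => //.
  exact: (measurableT_comp (measurable_derivative (mf i j) (fun x => derf i j x _)) mX).
have i2 i j : P.-integrable setT (fun w => (score (X w) i j * f i j (X w))%:E).
  apply: L2_integrable; under eq_fun do rewrite mulrC.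
  apply: (@L2_bounded_mul _ _ _ _ _ _ (eps^-1 + fro2 Z)) => //.
    exact: score_L2.
  exact: (measurableT_comp (mf i j)).
apply: eq_integral_sum_real => [i|i|i].
- by apply: integrable_sum_real => j.
- by apply: integrable_sum_real => j.
apply: eq_integral_sum_real => // j.
apply: (normal_cols_stein mX uS Xnormal (f := f i j) (f' := f' i j)
  (K := eps^-1 + fro2 Z)) => //.
- move=> x D1 D2; rewrite /f' /dF !mulmxDr mxtraceD [(_ + _ : 'M[R]_(p, q)) i j]mxE.
  ring.
- move=> x c D; rewrite /f' /dF -!scalemxAr mxtraceZ [(_ *: _ : 'M[R]_(p, q)) i j]mxE.
  ring.
Qed.

(** With u = 1 / (F + eps), the inequalities q rank S >= 3 and F u <= 1 make the divergence at least
    3 u - 2 u = u. The other side is at most half of |Z|^2 |score|^2 plus half of u^2 F <= u. The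
    term E u / 2 is absorbed on the left, which is legitimate because [eps] makes E u finite. *)
Lemma inv_Fstat_shift_bound : (2 < q * \rank S)%N ->
  (\int[P]_w ((Fstat (X w) S + eps)^-1)%:E <=
   (fro2 Z)%:E * \int[P]_w (fro2 (score (X w)))%:E)%E.
Proof.
move=> rk; under eq_integral do rewrite Fstat_gram -/S -/V -/(F _).
have ih : P.-integrable setT (fun w => ((F (X w) + eps)^-1)%:E).
  apply: (@bounded_integrable _ _ _ P (fun w => (F (X w) + eps)^-1) eps^-1).
    exact: (measurableT_comp minv mX).
  by move=> w; rewrite ger0_norm ?invr_ge0// ltW.
have ia : P.-integrable setT (fun w => (fro2 Z * fro2 (score (X w)))%:E).
  by under eq_fun do rewrite EFinM; exact: integrableZl fro2_score_integrable.
have i2 : P.-integrable setT (fun w =>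
    (2^-1 * (fro2 Z * fro2 (score (X w))) + 2^-1 * (F (X w) + eps)^-1)%:E).
  under eq_fun do rewrite EFinD !EFinM -EFinM.
  by apply: integrableD => //; apply: integrableZl.
have il : P.-integrable setT (fun w =>
    ((q * \rank S)%:R * (F (X w) + eps)^-1 - 2 * F (X w) * (F (X w) + eps) ^- 2)%:E).
  apply: (@bounded_integrable _ _ _ P (fun w => (q * \rank S)%:R * (F (X w) + eps)^-1
    - 2 * F (X w) * (F (X w) + eps) ^- 2) (((q * \rank S)%:R + 2) * eps^-1)).
    apply: (measurableT_comp (f := fun x => (q * \rank S)%:R * (F x + eps)^-1
      - 2 * F x * (F x + eps) ^- 2)) => //.
    apply: measurable_funB; apply: measurable_funM => //.
      exact: measurable_funM.
    by under eq_fun do rewrite -exprVn; exact: measurable_funX.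
  move=> w; have := inv_bound (X w); have := Fe0 (X w); have := F0 (X w).
  set t := F (X w) => t0 te; set u := (t + eps)^-1 => ue.
  have u0 : 0 <= u by rewrite invr_ge0 ltW.
  have tu : t * u <= 1 by rewrite ler_pdivrMr// mul1r lerDl ltW.
  have tu0 : 0 <= t * u by rewrite mulr_ge0.
  have -> : 2 * t * (t + eps) ^- 2 = 2 * (t * u) * u by rewrite -exprVn -/u; ring.
  rewrite (le_trans (ler_normB _ _))// !normrM mulrDl !(ger0_norm u0) !ger0_norm//.
  apply: lerD; first by rewrite ler_wpM2l.
  by rewrite ler_pM//; lra.
have ir : P.-integrable setT (fun w =>
    ((F (X w) + eps)^-1 * \tr ((Z *m score (X w))^T *m (V *m X w)))%:E).
  under eq_fun do rewrite -sum_f.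
  apply: integrable_sum_real => i; apply: integrable_sum_real => j.
  apply: L2_integrable; under eq_fun do rewrite mulrC.
  apply: (@L2_bounded_mul _ _ _ _ _ _ (eps^-1 + fro2 Z)) => //.
    exact: score_L2.
  exact: (measurableT_comp (mf i j)).
have h1 : (\int[P]_w ((F (X w) + eps)^-1)%:E <=
    \int[P]_w (2^-1 * (fro2 Z * fro2 (score (X w))) + 2^-1 * (F (X w) + eps)^-1)%:E)%E.
  apply: (@le_trans _ _ (\int[P]_w ((q * \rank S)%:R * (F (X w) + eps)^-1
      - 2 * F (X w) * (F (X w) + eps) ^- 2)%:E)%E).
    apply: le_integral => // w _; rewrite lee_fin.
    have := Fe0 (X w); have := F0 (X w).
    set t := F (X w) => t0 te; set u := (t + eps)^-1.
    have u0 : 0 <= u by rewrite invr_ge0 ltW.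
    have tu : t * u <= 1 by rewrite ler_pdivrMr// mul1r lerDl ltW.
    have -> : 2 * t * (t + eps) ^- 2 = 2 * (t * u) * u by rewrite -exprVn -/u; ring.
    have r3 : 3 <= (q * \rank S)%:R :> R by rewrite ler_nat.
    nra.
  rewrite stein_div; apply: le_integral => // w _; rewrite lee_fin.
  have := Fe0 (X w); have := F0 (X w); have := erefl (F (X w)).
  rewrite {1}/F; set t := F (X w) => tE t0 te; set u := (t + eps)^-1.
  have u0 : 0 <= u by rewrite invr_ge0 ltW.
  have tu : t * u <= 1 by rewrite ler_pdivrMr// mul1r lerDl ltW.
  have := norm_mxtrace_mul_tr_le (Z *m score (X w)) (u *: (V *m X w)).
  rewrite -scalemxAr mxtraceZ.
  have -> : fro2 (u *: (V *m X w)) = u * (t * u).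
    by rewrite fro2Z tE; ring.
  have := fro2_mul Z (score (X w)).
  have : u * (t * u) <= u by rewrite -[leRHS]mulr1 ler_wpM2l.
  move=> a1 a2; have := ler_norm (u * \tr ((Z *m score (X w))^T *m (V *m X w))).
  lra.
have e2 : (\int[P]_w (2^-1 * (fro2 Z * fro2 (score (X w))) + 2^-1 * (F (X w) + eps)^-1)%:E
   = 2^-1%:E * ((fro2 Z)%:E * \int[P]_w (fro2 (score (X w)))%:E) +
     2^-1%:E * \int[P]_w ((F (X w) + eps)^-1)%:E)%E.
  under eq_integral do rewrite EFinD.
  rewrite integralD//; first last.
  - by under eq_fun do rewrite EFinM; exact: integrableZl.
  - by under eq_fun do rewrite EFinM; exact: integrableZl.
  under eq_integral do rewrite EFinM.
  rewrite integralZl//.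
  under eq_integral do rewrite EFinM.
  rewrite integralZl//; last exact: fro2_score_integrable.
  congr (_ + _)%E; under eq_integral do rewrite EFinM.
  by rewrite integralZl.
rewrite e2 in h1.
have f1 := integrable_fin_num measurableT ih.
have f2 := integrable_fin_num measurableT fro2_score_integrable.
move: h1; rewrite -(fineK f1) -(fineK f2) -!EFinM -EFinD !lee_fin.
lra.
Qed.

End stein_columns.

Section monotone_limits.
Context d (T : measurableType d) (R : realType) (mu : {measure set T -> \bar R}).

Lemma cvg_integral_monotone (f : nat -> T -> R) (g : T -> R) :
  (forall n, measurable_fun [set: T] (f n)) -> (forall n x, 0 <= f n x) ->
  (forall x, {homo f^~ x : m n / (m <= n)%N >-> m <= n}) ->
  (forall x, f n x @[n --> \oo] --> g x) ->
  (\int[mu]_x (f n x)%:E @[n --> \oo] --> \int[mu]_x (g x)%:E)%E.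
Proof.
move=> mf f0 nd fg.
have -> : (\int[mu]_x (g x)%:E = \int[mu]_x limn (fun n => (f n x)%:E))%E.
  apply: eq_integral => x _; apply/esym/cvg_lim => //.
  by apply: cvg_EFin; [exact: nearW|exact: fg].
apply: (@cvg_monotone_convergence _ _ _ mu _ measurableT (fun n x => (f n x)%:E)) => //.
- by move=> n; exact/measurable_EFinP.
- by move=> n x _; rewrite lee_fin.
- by move=> x _ m n mn; rewrite lee_fin; exact: nd.
Qed.

(** The integrands increase to 1 / f where f > 0 and to infinity where f = 0; as the limit has a
    finite integral, the second case is negligible. *)
Lemma integrable_inv_of_bounded (f : T -> R) (K : R) :
  measurable_fun [set: T] f -> (forall x, 0 <= f x) ->
  (forall n, \int[mu]_x ((f x + n.+1%:R^-1)^-1)%:E <= K%:E)%E ->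
  {ae mu, forall x, 0 < f x} /\ mu.-integrable [set: T] (fun x => ((f x)^-1)%:E).
Proof.
move=> mf f0 fK.
have i0 n : 0 < n.+1%:R^-1 :> R by rewrite invr_gt0.
have fe0 n x : 0 < f x + n.+1%:R^-1 by rewrite ltr_wpDl.
pose g n x := ((f x + n.+1%:R^-1)^-1)%:E.
pose h x := limn (g^~ x).
have mg n : measurable_fun [set: T] (g n).
  apply/measurable_EFinP; apply: measurable_inv_real.
  exact: measurable_funD.
have g0 n x : (0 <= g n x)%E by rewrite lee_fin invr_ge0 ltW.
have gnd x : nondecreasing_seq (g^~ x).
  move=> k l kl; rewrite lee_fin lef_pV2 ?posrE// lerD2l lef_pV2 ?posrE//.
  by rewrite ler_nat ltnS.
have gcvg x : cvgn (g^~ x) by exact: ereal_nondecreasing_is_cvgn.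
have gh n x : (g n x <= h x)%E.
  apply: lime_ge => //; exists n => // l /= nl; exact: gnd.
have L := @cvg_monotone_convergence _ _ _ mu _ measurableT _ mg
  (fun n x _ => g0 n x) (fun x _ => gnd x).
have hK : (\int[mu]_x h x <= K%:E)%E.
  rewrite -(cvg_lim (@ereal_hausdorff R) L); apply: lime_le.
    by apply/cvg_ex; eexists; exact: L.
  by apply: nearW => n; exact: fK.
have h0 x : (0 <= h x)%E by exact: le_trans (gh 0%N x).
have mh : measurable_fun [set: T] h.
  by apply: (emeasurable_fun_cvg g) => // x _; exact: gcvg.
have ih : mu.-integrable [set: T] h.
  apply/integrableP; split=> //.
  under eq_integral do rewrite gee0_abs//.
  by rewrite (le_lt_trans hK)// ltry.
split.
  have := integrable_ae measurableT ih.
  apply: filterS => x /(_ I) hx; rewrite lt_neqAle f0 andbT eq_sym.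
  apply/eqP => fx0; move: hx (gh^~ x); rewrite /g fx0.
  case: (h x) => [r _ H|//|//].
  have := H (Num.truncn r); rewrite add0r invrK lee_fin.
  by rewrite leNgt truncnS_gt.
apply: (@le_integrable _ _ _ mu _ measurableT _ h) => //.
  by apply/measurable_EFinP; exact: measurable_inv_real.
move=> x _; rewrite !gee0_abs ?lee_fin ?invr_ge0//.
(* Since 0^-1 = 0 by convention, the domination by [h] also holds where [f] vanishes. *)
have [->|fx0] := eqVneq (f x) 0; first by rewrite invr0.
have fx : 0 < f x by rewrite lt_neqAle eq_sym fx0 f0.
suff -> : h x = ((f x)^-1)%:E by [].
apply/cvg_lim => //; apply: cvg_EFin; first exact: nearW.
apply: cvgV => //; rewrite -[X in _ --> X]addr0.
by apply: cvgD; [exact: cvg_cst|exact: cvg_harmonic].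
Qed.

End monotone_limits.

Section positive_statistic.
Context d (Omega : measurableType d) (R : realType) (P : probability Omega R).
Context (m p q : nat) (theta : 'M[R]_(p, q)) (Sigma Gamma : 'M[R]_p).
Variables (X : Omega -> 'M[R]_(p, q)) (Y : Omega -> 'M[R]_(m, p)).
Hypothesis mX : measurable_fun [set: Omega] X.
Hypothesis mY : measurable_fun [set: Omega] Y.
Hypothesis uS : Sigma \in unitmx.
Hypothesis uG : Gamma \in unitmx.
Hypothesis Xnormal : normal_matrix_cols P theta Sigma X.
Hypothesis Ynormal : normal_matrix_rows P Gamma Y.
Hypothesis XS_indep : independent P X (fun w => gram (Y w)).
Hypothesis rank_gt2 : P [set w | (2 < q * \rank (gram (Y w)))%N] = 1%E.

Let mS : measurable_fun [set: Omega] (fun w => gram (Y w)).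
Proof. exact: measurable_gram. Qed.

(** The event is measurable because the rank is the trace of S S^+, a measurable function; its
    complement then has probability 0. *)
Lemma ae_rank_gt2 : {ae P, forall w, (2 < q * \rank (gram (Y w)))%N}.
Proof.
pose f w := q%:R * \tr (gram (Y w) *m mpinv (gram (Y w))).
have mf : measurable_fun [set: Omega] f.
  apply: measurable_funM => //; apply: measurable_mxtrace; apply: measurable_mulmx => //.
  exact: measurable_mpinv.
have E : [set w | (2 < q * \rank (gram (Y w)))%N] = f @^-1` `]2, +oo[.
  apply/seteqP; split=> w; rewrite /f /= in_itv/= andbT mxtrace_mul_mpinv -natrM ltr_nat//.
have mE : measurable [set w | (2 < q * \rank (gram (Y w)))%N].
  by rewrite E -[_ @^-1` _]setTI; apply: mf.
exists (~` [set w | (2 < q * \rank (gram (Y w)))%N]); split => //.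
  exact: measurableC.
by have /= := probability_setC P mE; rewrite rank_gt2 subee// => ->.
Qed.

Lemma inv_Fstat_integrable :
  {ae P, forall w, 0 < Fstat (X w) (gram (Y w))} /\
  P.-integrable setT (fun w => ((Fstat (X w) (gram (Y w)))^-1)%:E).
Proof.
pose k := fine (\int[P]_w (fro2 (score theta Sigma (X w)))%:E)%E.
have kE : (\int[P]_w (fro2 (score theta Sigma (X w)))%:E)%E = k%:E.
  rewrite /k fineK//; apply: (integrable_fin_num measurableT).
  exact: (fro2_score_integrable mX uS Xnormal).
have iY := fro2_integrable mY uG Ynormal.
pose l := fine (\int[P]_w (fro2 (Y w))%:E)%E.
have lE : (\int[P]_w (fro2 (Y w))%:E)%E = l%:E.
  by rewrite /l fineK//; exact: (integrable_fin_num measurableT).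
apply: (@integrable_inv_of_bounded _ _ _ P _ (l * k)).
- exact: measurable_Fstat.
- by move=> w; exact: Fstat_gram_ge0.
(* The absolute value makes [g] nonnegative at all pairs of matrices, as Tonelli's theorem asks; on
   Gram matrices it changes nothing. *)
move=> n; pose g (u : 'M[R]_(p, q) * 'M[R]_p) : \bar R :=
  (`|(Fstat u.1 u.2 + n.+1%:R^-1)^-1|)%:E.
have i0 : 0 < n.+1%:R^-1 :> R by rewrite invr_gt0.
have mg : measurable_fun [set: 'M[R]_(p, q) * 'M[R]_p] g.
  apply/measurable_EFinP; apply: measurableT_comp => //; apply: measurable_inv_real.
  by apply: measurable_funD => //; apply: measurable_Fstat.
have gE (x : 'M[R]_(p, q)) w : g (x, gram (Y w)) =
    ((Fstat x (gram (Y w)) + n.+1%:R^-1)^-1)%:E.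
  by rewrite /g /= ger0_norm// invr_ge0 addr_ge0 ?Fstat_gram_ge0// ltW.
under eq_integral do rewrite -gE.
rewrite (@ge0_independent_integral2 _ _ _ _ _ _ _ _ _ _ mX mS XS_indep g mg)//.
rewrite mulrC EFinM -lE -integralZl//.
have -> : (\int[P]_x (k%:E * (fro2 (Y x))%:E) = \int[P]_x (k * fro2 (Y x))%:E)%E.
  by apply: eq_integral => x _; rewrite EFinM.
have k0 : 0 <= k by rewrite -lee_fin -kE integral_ge0// => w _; rewrite lee_fin fro2_ge0.
apply: ae_ge0_le_integral => //.
- by move=> w _; apply: integral_ge0 => w' _; rewrite lee_fin.
- by apply: (@measurable_inner_integral2 _ _ _ P _ _ _ _ _ _ mX mS g mg) => u; rewrite lee_fin.
- by move=> w _; rewrite lee_fin mulr_ge0// fro2_ge0.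
- apply/measurable_EFinP; apply: measurable_funM => //.
  exact: measurable_fro2.
apply: filterS ae_rank_gt2 => w rk _.
under eq_integral do rewrite gE.
have := inv_Fstat_shift_bound mX uS Xnormal i0 rk.
  by rewrite kE mulrC.
by move=> u; rewrite lee_fin.
Qed.

End positive_statistic.

(** * The identity for X and S jointly *)

Section smoothed_weight.
Context (R : realType) (r : R -> R) (c1 c2 e : R).
Hypothesis r_bounded : forall t, 0 <= r t <= c1.
Hypothesis r_derivable : forall t, derivable r t 1.
Hypothesis dr_bounded : forall t, `|r^`()%classic t| <= c2.
Hypothesis e_ge0 : 0 <= e.
Local Notation r' := (r^`()%classic).

(* At [e = 0] this is [r t ^+ 2 / t ^+ 2], equal to 0 at [t = 0]. *)
Definition weight (t : R) : R := r t ^+ 2 * (t ^+ 2 + e)^-1.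

Definition weight' (t : R) : R :=
  2 * r t * r' t * (t ^+ 2 + e)^-1 - 2 * r t ^+ 2 * t * (t ^+ 2 + e) ^- 2.

Lemma derivable1_is_derive (t : R) : is_derive t 1 r (r' t).
Proof. by rewrite derive1E; exact: derivableP. Qed.

Let c10 : 0 <= c1.
Proof. by have /andP[a b] := r_bounded 0; exact: le_trans b. Qed.

Let c20 : 0 <= c2. Proof. exact: le_trans (dr_bounded 0). Qed.

Let sqr_r t : r t ^+ 2 <= c1 ^+ 2.
Proof. by have /andP[a b] := r_bounded t; rewrite lerXn2r ?nnegrE. Qed.

Let mul_r t : `|r t * r' t| <= c1 * c2.
Proof.
have /andP[a b] := r_bounded t.
by rewrite normrM ler_pM// ger0_norm.
Qed.

Lemma weight_ge0 t : 0 <= weight t.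
Proof. by rewrite mulr_ge0 ?sqr_ge0// invr_ge0 addr_ge0// sqr_ge0. Qed.

Lemma is_derive_weight (t : R) : 0 < t ^+ 2 + e -> is_derive t 1 weight (weight' t).
Proof.
move=> te; have dr := derivable1_is_derive t.
have h1 : is_derive t 1 (fun s : R => s ^+ 2 + e) (2 * t).
  have -> : (fun s : R => s ^+ 2 + e) = (fun s : R => s * s + e).
    by apply/funext => s; rewrite expr2.
  by apply: is_derive_eq; rewrite /GRing.scale/=; ring.
have h2 : is_derive t 1 (fun s : R => (s ^+ 2 + e)^-1) (- (t ^+ 2 + e) ^- 2 * (2 * t)).
  by apply: is_derive_eq; first by apply: is_deriveV; rewrite gt_eqF.
have h3 : is_derive t 1 (fun s : R => r s ^+ 2) (2 * r t * r' t).
  have -> : (fun s : R => r s ^+ 2) = (fun s : R => r s * r s).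
    by apply/funext => s; rewrite expr2.
  by apply: is_derive_eq; rewrite /GRing.scale/=; ring.
have h4 := is_deriveM h3 h2.
by apply: (is_derive_eq h4); rewrite /GRing.scale/= /weight'; ring.
Qed.

Lemma measurable_r : measurable_fun [set: R] r.
Proof.
apply: continuous_measurable_fun => t; apply: differentiable_continuous.
exact/derivable1_diffP.
Qed.

Lemma measurable_r' : measurable_fun [set: R] r'.
Proof.
apply: (@measurable_fun_cvg _ R R _
  (fun n t => n.+1%:R * (r (t + n.+1%:R^-1) - r t))).
  move=> n; apply: measurable_funM => //; apply: measurable_funB; last exact: measurable_r.
  by apply: (measurableT_comp measurable_r); exact: measurable_funD.
by move=> t _; exact: cvg_harmonic_quotient (derivable1_is_derive t).
Qed.

Let minv : measurable_fun [set: R] (fun t => (t ^+ 2 + e)^-1).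
Proof. by apply: measurable_inv_real; exact: measurable_funD. Qed.

Lemma measurable_weight : measurable_fun [set: R] weight.
Proof. by apply: measurable_funM => //; apply: measurable_funX; exact: measurable_r. Qed.

Lemma measurable_weight' : measurable_fun [set: R] weight'.
Proof.
have mr := measurable_r; have mr' := measurable_r'.
apply: measurable_funB; apply: measurable_funM => //.
- by apply: measurable_funM => //; exact: measurable_funM.
- apply: measurable_funM => //; apply: measurable_funM => //; exact: measurable_funX.
by under eq_fun do rewrite -exprVn; exact: measurable_funX.
Qed.

(** Uniform in [e], unlike [weight_bounds]; the price is the factor 1 / t, covered by
    [inv_Fstat_integrable]. *)
Lemma mul_weight_bound (t : R) : 0 < t -> `|t * weight t| <= c1 ^+ 2 * t^-1.
Proof.
move=> t0; rewrite ger0_norm; last by rewrite mulr_ge0 ?weight_ge0// ltW.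
have t2 : 0 < t ^+ 2 by rewrite exprn_gt0.
rewrite /weight mulrCA ler_pM//; first exact: sqr_ge0.
  by rewrite mulr_ge0 ?invr_ge0 ?addr_ge0 ?(ltW t2)// ltW.
rewrite ler_pdivrMr ?ltr_pwDl//; rewrite mulrDr expr2 mulrA mulVf ?gt_eqF// mul1r.
by rewrite lerDl mulr_ge0// invr_ge0 ltW.
Qed.

Lemma sqr_weight'_bound (t : R) : 0 < t ->
  `|t ^+ 2 * weight' t| <= 2 * (c1 * c2) + 2 * c1 ^+ 2 * t^-1.
Proof.
move=> t0; have t2 : 0 < t ^+ 2 by rewrite exprn_gt0.
pose u := (t ^+ 2 + e)^-1.
have u0 : 0 <= u by rewrite invr_ge0 addr_ge0// ltW.
have tu : t ^+ 2 * u <= 1 by rewrite ler_pdivrMr ?ltr_pwDl// mul1r lerDl.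
have tu0 : 0 <= t ^+ 2 * u by rewrite mulr_ge0// ltW.
have w := mul_weight_bound t0; rewrite /weight -/u in w.
have -> : t ^+ 2 * weight' t =
    2 * ((r t * r' t) * (t ^+ 2 * u)) - 2 * ((t * (r t ^+ 2 * u)) * (t ^+ 2 * u)).
  by rewrite /weight' -exprVn -/u; ring.
have b1 : `|(r t * r' t) * (t ^+ 2 * u)| <= c1 * c2.
  by rewrite normrM (ger0_norm tu0) -[leRHS]mulr1 ler_pM.
have b2 : `|(t * (r t ^+ 2 * u)) * (t ^+ 2 * u)| <= c1 ^+ 2 * t^-1.
  by rewrite normrM (ger0_norm tu0) -[leRHS]mulr1 ler_pM.
by move: b1 b2; rewrite !ler_norml; lra.
Qed.

(** For fixed [e], the quantities u, t u and t^2 u with u = 1 / (t^2 + e) are all at most k = 1 / e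
    + 1 when t >= 0, and they control the four expressions. *)
Lemma weight_bounds : 0 < e -> exists K,
  [/\ forall t : R, 0 <= t -> `|weight t| <= K,
      forall t : R, 0 <= t -> `|t * weight t| <= K,
      forall t : R, 0 <= t -> `|weight' t| <= K &
      forall t : R, 0 <= t -> `|t ^+ 2 * weight' t| <= K].
Proof.
move=> e0; pose k := e^-1 + 1.
have k1 : 1 <= k by rewrite lerDr invr_ge0.
have u0 (t : R) : 0 <= (t ^+ 2 + e)^-1 by rewrite invr_ge0 addr_ge0// sqr_ge0.
have te (t : R) : 0 < t ^+ 2 + e by rewrite ltr_wpDl// sqr_ge0.
have uk (t : R) : (t ^+ 2 + e)^-1 <= k.
  rewrite (@le_trans _ _ e^-1)//; last by rewrite lerDl.
  by rewrite lef_pV2 ?posrE// lerDr sqr_ge0.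
have tu (t : R) : t ^+ 2 * (t ^+ 2 + e)^-1 <= 1.
  by rewrite ler_pdivrMr// mul1r lerDl.
have tk (t : R) : 0 <= t -> t * (t ^+ 2 + e)^-1 <= k.
  move=> t0; rewrite ler_pdivrMr// /k.
  have -> : (e^-1 + 1) * (t ^+ 2 + e) = e^-1 * t ^+ 2 + e^-1 * e + t ^+ 2 + e by ring.
  rewrite mulVf ?gt_eqF//.
  have : 0 <= e^-1 * t ^+ 2 by rewrite mulr_ge0 ?invr_ge0 ?sqr_ge0.
  have := sqr_ge0 (t - 1); nra.
exists (c1 ^+ 2 * k + (2 * (c1 * c2) * k + 2 * c1 ^+ 2 * (k * k))).
have q0 : 0 <= c1 ^+ 2 by exact: sqr_ge0.
have k0 : 0 <= k by exact: le_trans k1.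
have A0 : 0 <= c1 ^+ 2 * k by rewrite mulr_ge0.
have B0 : 0 <= 2 * (c1 * c2) * k by rewrite !mulr_ge0.
have C0 : 0 <= 2 * c1 ^+ 2 * (k * k) by rewrite !mulr_ge0.
(* With a = 1 and a = t^2 this gives the last two bounds at once. *)
have w' (a t : R) : 0 <= t -> 0 <= a -> a * (t ^+ 2 + e)^-1 <= k ->
    `|a * weight' t| <= 2 * (c1 * c2) * k + 2 * c1 ^+ 2 * (k * k).
  move=> t0 a0 ak; have ta := tk _ t0; move: ak ta (u0 t).
  rewrite /weight' -exprVn; set u := (t ^+ 2 + e)^-1 => ak ta v0.
  have -> : a * (2 * r t * r' t * u - 2 * r t ^+ 2 * t * u ^+ 2) =
    2 * ((r t * r' t) * (a * u)) - 2 * (r t ^+ 2 * ((a * u) * (t * u))) by ring.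
  have au0 : 0 <= a * u by rewrite mulr_ge0.
  have tu0 : 0 <= t * u by rewrite mulr_ge0.
  have b1 : `|(r t * r' t) * (a * u)| <= c1 * c2 * k.
    by rewrite normrM (ger0_norm au0) ler_pM.
  have b2 : `|r t ^+ 2 * ((a * u) * (t * u))| <= c1 ^+ 2 * (k * k).
    rewrite normrM (ger0_norm (sqr_ge0 _)) (ger0_norm (mulr_ge0 au0 tu0)).
    by rewrite ler_pM ?sqr_ge0 ?mulr_ge0// ler_pM.
  by move: b1 b2; rewrite !ler_norml; lra.
split=> t t0.
- rewrite ger0_norm ?weight_ge0// (@le_trans _ _ (c1 ^+ 2 * k))//; last by lra.
  by rewrite ler_pM ?sqr_ge0.
- rewrite ger0_norm; last by rewrite mulr_ge0 ?weight_ge0.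
  rewrite /weight mulrCA.
  rewrite (@le_trans _ _ (c1 ^+ 2 * k))//; last by lra.
  by rewrite ler_pM ?sqr_ge0// ?mulr_ge0// tk.
- have := w' 1 t t0 ler01; rewrite !mul1r => /(_ (uk t)); lra.
have := w' (t ^+ 2) t t0 (sqr_ge0 t) (le_trans (tu t) k1); lra.
Qed.

End smoothed_weight.

Section joint_identity.
Context d (Omega : measurableType d) (R : realType) (P : probability Omega R).
Context (m p q : nat) (theta : 'M[R]_(p, q)) (Sigma Gamma L : 'M[R]_p).
Variables (X : Omega -> 'M[R]_(p, q)) (Y : Omega -> 'M[R]_(m, p)).
Hypothesis mX : measurable_fun [set: Omega] X.
Hypothesis mY : measurable_fun [set: Omega] Y.
Hypothesis uS : Sigma \in unitmx.
Hypothesis uG : Gamma \in unitmx.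
Hypothesis invG : invmx Gamma = L^T *m L.
Hypothesis Xnormal : normal_matrix_cols P theta Sigma X.
Hypothesis Ynormal : normal_matrix_rows P Gamma Y.
Hypothesis XS_indep : independent P X (fun w => gram (Y w)).
Hypothesis rank_gt2 : P [set w | (2 < q * \rank (gram (Y w)))%N] = 1%E.
Variables (r : R -> R) (c1 c2 : R).
Hypothesis r_bounded : forall t, 0 <= r t <= c1.
Hypothesis r_derivable : forall t, derivable r t 1.
Hypothesis dr_bounded : forall t, `|r^`()%classic t| <= c2.

Let S w := gram (Y w).
Let mS : measurable_fun [set: Omega] S. Proof. exact: measurable_gram. Qed.
Let F0 w : 0 <= Fstat (X w) (S w). Proof. exact: Fstat_gram_ge0. Qed.

(** The root [L] of the inverse covariance makes the quadratic form visibly nonnegative at every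
    [s], Gram matrix or not, as Tonelli's theorem and monotone convergence require. *)
Let quadE (x : 'M[R]_(p, q)) phi (s : 'M[R]_p) :
  gram_quad (invmx Gamma) x phi s = phi (Fstat x s) * fro2 (L *m (s *m mpinv s *m x)).
Proof.
rewrite /gram_quad; move: (s *m _ *m _) => v; congr (_ * _).
by rewrite invG fro2E trmx_mul !mulmxA.
Qed.

(** The divergence is bounded, so Fubini applies to it; the quadratic form is nonnegative and falls
    to Tonelli. For each value of [X] the inner identity is [gram_stein]. *)
Lemma joint_smoothed_identity (e : R) : 0 < e ->
  (\int[P]_w (gram_div m (X w) (weight r e) (weight' r e) (S w))%:E =
   \int[P]_w (gram_quad (invmx Gamma) (X w) (weight r e) (S w))%:E)%E.
Proof.
move=> e0; have e1 := ltW e0.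
have [K [b1 b2 b3 b4]] := weight_bounds r_bounded dr_bounded e1 e0.
have dw (t : R) : is_derive t 1 (weight r e) (weight' r e t).
  by apply: is_derive_weight => //; rewrite ltr_wpDl// sqr_ge0.
have mw := @measurable_weight _ _ e r_derivable.
have mw' := @measurable_weight' _ _ e r_derivable.
rewrite (@bounded_independent_integral _ _ _ P _ _ _ _ _ _ mX mS XS_indep
  (fun u => gram_div m u.1 (weight r e) (weight' r e) u.2)
  ((m%:R + 3 * p%:R + 3) * K)); first last.
- move=> w w'; apply: gram_div_bound.
    by apply: b2; exact: Fstat_gram_ge0.
  by apply: b4; exact: Fstat_gram_ge0.
- exact: (measurable_gram_div measurable_fst measurable_snd).
rewrite (@ge0_independent_integral _ _ _ P _ _ _ _ _ _ mX mS XS_indep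
  (fun u => (gram_quad (invmx Gamma) u.1 (weight r e) u.2)%:E)); first last.
- by move=> u; rewrite quadE lee_fin mulr_ge0 ?fro2_ge0 ?weight_ge0.
- apply/measurable_EFinP.
  exact: (measurable_gram_quad measurable_fst measurable_snd).
apply: eq_integral => w _.
exact: (gram_stein mY uG Ynormal (X w) dw b1 b2 b3 b4).
Qed.

Lemma joint_identity :
  (\int[P]_w (gram_div m (X w) (weight r 0) (weight' r 0) (S w))%:E =
   \int[P]_w (gram_quad (invmx Gamma) (X w) (weight r 0) (S w))%:E)%E.
Proof.
pose e n : R := n.+1%:R^-1.
have e0 n : 0 < e n by rewrite invr_gt0.
have ce : e n @[n --> \oo] --> (0 : R) by exact: cvg_harmonic.
have mw k := @measurable_weight _ _ k r_derivable.
have mw' k := @measurable_weight' _ _ k r_derivable.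
have [aeF iF] := inv_Fstat_integrable mX mY uS uG Xnormal Ynormal XS_indep rank_gt2.
have ci (t : R) : 0 < t -> (t ^+ 2 + e n)^-1 @[n --> \oo] --> (t ^+ 2 + 0)^-1.
  move=> t0; apply: cvgV; first by rewrite addr0 expf_neq0// gt_eqF.
  by apply: cvgD => //; exact: cvg_cst.
have cw (t : R) : 0 < t -> weight r (e n) t @[n --> \oo] --> weight r 0 t.
  by move=> t0; apply: cvgM; [exact: cvg_cst|exact: ci].
have cw' (t : R) : 0 < t -> weight' r (e n) t @[n --> \oo] --> weight' r 0 t.
  move=> t0; have c := ci t t0.
  apply: cvgB; apply: cvgM => //; [exact: cvg_cst|exact: cvg_cst|].
  under eq_cvg do rewrite -exprVn expr2.
  by rewrite -exprVn expr2; exact: cvgM.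
have H1 : (\int[P]_w (gram_div m (X w) (weight r (e n)) (weight' r (e n)) (S w))%:E
    @[n --> \oo] -->
    \int[P]_w (gram_div m (X w) (weight r 0) (weight' r 0) (S w))%:E)%E.
  pose b w := (m%:R + 3 * p%:R + 3) *
    (2 * (c1 * c2) + 2 * c1 ^+ 2 * (Fstat (X w) (S w))^-1).
  apply: (@cvg_integral_dominated _ _ _ P _ _ b).
  - by move=> n; exact: measurable_gram_div.
  - exact: measurable_gram_div.
  - apply: filterS aeF => w Fw; apply: cvgB.
      by apply: cvgM; [exact: cw|exact: cvg_cst].
    apply: cvgM; last exact: cvg_cst.
    by apply: cvgM; [exact: cvg_cst|exact: cw'].
  - have -> : EFin \o b = (fun w => (m%:R + 3 * p%:R + 3)%:E *
        ((2 * (c1 * c2))%:E + (2 * c1 ^+ 2)%:E * ((Fstat (X w) (S w))^-1)%:E))%E by [].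
    apply: integrableZl => //; apply: integrableD => //.
      exact: integrable_cst_probability.
    exact: integrableZl.
  apply: filterS aeF => w Fw n; apply: gram_div_bound; rewrite -/(S w).
    apply: (le_trans (mul_weight_bound r_bounded _ Fw)); first exact: ltW.
    have c12 : 0 <= c1 * c2.
      have /andP[a1 a2] := r_bounded 0.
      by rewrite mulr_ge0 ?(le_trans a1 a2)// (le_trans _ (dr_bounded 0)).
    have : 0 <= c1 ^+ 2 * (Fstat (X w) (S w))^-1.
      by rewrite mulr_ge0 ?sqr_ge0// invr_ge0 ltW.
    lra.
  by apply: (sqr_weight'_bound r_bounded dr_bounded _ Fw); exact: ltW.
have H2 : (\int[P]_w (gram_quad (invmx Gamma) (X w) (weight r (e n)) (S w))%:E
    @[n --> \oo] -->
    \int[P]_w (gram_quad (invmx Gamma) (X w) (weight r 0) (S w))%:E)%E.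
  apply: cvg_integral_monotone.
  - by move=> n; exact: measurable_gram_quad.
  - by move=> n w; rewrite quadE mulr_ge0 ?fro2_ge0 ?weight_ge0// ltW.
  - move=> w k l kl; rewrite !quadE ler_wpM2r ?fro2_ge0// ler_wpM2l ?sqr_ge0//.
    rewrite lef_pV2 ?posrE ?ltr_wpDl ?sqr_ge0// lerD2l lef_pV2 ?posrE//.
    by rewrite ler_nat ltnS.
  (* Where F = 0 one has Y S^+ X = 0, hence S S^+ X = 0, and the integrand is 0 for all n: the
     convergence holds at every point. *)
  move=> w; have [Fw|Fw] := eqVneq (Fstat (X w) (S w)) 0; last first.
    rewrite quadE; under eq_cvg do rewrite quadE.
    apply: cvgM; last exact: cvg_cst.
    by apply: cw; rewrite lt_neqAle eq_sym Fw F0.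
  have E : S w *m mpinv (S w) *m X w = 0.
    have := Fstat_gram (X w) (Y w); rewrite -/(S w) Fw => /esym/fro2_eq0 V0.
    by rewrite {1}/S /gram -!mulmxA (mulmxA (Y w)) V0 mulmx0.
  have z0 : fro2 (0 : 'M[R]_(p, q)) = 0 by rewrite fro2E mulmx0 mxtrace0.
  rewrite quadE E mulmx0 z0 mulr0.
  by under eq_cvg do rewrite quadE E mulmx0 z0 mulr0; exact: cvg_cst.
have [e1 e2] := (cvg_lim (@ereal_hausdorff R) H1, cvg_lim (@ereal_hausdorff R) H2).
rewrite -e1 -e2; apply: congr_lim; apply/funext => n.
exact: joint_smoothed_identity.
Qed.

End joint_identity.

(** * Pointwise divergences *)

(* The integral of a nonnegative function is a supremum over simple functions,
   so no measurability of [f] is required. *)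
Lemma ae_ge0_integral_lty d (T : measurableType d) (R : realType)
    (mu : {measure set T -> \bar R}) (f g : T -> R) :
  (forall x, 0 <= f x) -> mu.-integrable [set: T] (EFin \o g) ->
  {ae mu, forall x, f x <= g x} -> (\int[mu]_x (f x)%:E < +oo)%E.
Proof.
move=> f0 ig fg; have /integrableP[mg gy] := ig.
apply: le_lt_trans gy; rewrite ge0_integralTE; last by move=> x; rewrite lee_fin.
apply/ge_ereal_sup => /= _ [h /= hf <-]; rewrite -integralT_nnsfun.
apply: ae_ge0_le_integral => //.
- by move=> x _; rewrite lee_fin; exact: fun_ge0.
- exact/measurable_EFinP.
- by apply/measurable_EFinP; apply: measurableT_comp => //; exact/measurable_EFinP.
apply: filterS fg => x fgx _; rewrite (le_trans (hf x))//= lee_fin.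
exact: le_trans (ler_norm _).
Qed.

Lemma mxdiv_mxder (R : realType) m n (f : 'M[R]_(m, n) -> 'M[R]_(m, n)) Z
    (df : 'M[R]_(m, n) -> 'M[R]_(m, n)) :
  (forall D, mxder f Z D (df D)) ->
  mxdiv f Z = \sum_i \sum_j df (delta_mx i j) i j.
Proof.
move=> dfD; apply: eq_bigr => i _; apply: eq_bigr => j _.
by have := dfD (delta_mx i j) i j => h; rewrite derive_val.
Qed.

Section divergence_of_estimator.
Context (R : realType) (m p q : nat) (Z : 'M[R]_(m, p)) (x : 'M[R]_(p, q)).
Variables (r : R -> R) (c1 c2 : R).
Hypothesis r_bounded : forall t, 0 <= r t <= c1.
Hypothesis r_derivable : forall t, derivable r t 1.
Hypothesis dr_bounded : forall t, `|r^`()%classic t| <= c2.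
Local Notation r' := (r^`()%classic).
Let S := gram Z.
Let F := Fstat x S.

(** The linear factor S S^+ contributes q rank S. The gradient of F paired with S S^+ x gives 2 F,
    as F is quadratic in S S^+ x, and (r / t)' times 2 F is 2 (r' - r / F). *)
Lemma mxdiv_gfun : 0 < F -> mxdiv (fun y : 'M[R]_(p, q) => gfun r y S) x =
  (q * \rank S)%:R * (r F / F) + 2 * (r' F - r F / F).
Proof.
move=> F0; pose V := Z *m mpinv S; pose Q := S *m mpinv S.
have FE (y : 'M[R]_(p, q)) : Fstat y S = fro2 (V *m y) by exact: Fstat_gram.
pose dk (D : 'M[R]_(p, q)) : R :=
  (r' F * F^-1 - r F * F ^- 2) * (2 * \tr ((V *m x)^T *m V *m D)).
have dfD D : mxder (fun y : 'M[R]_(p, q) => gfun r y S) x D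
    (dk D *: (Q *m x) + (r F / F) *: (Q *m D)).
  rewrite /gfun; under eq_fun do rewrite FE.
  have -> : r F / F = r (fro2 (V *m x)) / fro2 (V *m x) by rewrite /F FE.
  apply: mxder_scale.
    apply: (@is_derive_comp_real R _ (fun t => r t / t) (fun y => fro2 (V *m y))).
      rewrite -FE -/F; have dr := derivable1_is_derive r_derivable F.
      have dV : is_derive F 1 (fun t : R => t^-1) (- F ^- 2).
        apply: is_derive_eq; first by apply: is_deriveV; rewrite gt_eqF.
        by rewrite /GRing.scale/= mulr1.
      have h := is_deriveM dr dV.
      by apply: (is_derive_eq h); rewrite /GRing.scale/=; ring.
    exact: is_derive_fro2_mul.
  apply: (mxder_eq (mxder_mul (mxder_cst Q x D) (mxder_id x D))).
  by rewrite mul0mx add0r.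
rewrite (mxdiv_mxder dfD).
have s1 : \sum_i \sum_j \tr ((V *m x)^T *m V *m delta_mx i j) * (Q *m x) i j = F.
  by rewrite sum_dFstat_proj /F FE.
have s2 : \sum_(i < p) \sum_(j < q) (Q *m delta_mx i j) i j = (q * \rank S)%:R :> R.
  exact: sum_gram_proj_delta.
transitivity ((q * \rank S)%:R * (r F / F) + 2 * (r' F * F^-1 - r F * F ^- 2) * F);
  last by field; rewrite gt_eqF.
rewrite -s2 -[X in _ + _ * X]s1 !(mulr_suml, mulr_sumr) -big_split; apply: eq_bigr => i _.
rewrite /= !(mulr_suml, mulr_sumr) -big_split; apply: eq_bigr => j _.
rewrite /= mxE [(_ *: _ : 'M[R]_(p, q)) i j]mxE [X in _ + X]mxE /dk; ring.
Qed.

Lemma mxdiv_gfun_bound : 0 < F ->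
  `|mxdiv (fun y : 'M[R]_(p, q) => gfun r y S) x| <=
    ((q * p)%:R + 2) * c1 * F^-1 + 2 * c2.
Proof.
move=> F0; rewrite mxdiv_gfun//.
have /andP[r0 r1] := r_bounded F.
have i0 : 0 <= F^-1 by rewrite invr_ge0 ltW.
have b0 : 0 <= r F / F by rewrite mulr_ge0.
have b1 : r F / F <= c1 * F^-1 by rewrite ler_wpM2r.
have b2 : (q * \rank S)%:R * (r F / F) <= (q * p)%:R * (c1 * F^-1).
  by rewrite ler_pM// ler_nat leq_mul// rank_leq_row.
have b3 : 0 <= (q * \rank S)%:R * (r F / F) by rewrite mulr_ge0.
have := dr_bounded F; rewrite !ler_norml => /andP[b4 b5].
have -> : ((q * p)%:R + 2) * c1 * F^-1 = (q * p)%:R * (c1 * F^-1) + 2 * (c1 * F^-1).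
  by ring.
by apply/andP; split; lra.
Qed.

End divergence_of_estimator.

(** * The derivative of Y S^+ at full rank *)

Definition full_rank (R : realType) m p (Z : 'M[R]_(m, p)) : bool :=
  if (p <= m)%N then gram Z \in unitmx else Z *m Z^T \in unitmx.

Section pseudo_root.
Context {R : realType} (m p : nat).
Implicit Types Z D : 'M[R]_(m, p).

Definition pseudo_root Z : 'M[R]_(m, p) := Z *m mpinv (gram Z).

(* The first term vanishes when [Z *m Z^T] is invertible, the second one when
   [gram Z] is; outside of these two cases [pseudo_root] is discontinuous. *)
Definition pseudo_root' Z D : 'M[R]_(m, p) :=
  let U := pseudo_root Z in
  (1%:M - U *m Z^T) *m D *m (U^T *m U) + U *m U^T *m D *m (1%:M - Z^T *m U)
  - U *m D^T *m U.

(** Agreement at [Z] is a separate premise because [0^'] excludes h = 0. *)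
Lemma mxder_near_eq (f g : 'M[R]_(m, p) -> 'M[R]_(m, p)) Z D df :
  (\forall h \near 0^', f (h *: D + Z) = g (h *: D + Z)) -> f Z = g Z ->
  mxder g Z D df -> mxder f Z D df.
Proof.
move=> fg fgZ /mxderP dg; apply/mxderP; apply: mxcvg_near_eq dg.
by apply: filterS fg => h ->; rewrite fgZ.
Qed.

Lemma pseudo_root_gram_unit Z : gram Z \in unitmx ->
  pseudo_root Z = Z *m invmx (gram Z).
Proof.
move=> uS; congr (_ *m _).
have := gram_mpinv_gram Z; set B := mpinv _ => h.
rewrite -[LHS](mulKmx uS) -[X in invmx _ *m X](mulmxK uS) h mulmxV//.
by rewrite mulmx1.
Qed.

Lemma pseudo_root_tr_unit Z : Z *m Z^T \in unitmx ->
  pseudo_root Z = invmx (Z *m Z^T) *m Z.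
Proof.
move=> uK; rewrite -[LHS](mulKmx uK); congr (_ *m _).
by rewrite -[RHS](mul_gram_proj Z) /pseudo_root /gram !mulmxA.
Qed.

(** Invertibility being an open condition, [pseudo_root] coincides near [Z] on the line with Y S^-1
    or (Y Y^T)^-1 Y, to which [mxder_invmx] applies. *)
Lemma mxder_pseudo_root Z D : full_rank Z ->
  mxder pseudo_root Z D (pseudo_root' Z D).
Proof.
rewrite /full_rank; case: ifP => _ uZ.
- have near_unit : \forall h \near (0 : R)^', gram (h *: D + Z) \in unitmx.
    exact: mxcvg_near_unitmx (mxder_cvg (mxder_gram Z D)) uZ.
  apply: (mxder_near_eq _ (pseudo_root_gram_unit uZ)
    (g := fun Y : 'M[R]_(m, p) => Y *m invmx (gram Y))).
    by apply: filterS near_unit => h; exact: pseudo_root_gram_unit.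
  apply: (mxder_eq (mxder_mul (mxder_id Z D) (mxder_invmx (mxder_gram Z D) uZ))).
  rewrite /pseudo_root' pseudo_root_gram_unit//.
  have E2 : Z^T *m (Z *m invmx (gram Z)) = 1%:M by rewrite mulmxA mulmxV.
  have E1 : (Z *m invmx (gram Z))^T *m (Z *m invmx (gram Z)) = invmx (gram Z).
    by rewrite trmx_mul trmx_inv gram_tr -mulmxA E2 mulmx1.
  rewrite E1 E2 subrr mulmx0 addr0; move: (invmx (gram Z)) => C.
  rewrite !(mulmxDl, mulmxDr, mulmxBl, mulmxN, mulmxBr, mulmxA, mul1mx, opprD).
  by rewrite !mulNmx addrA -addrA [- _ - _]addrC addrA.
- have dK : mxder (fun Y : 'M[R]_(m, p) => Y *m Y^T) Z D (D *m Z^T + Z *m D^T).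
    exact: mxder_mul (mxder_id Z D) (mxder_tr (mxder_id Z D)).
  have near_unit : \forall h \near (0 : R)^',
      (h *: D + Z) *m (h *: D + Z)^T \in unitmx.
    exact: mxcvg_near_unitmx (mxder_cvg dK) uZ.
  apply: (mxder_near_eq _ (pseudo_root_tr_unit uZ)
    (g := fun Y : 'M[R]_(m, p) => invmx (Y *m Y^T) *m Y)).
    by apply: filterS near_unit => h; exact: pseudo_root_tr_unit.
  apply: (mxder_eq (mxder_mul (mxder_invmx dK uZ) (mxder_id Z D))).
  rewrite /pseudo_root' pseudo_root_tr_unit//.
  have E2 : invmx (Z *m Z^T) *m Z *m Z^T = 1%:M by rewrite -mulmxA mulVmx.
  have E1 : (invmx (Z *m Z^T) *m Z) *m (invmx (Z *m Z^T) *m Z)^T = invmx (Z *m Z^T).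
    have -> : (invmx (Z *m Z^T) *m Z)^T = Z^T *m invmx (Z *m Z^T).
      by rewrite trmx_mul trmx_inv trmx_mul trmxK.
    by rewrite mulmxA E2 mul1mx.
  rewrite E1 E2 subrr !mul0mx add0r; move: (invmx (Z *m Z^T)) => C.
  rewrite !(mulmxDl, mulmxDr, mulmxBl, mulmxBr, mulmxN, mulmxA, mulmx1, opprD, mulNmx).
  by rewrite addrC addrA.
Qed.

Lemma mxlin_pseudo_root' Z : mxlin (pseudo_root' Z).
Proof.
have id : mxlin (fun D : 'M[R]_(m, p) => D) by split.
apply: mxlin_add; last first.
  by apply: mxlin_opp; apply: mxlin_mulr; apply: mxlin_mull; exact: mxlin_tr.
by apply: mxlin_add; apply: mxlin_mulr; apply: mxlin_mull.
Qed.

End pseudo_root.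

Section gram_field_algebra.
Context {R : realType} (m p q : nat) (x : 'M[R]_(p, q)).
Variables (u z : 'M[R]_(m, p)) (v : 'M[R]_(m, q)) (w : 'M[R]_m) (c : 'M[R]_p).
Hypotheses (ux : u *m x = v) (zc : z *m c = 0) (wz : w *m z = 0) (wT : w^T = w).
Hypotheses (vw : v^T *m w = 0) (vzu : v^T *m z *m u^T = v^T).

(** Here [w] and [c] stand for the complementary projections 1 - U Z^T and 1 - Z^T U, not for the
    hat matrix and the resolvent as in the regularised case. They annihilate Z from the left and
    from the right, which kills most traces. *)
Let dv (D : 'M[R]_(m, p)) : 'M[R]_(m, q) :=
  (w *m D *m (u^T *m u) + u *m u^T *m D *m c - u *m D^T *m u) *m x.

Let dvE D : dv D = w *m D *m (u^T *m v) + u *m u^T *m D *m (c *m x) - u *m D^T *m v.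
Proof. by rewrite /dv !(mulmxDl, mulNmx) -ux !mulmxA. Qed.

Let tr_uvvz : \tr (u^T *m (v *m v^T *m z)) = \tr (v^T *m v).
Proof.
by trace_cycle (u^T *m v) (v^T *m z); rewrite vzu.
Qed.

Let tr_c (A : 'M[R]_(p, m)) : \tr (c *m A *m z) = 0.
Proof. by rewrite mxtrace_mulC mulmxA zc mul0mx mxtrace0. Qed.

Lemma sum_dv_mul :
  \sum_i \sum_j (dv (delta_mx i j) *m v^T *m z) i j =
  (\tr w - 1) * \tr (v^T *m v).
Proof.
have E D : dv D *m v^T *m z = w *m D *m (u^T *m (v *m v^T *m z))
    + u *m u^T *m D *m (c *m (x *m v^T) *m z) + (- u) *m D^T *m (v *m v^T *m z).
  by rewrite dvE !(mulmxDl, mulNmx) !mulmxA.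
under eq_bigr => i _ do
  under eq_bigr => j _ do rewrite E [(_ + _ : 'M[R]_(m, p)) i j]mxE
    [X in X + _](mxE _ _ i j).
under eq_bigr do rewrite !big_split/=.
rewrite !big_split/= !sum_mul_delta_mul sum_mul_trdelta_mul.
by rewrite tr_c [(- u)^T]linearN/= mulNmx mxtraceN tr_uvvz; ring.
Qed.

Lemma sum_mul_tr_dv :
  \sum_i \sum_j (v *m (dv (delta_mx i j))^T *m z) i j =
  - \tr (v^T *m v) * \tr (u^T *m z).
Proof.
have E D : v *m (dv D)^T *m z = (v *m v^T *m u) *m D^T *m (w *m z)
    + (v *m (c *m x)^T) *m D^T *m (u *m u^T *m z) + (- (v *m v^T)) *m D *m (u^T *m z).
  rewrite dvE [(_ - _)^T]linearB/= [(_ + _)^T]linearD/= !trmx_mul !trmxK wT.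
  by rewrite !(mulmxDr, mulmxDl, mulmxN, mulNmx) !mulmxA.
under eq_bigr => i _ do
  under eq_bigr => j _ do rewrite E [(_ + _ : 'M[R]_(m, p)) i j]mxE
    [X in X + _](mxE _ _ i j).
under eq_bigr do rewrite !big_split/=.
rewrite !big_split/= !sum_mul_delta_mul !sum_mul_trdelta_mul.
rewrite wz mulmx0 mxtrace0 add0r mxtraceN [\tr (v *m _)]mxtrace_mulC.
have -> : (v *m (c *m x)^T)^T *m (u *m u^T *m z) = c *m (x *m v^T *m u *m u^T) *m z.
  by rewrite trmx_mul trmxK !mulmxA.
by rewrite tr_c add0r.
Qed.

Lemma sum_mul_delta :
  \sum_i \sum_j (v *m v^T *m delta_mx i j : 'M[R]_(m, p)) i j = \tr (v^T *m v) * p%:R.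
Proof.
under eq_bigr => i _ do under eq_bigr => j _ do rewrite -[v *m v^T *m _]mulmx1.
by rewrite sum_mul_delta_mul mxtrace1 [\tr (v *m _)]mxtrace_mulC.
Qed.

Lemma sum_trace_dv :
  \sum_i \sum_j \tr (v^T *m dv (delta_mx i j)) * (v *m v^T *m z) i j =
  - \tr (v^T *m v *m (v^T *m v)).
Proof.
have E D : \tr (v^T *m dv D) =
    \tr ((c *m x *m v^T *m u *m u^T - u^T *m v *m v^T) *m D).
  rewrite dvE !(mulmxDr, mulmxN) !(mulmxA v^T) vw !mul0mx add0r.
  rewrite mulmxBl !mxtraceB; congr (_ - _).
    by trace_cycle (v^T *m (u *m u^T) *m D) (c *m x).
  rewrite -mxtrace_tr !trmx_mul !trmxK.
  by trace_cycle (v^T *m D) (u^T *m v).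
under eq_bigr => i _ do under eq_bigr => j _ do rewrite E.
rewrite sum_trace_delta mulmxBl mxtraceB.
have -> : c *m x *m v^T *m u *m u^T *m (v *m v^T *m z) =
    c *m (x *m v^T *m u *m u^T *m v *m v^T) *m z by rewrite !mulmxA.
rewrite tr_c sub0r; congr (- _).
trace_cycle (u^T *m v) (v^T *m v *m v^T *m z).
by rewrite -(mulmxA (v^T *m v) v^T z) -(mulmxA (v^T *m v) (v^T *m z)) vzu -!mulmxA.
Qed.

End gram_field_algebra.

Section divergence_of_gram_field.
Context {R : realType} (m p q : nat) (x : 'M[R]_(p, q)) (Z : 'M[R]_(m, p)).
Variables (phi phi' : R -> R).
Let S := gram Z.
Let U := pseudo_root Z.
Let W := U *m Z^T.
Let v := U *m x.
Let F := Fstat x S.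

Definition gram_field (Y : 'M[R]_(m, p)) : 'M[R]_(m, p) :=
  phi (Fstat x (gram Y)) *: (Y *m mpinv (gram Y) *m x *m x^T *m mpinv (gram Y) *m gram Y).

(** As S^+ is symmetric, the direction of the field is v v^T Y with v = Y S^+ x, so that
    [pseudo_root] is the one nontrivial map to differentiate. *)
Let field_root (Y : 'M[R]_(m, p)) :
  gram_field Y = phi (fro2 (pseudo_root Y *m x)) *:
    (pseudo_root Y *m x *m (pseudo_root Y *m x)^T *m Y).
Proof.
rewrite /gram_field Fstat_gram; congr (_ *: _).
rewrite -[X in _ = X *m _ *m _ *m _]/(Y *m mpinv (gram Y)).
rewrite -!(mulmxA (_ *m x)) trmx_mul; congr (_ *m _).
rewrite -!mulmxA; congr (_ *m _).
rewrite /pseudo_root trmx_mul mpinv_tr; last by rewrite /gram trmx_mul trmxK.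
by rewrite -!mulmxA.
Qed.

Definition gram_field' (D : 'M[R]_(m, p)) : 'M[R]_(m, p) :=
  let dv := pseudo_root' Z D *m x in
  (phi' F * (2 * \tr (v^T *m dv))) *: (v *m v^T *m Z)
  + phi F *: (dv *m v^T *m Z + v *m dv^T *m Z + v *m v^T *m D).

Lemma mxlin_gram_field' : mxlin gram_field'.
Proof.
have id : mxlin (fun D : 'M[R]_(m, p) => D) by split.
have dv : mxlin (fun D => pseudo_root' Z D *m x).
  by apply: mxlin_mulr; exact: mxlin_pseudo_root'.
apply: mxlin_add; last first.
  apply: mxlin_scale; apply: mxlin_add; last exact: mxlin_mull.
  by apply: mxlin_add; apply: mxlin_mulr; [apply: mxlin_mulr|apply: mxlin_mull; exact: mxlin_tr].
have h := @mxlin_trace_scale _ m p _ _ _ _ (v *m v^T *m Z) (mxlin_mull v^T dv).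
have [h1 h2] := mxlin_scale (phi' F * 2) h.
have E t : (phi' F * (2 * t)) *: (v *m v^T *m Z) =
    (phi' F * 2) *: (t *: (v *m v^T *m Z)) by rewrite scalerA mulrA.
by split=> [D1 D2|c D]; rewrite !E; [exact: h1|exact: h2].
Qed.

Hypothesis fZ : full_rank Z.

Lemma mxder_gram_field D : is_derive F 1 phi (phi' F) ->
  mxder gram_field Z D (gram_field' D).
Proof.
move=> dphi; have dU := mxder_pseudo_root D fZ.
have FE : F = fro2 v by exact: Fstat_gram.
have dv : mxder (fun Y : 'M[R]_(m, p) => pseudo_root Y *m x) Z D (pseudo_root' Z D *m x).
  apply: (mxder_eq (mxder_mul dU (mxder_cst x Z D))).
  by rewrite mulmx0 addr0.
have dF : is_derive Z D (fun Y : 'M[R]_(m, p) => fro2 (pseudo_root Y *m x))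
    (2 * \tr (v^T *m (pseudo_root' Z D *m x))).
  have -> : (fun Y : 'M[R]_(m, p) => fro2 (pseudo_root Y *m x)) =
      (fun Y => \tr ((pseudo_root Y *m x)^T *m (pseudo_root Y *m x))).
    by apply/funext => Y; rewrite fro2E.
  have := is_derive_trace (mxder_mul (mxder_tr dv) dv).
  rewrite -/U -/v mxtraceD; move: (pseudo_root' Z D *m x) => w.
  rewrite -[X in is_derive _ _ _ (X + _)]mxtrace_tr trmx_mul trmxK.
  by rewrite mulr_natl mulr2n.
have dvv := mxder_mul (mxder_mul dv (mxder_tr dv)) (mxder_id Z D).
rewrite FE in dphi.
have dpF := @is_derive_comp_real R _ phi
  (fun Y : 'M[R]_(m, p) => fro2 (pseudo_root Y *m x)) Z D _ _ dphi dF.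
have := mxder_scale dpF dvv.
rewrite -/U -/v -FE /gram_field' => h.
have -> : gram_field = (fun Y => phi (fro2 (pseudo_root Y *m x)) *:
    (pseudo_root Y *m x *m (pseudo_root Y *m x)^T *m Y)).
  by apply/funext => Y; exact: field_root.
by apply: (mxder_eq h); rewrite mulmxDl.
Qed.

Let ZU : Z^T *m U = S *m mpinv S.
Proof. by rewrite /U /pseudo_root /S /gram !mulmxA. Qed.

Let ZP : Z *m (1%:M - Z^T *m U) = 0.
Proof. by rewrite ZU mulmxBr mulmx1 mul_gram_proj subrr. Qed.

Let W_tr : W^T = W.
Proof.
rewrite /W /U /pseudo_root !trmx_mul trmxK mpinv_tr ?mulmxA//.
by rewrite /gram trmx_mul trmxK.
Qed.

Let WU : W *m U = U.
Proof.
rewrite /W -mulmxA ZU /U /pseudo_root -mulmxA; congr (_ *m _).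
by rewrite mulmxA mpinv_gram_mpinv.
Qed.

Let Wv : W *m v = v. Proof. by rewrite /v mulmxA WU. Qed.

Let WZ : (1%:M - W) *m Z = 0.
Proof.
rewrite mulmxBl mul1mx -[X in X *m Z]W_tr /W trmx_mul trmxK.
have -> : Z *m U^T *m Z = Z *m (S *m mpinv S).
  rewrite -mulmxA; congr (_ *m _); rewrite -[LHS]trmxK trmx_mul trmxK ZU.
  exact: mpinv_gram_proj_tr.
by rewrite mul_gram_proj subrr.
Qed.

Let trW : \tr W = (\rank S)%:R.
Proof. by rewrite /W mxtrace_mulC ZU mxtrace_mul_mpinv. Qed.

Let vW : v^T *m (1%:M - W) = 0.
Proof.
rewrite -[LHS]trmxK trmx_mul trmxK linearB/= trmx1 W_tr mulmxBl mul1mx Wv subrr.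
exact: trmx0.
Qed.

Let vZU : v^T *m Z *m U^T = v^T.
Proof.
have E : Z *m U^T = W by rewrite -[RHS]W_tr [RHS]trmx_mul trmxK.
by rewrite -mulmxA E; move: vW; rewrite mulmxBr mulmx1 => /subr0_eq.
Qed.

Let FE : \tr (v^T *m v) = F. Proof. by rewrite -fro2E /F Fstat_gram. Qed.

(** With k = rank S, the three factors of v v^T Z contribute (m - k - 1) F, - k F and p F, and the
    derivative of [phi] contributes - 2 phi' T. The exact divergence thus equals the limit of the
    regularised ones, and [gram_div_bound] serves for (i) too. *)
Lemma sum_gram_field' :
  \sum_i \sum_j gram_field' (delta_mx i j) i j = gram_div m x phi phi' S.
Proof.
have Wt : (1%:M - W)^T = 1%:M - W by rewrite linearB/= trmx1 W_tr.
have trUZ : \tr (U^T *m Z) = (\rank S)%:R.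
  rewrite -mxtrace_tr [X in \tr X](_ : _ = Z^T *m U).
    by rewrite ZU mxtrace_mul_mpinv.
  by rewrite [LHS]trmx_mul trmxK.
have S1 := sum_dv_mul (1%:M - W) (erefl v) ZP vZU.
have S2 := sum_mul_tr_dv (erefl v) ZP WZ Wt.
have S3 := sum_mul_delta p v.
have S4 := sum_trace_dv (erefl v) ZP vW vZU.
have E D i j : gram_field' D i j =
    (phi' F * 2) * (\tr (v^T *m (pseudo_root' Z D *m x)) * (v *m v^T *m Z) i j)
    + phi F * ((pseudo_root' Z D *m x *m v^T *m Z) i j
      + (v *m (pseudo_root' Z D *m x)^T *m Z) i j + (v *m v^T *m D) i j).
  rewrite /gram_field'; move: (pseudo_root' Z D *m x) => w.
  move: (v *m v^T *m Z) (w *m v^T *m Z) (v *m w^T *m Z) (v *m v^T *m D) => a b c e.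
  rewrite [LHS]mxE [X in X + _ = _]mxE [X in _ + X = _]mxE [X in _ + _ * X = _]mxE
    [X in _ + _ * (X + _) = _]mxE; ring.
under eq_bigr => i _ do under eq_bigr => j _ do rewrite E.
under eq_bigr do rewrite big_split/= -!mulr_sumr !big_split/=.
rewrite big_split/= -!mulr_sumr !big_split/= S1 S2 S3 S4 FE.
rewrite mxtraceB mxtrace1 trW trUZ /gram_div -/F mxtrace_mul_mpinv.
have -> : \tr (v^T *m v *m (v^T *m v)) = Tstat x S.
  by rewrite Tstat_gram fro2_gram.
by rewrite -/S; ring.
Qed.

End divergence_of_gram_field.

(** * Passing from Y to the rescaled variable *)

Section conjugated_divergence.
Context {R : realType} (m p : nat).

Lemma mxlin_sum a b (g : 'M[R]_(m, p) -> 'M[R]_(a, b)) (I : Type) (s : seq I)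
    (c : I -> R) (D : I -> 'M[R]_(m, p)) : mxlin g ->
  g (\sum_(l <- s) c l *: D l) = \sum_(l <- s) c l *: g (D l).
Proof.
move=> [gD gZ]; elim: s => [|l s IH]; last by rewrite !big_cons gD gZ IH.
by rewrite !big_nil -[X in g X](scale0r 0) gZ scale0r.
Qed.

(** The left side is the trace of [g] conjugated by the invertible map D |-> D A, and a trace is
    invariant under conjugation. *)
Lemma sum_conjugate_delta (g : 'M[R]_(m, p) -> 'M[R]_(m, p)) (A : 'M[R]_p) :
  mxlin g -> A \in unitmx ->
  \sum_i \sum_j (g (delta_mx i j *m A) *m invmx A) i j =
  \sum_i \sum_j g (delta_mx i j) i j.
Proof.
move=> glin uA; apply: eq_bigr => i _.
have dA j : delta_mx i j *m A = \sum_l A j l *: delta_mx i l.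
  apply/matrixP => k l; rewrite summxE mxE (bigD1 j)//= big1 => [|t tj]; last first.
    by rewrite mxE (negbTE tj) andbF mul0r.
  rewrite addr0 (bigD1 l)//= big1 => [|t tl]; last first.
    by rewrite !mxE [l == t]eq_sym (negbTE tl) andbF mulr0.
  by rewrite !mxE !eqxx !andbT addr0 mulrC.
transitivity (\sum_j \sum_l \sum_k A j l * (g (delta_mx i l) i k * invmx A k j)).
  apply: eq_bigr => j _; rewrite dA mxlin_sum// mulmx_suml summxE.
  apply: eq_bigr => l _; rewrite -scalemxAl mxE [X in _ * X = _]mxE.
  by rewrite mulr_sumr.
rewrite exchange_big; apply: eq_bigr => l _; rewrite exchange_big/=.
transitivity (\sum_k g (delta_mx i l) i k * (invmx A *m A) k l).
  apply: eq_bigr => k _; rewrite [X in _ * X]mxE mulr_sumr; apply: eq_bigr => j _.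
  by ring.
rewrite mulVmx// (bigD1 l)//= big1 => [|k kl]; last by rewrite mxE (negbTE kl) mulr0.
by rewrite mxE eqxx mulr1 addr0.
Qed.

End conjugated_divergence.

Section divergence_YtildeH.
Context {R : realType} (m p q : nat) (A : 'M[R]_p) (x : 'M[R]_(p, q)) (Z : 'M[R]_(m, p)).
Variables (r : R -> R).
Hypothesis q_gt0 : (0 < q)%N.
Hypothesis uA : A \in unitmx.
Hypothesis r_derivable : forall t, derivable r t 1.
Let s : R := Num.sqrt q%:R.
Let s0 : s != 0. Proof. by rewrite gt_eqF// sqrtr_gt0 ltr0n. Qed.
Let V := gram_field x (weight r 0) (m := m).

Let YofK : Yof q A (Ytilde q A Z) = Z.
Proof.
by rewrite /Yof /Ytilde -/s -scalemxAl scalerA mulVf// scale1r mulmxKV.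
Qed.

Let YtildeHE (Yt : 'M[R]_(m, p)) :
  YtildeH r A x Yt = s *: (V (Yof q A Yt) *m invmx A).
Proof.
rewrite /YtildeH /Hmat /V /gram_field.
have E : Yt *m A = s *: Yof q A Yt by rewrite /Yof -/s scalerA divff// scale1r.
move: (Yof q A Yt) E => Y E; rewrite /Gmat /weight addr0.
set k := r _ ^+ 2 / _; move: k (mpinv (gram Y)) (gram Y) => k B T.
rewrite -!(scalemxAl, scalemxAr) !mulmxA E -!scalemxAl !scalerA.
by rewrite mulrC.
Qed.

(** Under Y = Yt A / s the scalars s and 1 / s cancel in the derivative and the factors A and A^-1
    conjugate it, so the divergence is that of [gram_field] in Y. *)
Lemma mxdiv_YtildeH : full_rank Z -> 0 < Fstat x (gram Z) ->
  mxdiv (YtildeH r A x) (Ytilde q A Z) =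
  gram_div m x (weight r 0) (weight' r 0) (gram Z).
Proof.
move=> fZ F0.
have dphi : is_derive (Fstat x (gram Z)) 1 (weight r 0)
    (weight' r 0 (Fstat x (gram Z))).
  by apply: is_derive_weight => //; rewrite addr0 exprn_gt0.
pose V' := gram_field' x Z (weight r 0) (weight' r 0).
have dV D : mxder (fun Yt : 'M[R]_(m, p) => V (Yof q A Yt)) (Ytilde q A Z) D
    (V' (Yof q A D)).
  move=> i j; apply/is_derive_along.
  have -> : (fun h : R => V (Yof q A (h *: D + Ytilde q A Z)) i j) =
      (fun h : R => V (h *: Yof q A D + Z) i j).
    apply/funext => h; congr (V _ i j); rewrite -[in RHS]YofK /Yof mulmxDl scalerDr.
    by rewrite -scalemxAl !scalerA mulrC.
  by apply/(is_derive_along (fun Y => V Y i j)); exact: mxder_gram_field.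
have dH D : mxder (YtildeH r A x) (Ytilde q A Z) D (V' (D *m A) *m invmx A).
  have -> : YtildeH r A x = (fun Yt : 'M[R]_(m, p) => s *: (V (Yof q A Yt) *m invmx A)).
    by apply/funext => Yt; exact: YtildeHE.
  have h1 := mxder_mul (dV D) (mxder_cst (invmx A) (Ytilde q A Z) D).
  have ds : is_derive (Ytilde q A Z) D (fun=> s) 0 by exact: is_derive_cst.
  apply: (mxder_eq (mxder_scale ds h1)).
  have VZ c B : V' (c *: B) = c *: V' B by exact: (mxlin_gram_field' _ _ _ _).2.
  rewrite scale0r add0r mulmx0 addr0 /Yof VZ -/s.
  by rewrite -scalemxAl scalerA divff// scale1r.
rewrite (mxdiv_mxder dH) sum_conjugate_delta//; last exact: mxlin_gram_field'.
exact: sum_gram_field'.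
Qed.

End divergence_YtildeH.

(** * The integrands of the risk identity and the conclusion *)

Lemma posdefmx_unitmx (R : realType) p (M : 'M[R]_p) : posdefmx M -> M \in unitmx.
Proof.
move=> [_ Mpos]; rewrite -row_free_unit -kermx_eq0; apply/rowV0P => v.
move=> /sub_kermxP vM; apply/eqP; rewrite -trmx_eq0; apply: contraT => /Mpos.
by rewrite trmxK vM mul0mx mxE ltxx.
Qed.

Section risk_integrands.
Context (R : realType) (m p q : nat) (r : R -> R) (x : 'M[R]_(p, q)) (S : 'M[R]_p).

Lemma gfun_quad (Lambda : 'M[R]_p) :
  \tr ((gfun r x S)^T *m Lambda *m gfun r x S) = gram_quad Lambda x (weight r 0) S.
Proof.
rewrite /gfun /gram_quad /weight addr0; move: (S *m mpinv S *m x) => v.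
rewrite [(_ *: v)^T]linearZ/= -!(scalemxAl, scalemxAr) scalerA mxtraceZ; congr (_ * _).
by rewrite mulrACA -invfM -!expr2.
Qed.

(** For phi = r^2 / t^2 the term - 2 phi' T splits into - 4 r r' T / F^2 and 4 r^2 T / F^3. *)
Lemma gram_div_weight :
  gram_div m x (weight r 0) (weight' r 0) S =
  r (Fstat x S) ^+ 2 / Fstat x S *
    (m%:R + p%:R - 2 * \tr (S *m mpinv S) - 1 + 4 * Tstat x S / Fstat x S ^+ 2)
  - 4 * r (Fstat x S) * r^`()%classic (Fstat x S) / Fstat x S ^+ 2 * Tstat x S.
Proof.
rewrite /gram_div /weight /weight' addr0.
(* At F = 0 both sides are 0 because 0^-1 = 0, so the identity holds at every point and not just
   almost surely. *)
have [->|F0] := eqVneq (Fstat x S) 0; first by rewrite !expr2 !mul0r invr0; ring.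
by field.
Qed.

End risk_integrands.

Theorem theorem3p1 (R : realType) (n p q : nat)
    (n_gt0 : (0 < n)%N) (p_gt0 : (0 < p)%N) (q_gt0 : (0 < q)%N)
    (theta : 'M[R]_(p, q)) (Sigma A : 'M[R]_p)
    (Sigma_pd : posdefmx Sigma) (A_pd : posdefmx A) (AA : A *m A = Sigma)
    (d : measure_display) (Omega : measurableType d) (P : probability Omega R)
    (X : {RV P >-> 'M[R]_(p, q)}) (Y : {RV P >-> 'M[R]_(n * q, p)})
    (X_normal : normal_matrix_cols P theta Sigma X)
    (Y_normal : normal_matrix_rows P (q%:R^-1 *: Sigma) Y)
    (XS_indep : independent P X (fun w => gram (Y w)))
    (rank_gt2 : P [set w | (2 < q * \rank (gram (Y w)))%N] = 1%E)
    (r : R -> R) (c1 c2 : R)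
    (r_bounded : forall x, 0 <= r x <= c1)
    (r_derivable : forall x, derivable r x 1)
    (dr_bounded : forall x, `|r^`()%classic x| <= c2) :
  let S w := gram (Y w) in
  let F w := Fstat (X w) (S w) in
  let g w := gfun r (X w) (S w) in
  let T w := \tr ((X w)^T *m mpinv (S w) *m X w *m
                  ((X w)^T *m mpinv (S w) *m X w)) in
  [/\ ('E_P[fun w => `|mxdiv (YtildeH r A (X w)) (Ytilde q A (Y w))|%R]
         < +oo)%E,
      ('E_P[fun w => `|mxdiv (fun x => gfun r x (S w)) (X w)|%R] < +oo)%E &
      ('E_P[fun w => \tr ((g w)^T *m invmx Sigma *m g w)%R] =
       (q%:R^-1)%:E *
       'E_P[fun w =>
         (r (F w) ^+ 2 / F w *
           ((n * q)%:R + p%:R - 2 * \tr (S w *m mpinv (S w)) - 1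
            + 4 * T w / F w ^+ 2)
          - 4 * r (F w) * r^`()%classic (F w) / F w ^+ 2 * T w)%R])%E].
Proof.
move=> S F g T.
have uA := posdefmx_unitmx A_pd; have uS := posdefmx_unitmx Sigma_pd.
have q0 : q%:R != 0 :> R by rewrite pnatr_eq0 -lt0n.
have uG : q%:R^-1 *: Sigma \in unitmx by rewrite unitmxZ ?unitfE ?invr_eq0.
have invG : invmx (q%:R^-1 *: Sigma) = q%:R *: invmx Sigma.
  by rewrite invmxZ// invrK.
have invS : invmx Sigma = invmx A *m invmx A.
  by apply: invmx_uniq; rewrite -AA mulmxA mulmxK// mulmxV.
(* sqrt q A^-1 is a root of the inverse row covariance q Sigma^-1, [A] being symmetric. *)
have invL : invmx (q%:R^-1 *: Sigma) =
    (Num.sqrt q%:R *: invmx A)^T *m (Num.sqrt q%:R *: invmx A).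
  rewrite [(_ *: _)^T]linearZ/= trmx_inv A_pd.1 -scalemxAl -scalemxAr scalerA -expr2 sqr_sqrtr//.
  by rewrite invG invS.
have mX : measurable_fun [set: Omega] X by exact: measurable_funPT.
have mY : measurable_fun [set: Omega] Y by exact: measurable_funPT.
have [aeF iF] := inv_Fstat_integrable mX mY uS uG X_normal Y_normal XS_indep rank_gt2.
have iaff (a b : R) : P.-integrable [set: Omega]
    (EFin \o (fun w => a * (F w)^-1 + b)).
  have -> : EFin \o (fun w => a * (F w)^-1 + b) =
      (fun w => a%:E * ((F w)^-1)%:E + b%:E)%E by [].
  apply: integrableD => //; first exact: integrableZl.
  exact: integrable_cst_probability.
have c12 : 0 <= c1 * c2.
  have /andP[a1 a2] := r_bounded 0.
  by rewrite mulr_ge0 ?(le_trans a1 a2)// (le_trans _ (dr_bounded 0)).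
split.
- rewrite expectation.unlock.
  (* The constant of [gram_div_bound] with m = nq. *)
  pose k : R := (n * q)%:R + 3 * p%:R + 3.
  apply: (ae_ge0_integral_lty _ (iaff (k * (2 * c1 ^+ 2)) (k * (2 * (c1 * c2))))).
    by move=> w.
  have full := normal_rows_full_rank mY uG Y_normal.
  apply: filterS2 aeF full => w Fw fw.
  rewrite (mxdiv_YtildeH q_gt0 uA r_derivable fw Fw).
  have := gram_div_bound (x := X w) (Z := Y w) (phi := weight r 0)
    (phi' := weight' r 0) (K := 2 * (c1 * c2) + 2 * c1 ^+ 2 * (F w)^-1).
  move=> /(_ _ _)/le_trans; apply.
  + apply: (le_trans (mul_weight_bound r_bounded (lexx 0) Fw)).
    have : 0 <= c1 ^+ 2 * (F w)^-1 by rewrite mulr_ge0 ?sqr_ge0// invr_ge0 ltW.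
    rewrite /F /S; lra.
  + exact: (sqr_weight'_bound r_bounded dr_bounded (lexx 0) Fw).
  by rewrite -/k mulrDr addrC !mulrA.
- rewrite expectation.unlock.
  apply: (ae_ge0_integral_lty _ (iaff (((q * p)%:R + 2) * c1) (2 * c2))).
    by move=> w.
  apply: filterS aeF => w Fw.
  exact: (mxdiv_gfun_bound r_bounded r_derivable dr_bounded Fw).
rewrite !expectation.unlock.
have main := joint_identity mX mY uS uG invL X_normal Y_normal XS_indep rank_gt2
  r_bounded r_derivable dr_bounded.
have -> : (\int[P]_w (r (F w) ^+ 2 / F w *
           ((n * q)%:R + p%:R - 2 * \tr (S w *m mpinv (S w))%R - 1
            + 4 * T w / F w ^+ 2)
          - 4 * r (F w) * r^`()%classic (F w) / F w ^+ 2 * T w)%:E =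
    \int[P]_w (gram_div (n * q) (X w) (weight r 0) (weight' r 0) (gram (Y w)))%:E)%E.
  by apply: eq_integral => w _; rewrite gram_div_weight.
rewrite main.
(* The rows of Y have covariance Sigma / q, so Stein's identity produces q Sigma^-1; this q is the
   origin of the factor 1 / q. *)
have quadE w : gram_quad (invmx (q%:R^-1 *: Sigma)) (X w) (weight r 0) (gram (Y w)) =
    q%:R * \tr ((g w)^T *m invmx Sigma *m g w).
  rewrite gfun_quad invG /gram_quad; move: (_ *m _ *m X w) => v.
  by rewrite -scalemxAr -scalemxAl mxtraceZ mulrCA.
under [in RHS]eq_integral do rewrite quadE EFinM.
(* Nonnegativity allows q to be taken out of the integral without knowing that it is finite. *)
have quad_ge0 w : 0 <= \tr ((g w)^T *m invmx Sigma *m g w).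
  rewrite -(@pmulr_rge0 _ q%:R) ?ltr0n// -quadE /gram_quad invL.
  move: (_ *m _ *m X w) (Num.sqrt _ *: _) => v L.
  rewrite mulr_ge0 ?weight_ge0//.
  have -> : v^T *m (L^T *m L) *m v = (L *m v)^T *m (L *m v) by rewrite trmx_mul !mulmxA.
  by rewrite -fro2E fro2_ge0.
have mquad : measurable_fun [set: Omega]
    (fun w => \tr ((g w)^T *m invmx Sigma *m g w)).
  have -> : (fun w => \tr ((g w)^T *m invmx Sigma *m g w)) =
      (fun w => gram_quad (invmx Sigma) (X w) (weight r 0) (gram (Y w))).
    by apply/funext => w; rewrite -gfun_quad.
  apply: measurable_gram_quad => //; first exact: measurable_gram.
  exact: measurable_weight.
rewrite ge0_integralZl_EFin//; first last.
- by apply/measurable_EFinP.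
- by move=> w _; rewrite lee_fin.
by rewrite muleA -EFinM mulVf// mul1e.
Qed.
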